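(* $\textsc{PL}^{+}_{\leq}$ is fixed-parameter tractable when parameterized by $q$ plus the treewidth of the superstructure graph.
   Context: Let $V$ be a finite set and $\mathcal{F}=\{f_v:2^{V\setminus\{v\}}\to\mathbb{N}_0 : v\in V\}$. For a digraph $D=(V,A)$ let $P_D(v)=\{u:uv\in A\}$ and $\texttt{score}(D)=\sum_v f_v(P_D(v))$. In the additive representation, $f_v(Q)=\sum_{x\in Q}f_v(\{x\})$ for all $v$, $Q\subseteq V\setminus\{v\}$, and $\mathcal{F}$ is given by the values $f_v(\{x\})$. A polytree is a digraph whose underlying undirected graph is a forest. $\textsc{PL}^{+}_{\leq}$: given $V$, $\mathcal{F}$ in the additive representation and integers $\ell,q$, decide whether there is a polytree $D$ on $V$ with every in-degree at most $q$ and $\texttt{score}(D)\geq\ell$. The superstructure graph $G=(V,E)$ has $ab\in E$ iff $f_b(\{a\})\neq0$ or $f_a(\{b\})\neq0$. *)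

(* Defs.v *)
From Corelib Require Import BinNums.
From mathcomp Require Import all_boot all_order all_algebra.
From mathcomp Require Import boolp.

Set Implicit Arguments.
Unset Strict Implicit.
Unset Printing Implicit Defensive.

(** * Model of computation

    First-order recursive LISP programs on binary trees (the functional
    counterpart "F" of the WHILE language in N. D. Jones, Computability and
    Complexity, 1997), with one time unit per evaluation step.  The only test
    is "is this tree DNil?", so values can be stored as pointers into a shared
    heap that grows by at most one cell per step; hence running times agree
    with those of Turing machines up to a polynomial. *)

Inductive data : Type :=
| DNil
| DCons of data & data.

Fixpoint data_size (d : data) : nat :=
  if d is DCons a b then (data_size a + data_size b).+1 else 1.

Inductive expr : Type :=
| EVar of nat                     (* de Bruijn index *)
| ENil
| ECons of expr & expr
| EHd of expr
| ETl of expr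
| EIf of expr & expr & expr       (* second branch when the test is DNil *)
| ELet of expr & expr
| ECall of nat & expr.            (* unary procedures, named by position *)

(* The list of procedure bodies; procedure 0 is the entry point. *)
Definition program : Type := seq expr.

Definition dhd (d : data) : data := if d is DCons a _ then a else DNil.
Definition dtl (d : data) : data := if d is DCons _ b then b else DNil.

(* [eval p env e v t]: in environment [env], [e] evaluates to [v] in exactly
   [t] steps.  A diverging evaluation has no derivation. *)
Inductive eval (p : program) : seq data -> expr -> data -> nat -> Prop :=
| EvVar env i : eval p env (EVar i) (nth DNil env i) 1
| EvNil env : eval p env ENil DNil 1
| EvCons env e1 e2 v1 v2 t1 t2 :
    eval p env e1 v1 t1 -> eval p env e2 v2 t2 ->
    eval p env (ECons e1 e2) (DCons v1 v2) (t1 + t2).+1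
| EvHd env e v t : eval p env e v t -> eval p env (EHd e) (dhd v) t.+1
| EvTl env e v t : eval p env e v t -> eval p env (ETl e) (dtl v) t.+1
| EvIfCons env e e1 e2 a b v t t1 :
    eval p env e (DCons a b) t -> eval p env e1 v t1 ->
    eval p env (EIf e e1 e2) v (t + t1).+1
| EvIfNil env e e1 e2 v t t2 :
    eval p env e DNil t -> eval p env e2 v t2 ->
    eval p env (EIf e e1 e2) v (t + t2).+1
| EvLet env e1 e2 v1 v2 t1 t2 :
    eval p env e1 v1 t1 -> eval p (v1 :: env) e2 v2 t2 ->
    eval p env (ELet e1 e2) v2 (t1 + t2).+1
| EvCall env f e v1 v2 t1 t2 :
    eval p env e v1 t1 -> eval p [:: v1] (nth ENil p f) v2 t2 ->
    eval p env (ECall f e) v2 (t1 + t2).+1.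

Definition runs (p : program) (input output : data) (t : nat) : Prop :=
  eval p [:: input] (nth ENil p 0) output t.

(** * Encodings *)

Definition enc_bool (b : bool) : data := if b then DCons DNil DNil else DNil.

Definition enc_seq (s : seq data) : data := foldr DCons DNil s.

(* Binary, least significant bit first. *)
Fixpoint bits_of_pos (m : positive) : seq bool :=
  match m with
  | xH => [:: true]
  | xO m' => false :: bits_of_pos m'
  | xI m' => true :: bits_of_pos m'
  end.

Definition bits_of_nat (m : nat) : seq bool :=
  if bin_of_nat m is Npos b then bits_of_pos b else [::].

Definition enc_nat (m : nat) : data :=
  enc_seq [seq enc_bool b | b <- bits_of_nat m].

Definition enc_int (z : int) : data :=
  DCons (enc_bool (z < 0)%R) (enc_nat `|z|%N).

(** * Parameterized problems *)

Record param_problem : Type := ParamProblem {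
  pp_instance : Type;
  pp_encode : pp_instance -> data;
  pp_yes : pp_instance -> Prop;
  pp_parameter : pp_instance -> nat
}.

Definition computable (f : nat -> nat) : Prop :=
  exists p : program, forall m : nat, exists t : nat,
    runs p (enc_nat m) (enc_nat (f m)) t.

(* The value of the parameter only enters the time bound; it is not handed to
   the algorithm. *)
Definition fixed_parameter_tractable (L : param_problem) : Prop :=
  exists (p : program) (f : nat -> nat) (c : nat),
    computable f /\
    forall x : pp_instance L, exists (b : bool) (t : nat),
      [/\ runs p (pp_encode x) (enc_bool b) t,
          b = true <-> pp_yes x &
          t <= f (pp_parameter x) * data_size (pp_encode x) ^ c].

(** * Graphs and treewidth

    A simple graph is a symmetric irreflexive relation on a finite type. *)

(* For symmetric [e], every edge is traversed back and forth by a [ucycle] of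
   size 2, so genuine cycles are those of size at least 3. *)
Definition acyclic (T : finType) (e : rel T) : Prop :=
  forall c : seq T, ucycle e c -> size c < 3.

Definition forest (T : finType) (e : rel T) : Prop :=
  [/\ symmetric e, irreflexive e & acyclic e].

Definition tree (T : finType) (e : rel T) : Prop :=
  [/\ forest e, 0 < #|T| & forall x y : T, connect e x y].

Definition tree_decomposition (V T : finType) (g : rel V) (e : rel T)
    (bag : T -> {set V}) : Prop :=
  [/\ tree e,
      forall v : V, exists t : T, v \in bag t,
      forall u v : V, g u v -> exists t : T, (u \in bag t) && (v \in bag t) &
      forall (v : V) (s t : T), v \in bag s -> v \in bag t ->
        connect [rel a b | [&& e a b, v \in bag a & v \in bag b]] s t].

(* On the graph with no vertices this is 0 rather than -1. *)
Definition width (V T : finType) (bag : T -> {set V}) : nat :=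
  (\max_(t : T) #|bag t|).-1.

Definition has_decomposition_of_width (V : finType) (g : rel V) (k : nat) : Prop :=
  exists (T : finType) (e : rel T) (bag : T -> {set V}),
    tree_decomposition g e bag /\ width bag = k.

Lemma has_decomposition (V : finType) (g : rel V) :
  exists k : nat, `[< has_decomposition_of_width g k >].
Proof.
exists (width (fun _ : unit => [set: V])); apply/asboolP.
exists unit, (fun _ _ => false), (fun _ => [set: V]); split=> //.
split.
- split; [split=> // | by rewrite card_unit | by case; case].
  by case=> [|x [|y s]] //=; rewrite /ucycle /=.
- by move=> v; exists tt; rewrite inE.
- by move=> u v _; exists tt; rewrite !inE.
- by move=> v [] [] _ _; exact: connect0.
Qed.

Definition treewidth (V : finType) (g : rel V) : nat :=
  ex_minn (has_decomposition g).

(** * Polytree learning with additive scores *)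

Definition parents (V : finType) (D : rel V) (v : V) : {set V} :=
  [set u | D u v].

Definition underlying (V : finType) (D : rel V) : rel V :=
  [rel u v | D u v || D v u].

(* A pair of opposite arcs is a (directed) cycle, giving two parallel edges in
   the underlying undirected graph; it cannot be seen in the simple graph
   [underlying D] and is excluded by the first conjunct. *)
Definition polytree (V : finType) (D : rel V) : Prop :=
  (forall u v : V, D u v -> ~~ D v u) /\ forest (underlying D).

(* [score_fun v Q] is f_v(Q); it is meaningful only for [v \notin Q]. *)
Record PL_instance : Type := PLInstance {
  num_vertices : nat;
  score_fun : 'I_num_vertices -> {set 'I_num_vertices} -> nat;
  score_additive : forall (v : 'I_num_vertices) (Q : {set 'I_num_vertices}),
    v \notin Q -> score_fun v Q = \sum_(x in Q) score_fun v [set x];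
  target : int;
  max_indegree : int
}.

Definition score (I : PL_instance) (D : rel 'I_(num_vertices I)) : nat :=
  \sum_(v < num_vertices I) score_fun v (parents D v).

Definition PL_yes (I : PL_instance) : Prop :=
  exists D : rel 'I_(num_vertices I),
    [/\ polytree D,
        forall v, ((#|parents D v|)%:Z <= max_indegree I)%R &
        (target I <= (score D)%:Z)%R].

Definition superstructure (I : PL_instance) : rel 'I_(num_vertices I) :=
  [rel a b | (a != b) &&
     ((score_fun b [set a] != 0) || (score_fun a [set b] != 0))].

(* The square table of the f_v({x}), with 0 in the meaningless entries x = v. *)
Definition PL_encode (I : PL_instance) : data :=
  let V := enum 'I_(num_vertices I) in
  let entry v x := if x == v then 0 else score_fun v [set x] in
  let table := enc_seq [seq enc_seq [seq enc_nat (entry v x) | x <- V] | v <- V] in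
  enc_seq [:: table; enc_int (target I); enc_int (max_indegree I)].

(* A parameter is a natural number, so a negative q counts as 0. *)
Definition PL_parameter (I : PL_instance) : nat :=
  `|Num.max 0%R (max_indegree I)|%N + treewidth (@superstructure I).

Definition PL_additive_bounded : param_problem :=
  {| pp_instance := PL_instance;
     pp_encode := PL_encode;
     pp_yes := PL_yes;
     pp_parameter := PL_parameter |}.

(* Main.v *)
From Corelib Require Import BinNums.
From mathcomp Require Import all_boot all_order all_algebra.
From mathcomp Require Import boolp zify ring.
Require Import Defs.

Set Implicit Arguments.
Unset Strict Implicit.
Unset Printing Implicit Defensive.

(** A set of arcs is a polytree with in-degrees at most [q] if and only if it is
    independent in two matroids on the ordered pairs of vertices: the graphic
    matroid, in which opposite arcs are parallel elements, and the partition
    matroid that allows at most [q] arcs with the same head.  As scores are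
    additive, the problem is an instance of weighted matroid intersection and is
    solved in polynomial time: starting from the empty set, augment along a
    shortest path of the exchange graph (found by the Bellman-Ford method) as
    long as there is one; the k-th set obtained has maximal score among the
    polytrees with k arcs.  This optimality is certified by a splitting
    [w = w1 + w2] of the weights such that the set is [w1]-maximal in the first
    matroid and [w2]-maximal in the second; the splitting for the next set is
    read off the shortest-path distances. *)

(** The obstacle in an augmentation is that every exchange along a walk is legal alone while all of
    them together may destroy independence. The remedy is to choose, among the cheapest walks, one
    with the fewest vertices: in each matroid the exchanges then preserve the new weights and are
    triangular within each weight class, so they can be undone one at a time. Multiplying costs by a
    number larger than any length builds this tie-break into the costs. Bellman-Ford also requires
    that there be no negative cycle; the current splitting of the weights serves as a potential that
    excludes one. Weights are written in binary, so the algorithm is confined to additions and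
    comparisons of natural numbers; negative terms are moved across inequalities and products are
    repeated sums. Programs are never written out as a whole: polynomial-time functions are shown to
    be closed under composition, branching and bounded loops. The delicate closure is the loop,
    where the size of the state must be bounded in advance for all rounds. *)

Lemma data_size_gt0 d : 0 < data_size d.
Proof. by case: d. Qed.

Lemma leq_exp_base m n k : m <= n -> m ^ k <= n ^ k.
Proof. by move=> le_mn; case: k => // k; rewrite leq_exp2r. Qed.

(** * Linking programs *)

(* A call out of the range of the original program evaluates to [DNil]; the
   [ELet] reproduces this, with the same running time. *)
Fixpoint relocate (k s : nat) (e : expr) : expr :=
  match e with
  | EVar i => EVar i
  | ENil => ENil
  | ECons a b => ECons (relocate k s a) (relocate k s b)
  | EHd a => EHd (relocate k s a)
  | ETl a => ETl (relocate k s a)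
  | EIf a b c => EIf (relocate k s a) (relocate k s b) (relocate k s c)
  | ELet a b => ELet (relocate k s a) (relocate k s b)
  | ECall f a =>
      if f < s then ECall (k + f) (relocate k s a) else ELet (relocate k s a) ENil
  end.

Lemma eval_relocate p q k :
  (forall i, i < size p ->
     nth ENil q (k + i) = relocate k (size p) (nth ENil p i)) ->
  forall env e v t, eval p env e v t -> eval q env (relocate k (size p) e) v t.
Proof.
move=> qE env e v t; elim=> {env e v t} /=; try by [constructor | econstructor; eauto].
move=> env f e v1 v2 t1 t2 _ IH1 ev2 IH2; case: ltnP => [f_lt | f_ge].
  by apply: EvCall IH1 _; rewrite qE.
move: ev2; rewrite nth_default // => ev2; inversion ev2; subst.
by apply: EvLet IH1 _; constructor.
Qed.

Lemma eval_linked pre p post env e v t :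
  eval p env e v t ->
  eval (pre ++ [seq relocate (size pre) (size p) i | i <- p] ++ post) env
    (relocate (size pre) (size p) e) v t.
Proof.
apply: eval_relocate => i i_lt.
rewrite nth_cat ltnNge leq_addr /= addKn nth_cat size_map i_lt.
by rewrite (nth_map ENil).
Qed.

Lemma eval_call_linked pre b p post env e d v t1 t2 :
  runs (b :: p) d v t2 ->
  eval (pre ++ [seq relocate (size pre) (size p).+1 i | i <- b :: p] ++ post) env e d t1 ->
  eval (pre ++ [seq relocate (size pre) (size p).+1 i | i <- b :: p] ++ post) env
    (ECall (size pre) e) v (t1 + t2).+1.
Proof.
move=> run ev; apply: EvCall ev _.
rewrite nth_cat ltnn subnn /=.
exact: (eval_linked pre post run).
Qed.

(** * Polynomial bounds *)

(** The base is at least 2, so a single exponent absorbs constant factors and summands, and no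
    leading coefficients have to be carried. *)
Definition poly_bounded (X : Type) (e : X -> data) (g : X -> nat) : Prop :=
  exists c, forall x, g x <= (data_size (e x)).+1 ^ c.

Section PolyBounded.
Variable X : Type.
Implicit Types (e : X -> data) (g h : X -> nat).

Lemma poly_bounded_le e g h :
  poly_bounded e h -> (forall x, g x <= h x) -> poly_bounded e g.
Proof. by move=> [c hc] gh; exists c => x; apply: leq_trans (hc x). Qed.

Lemma poly_bounded_const e n : poly_bounded e (fun _ => n).
Proof.
exists n => x; apply: leq_trans (ltnW (ltn_expl n (ltnSn 1))) _.
by apply: leq_exp_base; rewrite ltnS data_size_gt0.
Qed.

Lemma poly_bounded_mul e g h :
  poly_bounded e g -> poly_bounded e h -> poly_bounded e (fun x => g x * h x).
Proof.
by move=> [c gc] [d hd]; exists (c + d) => x; rewrite expnD leq_mul.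
Qed.

Lemma poly_bounded_add e g h :
  poly_bounded e g -> poly_bounded e h -> poly_bounded e (fun x => g x + h x).
Proof.
move=> pg ph.
(* A sum is at most the product of the successors, and a successor costs one more factor of a base
   that is at least 2. *)
have pk : poly_bounded e (fun x => (g x).+1 * (h x).+1).
  have aux (k : X -> nat) : poly_bounded e k -> poly_bounded e (fun x => (k x).+1).
    case=> c kc; exists c.+1 => x; rewrite expnS.
    have := kc x; have := data_size_gt0 (e x).
    have : 0 < (data_size (e x)).+1 ^ c by rewrite expn_gt0.
    by move: (data_size _) => b; move: (b.+1 ^ c) (k x) => a d; nia.
  by apply: poly_bounded_mul; apply: aux.
by apply: poly_bounded_le pk _ => x; nia.
Qed.

Lemma poly_bounded_exp e g k :
  poly_bounded e g -> poly_bounded e (fun x => g x ^ k).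
Proof.
move=> pg; elim: k => [|k IHk]; first by apply: (poly_bounded_const e 1).
by apply: poly_bounded_le (poly_bounded_mul pg IHk) _ => x; rewrite expnS.
Qed.

Lemma poly_bounded_size e : poly_bounded e (fun x => data_size (e x)).
Proof. by exists 1 => x; rewrite expn1. Qed.

Lemma poly_bounded_ctx e e' g :
  poly_bounded e g -> poly_bounded e' (fun x => data_size (e x)) ->
  poly_bounded e' g.
Proof.
move=> [c gc] pe.
have := poly_bounded_exp c (poly_bounded_add pe (poly_bounded_const e' 1)).
by move/poly_bounded_le; apply => x; rewrite addn1.
Qed.

End PolyBounded.

Lemma poly_bounded_pull (X Y : Type) (pi : Y -> X) (e : X -> data) g :
  poly_bounded e g -> poly_bounded (e \o pi) (g \o pi).
Proof. by case=> c gc; exists c => y; apply: gc. Qed.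

(** * Polynomial-time functions *)

(* A polynomial bound on the time alone would not compose: sharing lets a program
   build a value of exponential size in linear time, hence the bound on the size
   of [F x]. *)

Definition polytime (X : Type) (e F : X -> data) : Prop :=
  exists (b : expr) (p : program) (T : X -> nat),
    [/\ forall x, exists2 t, runs (b :: p) (e x) (F x) t & t <= T x,
        poly_bounded e T & poly_bounded e (fun x => data_size (F x))].

Lemma polytime_ext (X : Type) (e e' F G : X -> data) :
  polytime e F -> e =1 e' -> F =1 G -> polytime e' G.
Proof. by move=> ptF /funext <- /funext <-. Qed.

(** A program sees only the encoding, so one for the family [e] serves every reindexing of it. This
    transports a fact about [x] to contexts that consist of [x] and further local data. *)
Lemma polytime_pull (X Y : Type) (pi : Y -> X) (e F : X -> data) :
  polytime e F -> polytime (fun y => e (pi y)) (fun y => F (pi y)).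
Proof.
case=> b [p [T [run pT pF]]]; exists b, p, (T \o pi); split.
- by move=> y; apply: run.
- exact: (poly_bounded_pull pi pT).
- exact: (poly_bounded_pull pi pF).
Qed.

Section Basic.
Variable X : Type.
Implicit Types (e F G : X -> data).

Lemma polytime_simple (b : expr) e F k :
  (forall x, eval [:: b] [:: e x] b (F x) k) ->
  poly_bounded e (fun x => data_size (F x)) -> polytime e F.
Proof.
move=> run pF; exists b, [::], (fun _ => k); split=> //; last exact: poly_bounded_const.
by move=> x; exists k => //; apply: run.
Qed.

Lemma polytime_id e : polytime e e.
Proof.
apply: (@polytime_simple (EVar 0) _ _ 1); last exact: poly_bounded_size.
by move=> x; apply: (EvVar _ [:: e x] 0).
Qed.

Lemma polytime_comp e F G : polytime e F -> polytime F G -> polytime e G.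
Proof.
move=> [b1 [p1 [T1 [run1 pT1 pF]]]] [b2 [p2 [T2 [run2 pT2 pG]]]].
(* The linked program has the main procedure at position 0, the first program at positions 1 to
   [(size p1).+1], and the second one from position [k] on. *)
pose k := (size p1).+2.
exists (ECall k (ECall 1 (EVar 0))),
  ([seq relocate 1 (size p1).+1 i | i <- b1 :: p1] ++
   [seq relocate k (size p2).+1 i | i <- b2 :: p2]), (fun x => (T1 x + T2 x).+4); split.
- move=> x; have [t1 r1 le1] := run1 x; have [t2 r2 le2] := run2 x.
  exists ((1 + t1).+1 + t2).+1; last by lia.
  rewrite /runs [nth _ _ _]/=.
  set main := ECall k _; set l1 := map _ (b1 :: p1); set l2 := map _ (b2 :: p2).
  have := @eval_call_linked [:: main] b1 p1 l2 [:: e x] (EVar 0) (e x) (F x) 1 t1 r1.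
  have := @eval_call_linked (main :: l1) b2 p2 [::] [:: e x]
            (ECall 1 (EVar 0)) (F x) (G x) (1 + t1).+1 t2 r2.
  rewrite cats0 [size (main :: l1)]/= size_map -/k -/l1 -/l2 /= => ev2 ev1.
  by apply/ev2/ev1; apply: (EvVar _ [:: e x] 0).
- apply: (@poly_bounded_le _ _ _ (fun x => T1 x + T2 x + 4)); last by move=> x; lia.
  apply: poly_bounded_add; last exact: poly_bounded_const.
  exact/poly_bounded_add/(poly_bounded_ctx pT2).
- exact: poly_bounded_ctx pG pF.
Qed.

Lemma polytime_cons e F G :
  polytime e F -> polytime e G -> polytime e (fun x => DCons (F x) (G x)).
Proof.
move=> [b1 [p1 [T1 [run1 pT1 pF]]]] [b2 [p2 [T2 [run2 pT2 pG]]]].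
pose k := (size p1).+2.
exists (ECons (ECall 1 (EVar 0)) (ECall k (EVar 0))),
  ([seq relocate 1 (size p1).+1 i | i <- b1 :: p1] ++
   [seq relocate k (size p2).+1 i | i <- b2 :: p2]), (fun x => T1 x + T2 x + 5); split.
- move=> x; have [t1 r1 le1] := run1 x; have [t2 r2 le2] := run2 x.
  exists ((1 + t1).+1 + (1 + t2).+1).+1; last by lia.
  rewrite /runs [nth _ _ _]/=.
  set main := ECons _ _; set l1 := map _ (b1 :: p1); set l2 := map _ (b2 :: p2).
  have := @eval_call_linked [:: main] b1 p1 l2 [:: e x] (EVar 0) (e x) (F x) 1 t1 r1.
  have := @eval_call_linked (main :: l1) b2 p2 [::] [:: e x]
            (EVar 0) (e x) (G x) 1 t2 r2.
  rewrite cats0 [size (main :: l1)]/= size_map -/k -/l1 -/l2 /= => ev2 ev1.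
  by apply: EvCons; [apply: ev1 | apply: ev2]; apply: (EvVar _ [:: e x] 0).
- apply: poly_bounded_add; last exact: poly_bounded_const.
  exact/poly_bounded_add.
- have := poly_bounded_add (poly_bounded_add pF pG) (poly_bounded_const e 1).
  by move/poly_bounded_le; apply => x /=; lia.
Qed.

Lemma polytime_hd e F : polytime e F -> polytime e (fun x => dhd (F x)).
Proof.
move/polytime_comp; apply; apply: (@polytime_simple (EHd (EVar 0)) _ _ 2).
  by move=> x; apply: EvHd; apply: (EvVar _ [:: F x] 0).
by apply: poly_bounded_le (poly_bounded_size F) _ => x; case: (F x) => //= a b; lia.
Qed.

Lemma polytime_tl e F : polytime e F -> polytime e (fun x => dtl (F x)).
Proof.
move/polytime_comp; apply; apply: (@polytime_simple (ETl (EVar 0)) _ _ 2).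
  by move=> x; apply: EvTl; apply: (EvVar _ [:: F x] 0).
by apply: poly_bounded_le (poly_bounded_size F) _ => x; case: (F x) => //= a b; lia.
Qed.

Lemma polytime_nil e : polytime e (fun _ => DNil).
Proof.
apply: (@polytime_simple ENil _ _ 1); last exact: poly_bounded_const.
by move=> x; constructor.
Qed.

Lemma polytime_const e d : polytime e (fun _ => d).
Proof.
by elim: d => [|a ? b ?]; [apply: polytime_nil | apply: polytime_cons].
Qed.

(** Test and both branches are evaluated first and packed into one value, from which the program
    merely selects. Evaluating the branch not taken is harmless, since all three functions are total
    and polynomial-time. *)
Lemma polytime_if_cons e C F G :
  polytime e C -> polytime e F -> polytime e G ->
  polytime e (fun x => if C x is DCons _ _ then F x else G x).
Proof.
move=> ptC ptF ptG; have := polytime_cons ptC (polytime_cons ptF ptG).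
move/polytime_comp; apply.
set H := fun x => _.
exists (EIf (EHd (EVar 0)) (EHd (ETl (EVar 0))) (ETl (ETl (EVar 0)))), [::], (fun=> 10); split.
- move=> x; exists (2 + 3).+1 => //; rewrite /runs /=.
  have v0 p : eval p [:: H x] (EVar 0) (H x) 1 by apply: (EvVar _ [:: H x] 0).
  have hdv p : eval p [:: H x] (EHd (EVar 0)) (C x) 2 by apply: EvHd (v0 p).
  case E : (C x) hdv => [|a b] hdv.
    by apply: EvIfNil; [exact: hdv | apply: EvTl (EvTl (v0 _))].
  by apply: EvIfCons; [exact: hdv | apply: EvHd (EvTl (v0 _))].
- exact: poly_bounded_const.
- apply: poly_bounded_le (poly_bounded_size H) _ => x; rewrite /H /=.
  by case: (C x) => [|? ?] /=; lia.
Qed.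

Lemma polytime_if e (b : X -> bool) F G :
  polytime e (fun x => enc_bool (b x)) -> polytime e F -> polytime e G ->
  polytime e (fun x => if b x then F x else G x).
Proof.
move=> ptb ptF ptG; apply: polytime_ext (polytime_if_cons ptb ptF ptG) _ _ => // x.
by case: (b x).
Qed.

Lemma polytime_bool_if e (b c d : X -> bool) :
  polytime e (fun x => enc_bool (b x)) -> polytime e (fun x => enc_bool (c x)) ->
  polytime e (fun x => enc_bool (d x)) ->
  polytime e (fun x => enc_bool (if b x then c x else d x)).
Proof.
move=> ptb ptc ptd; apply: polytime_ext (polytime_if ptb ptc ptd) _ _ => // x.
by case: (b x).
Qed.

Lemma polytime_neg e (b : X -> bool) :
  polytime e (fun x => enc_bool (b x)) -> polytime e (fun x => enc_bool (~~ b x)).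
Proof.
move=> ptb; exact: (@polytime_bool_if e b (fun=> false) (fun=> true) ptb
  (polytime_const _ (enc_bool false)) (polytime_const _ (enc_bool true))).
Qed.

Lemma polytime_and e (b c : X -> bool) :
  polytime e (fun x => enc_bool (b x)) -> polytime e (fun x => enc_bool (c x)) ->
  polytime e (fun x => enc_bool (b x && c x)).
Proof.
move=> ptb ptc; exact: (@polytime_bool_if e b c (fun=> false) ptb ptc
  (polytime_const _ (enc_bool false))).
Qed.

Lemma polytime_or e (b c : X -> bool) :
  polytime e (fun x => enc_bool (b x)) -> polytime e (fun x => enc_bool (c x)) ->
  polytime e (fun x => enc_bool (b x || c x)).
Proof.
move=> ptb ptc; exact: (@polytime_bool_if e b (fun=> true) c ptb
  (polytime_const _ (enc_bool true)) ptc).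
Qed.

Lemma polytime_xor e (b c : X -> bool) :
  polytime e (fun x => enc_bool (b x)) -> polytime e (fun x => enc_bool (c x)) ->
  polytime e (fun x => enc_bool (b x (+) c x)).
Proof.
move=> ptb ptc.
apply: polytime_ext (polytime_bool_if ptb (polytime_neg ptc) ptc) _ _ => // x.
by case: (b x).
Qed.

Lemma polytime_bounded e F :
  polytime e F -> poly_bounded e (fun x => data_size (F x)).
Proof. by case=> b [p [T []]]. Qed.

(** Contexts are nested pairs with the most recent local value in front: [polytime_here] reads that
    value and [polytime_skip] passes over it, as with de Bruijn indices. *)
Lemma polytime_here F e : polytime (fun x => DCons (F x) (e x)) F.
Proof. exact: (polytime_hd (polytime_id (fun x => DCons (F x) (e x)))). Qed.

Lemma polytime_skip F G e :
  polytime e F -> polytime (fun x => DCons (G x) (e x)) F.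
Proof.
exact: (polytime_comp (polytime_tl (polytime_id (fun x => DCons (G x) (e x))))).
Qed.

End Basic.

Lemma polytime_weaken (X : Type) (A : X -> Type) (G : {x : X & A x} -> data)
    (e F : X -> data) :
  polytime e F -> polytime (fun u => DCons (G u) (e (projT1 u))) (fun u => F (projT1 u)).
Proof. by move=> ptF; apply/polytime_skip/(polytime_pull (@projT1 X A)). Qed.

(** * Loops with a bound on the state *)

Section Iteration.
Variables (X : Type) (e : X -> data) (l : X -> seq data) (S : X -> nat -> data).
Variable B : X -> nat.
Hypothesis ptl : polytime e (fun x => enc_seq (l x)).
Hypothesis pt0 : polytime e (fun x => S x 0).
Hypothesis pB : poly_bounded e B.
Hypothesis SB : forall x i, i <= size (l x) -> data_size (S x i) <= B x.

Let U := {xi : X * nat | xi.2 < size (l xi.1)}.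

Hypothesis ptS : polytime
  (fun u : U => DCons (S (val u).1 (val u).2) (e (val u).1))
  (fun u : U => S (val u).1 (val u).2.+1).

(** The argument consists of the remaining clock, the state and the context. The step program,
    linked at position 1, receives the last two, which is the layout in [ptS]. *)
Let loop : expr :=
  EIf (EHd (EVar 0))
    (ECall 0 (ECons (ETl (EHd (EVar 0)))
       (ECons (ECall 1 (ETl (EVar 0))) (ETl (ETl (EVar 0))))))
    (EHd (ETl (EVar 0))).

(** The list [l x] is only a clock; its elements are not inspected. A polynomial-time step could
    square the size of the state in every round, hence the bound [B] on all states. As [U] contains
    only rounds that occur, the step has to be right and fast just on the states reached. *)
Lemma polytime_iter : polytime e (fun x => S x (size (l x))).
Proof.
have := polytime_cons ptl (polytime_cons pt0 (polytime_id e)).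
move/polytime_comp; apply; set H := fun x => _.
have [b [p [T [run [c Tc] _]]]] := ptS.
(* The argument of a step has size at most [B x + data_size (e x) + 1], so [M x] bounds the time of
   every step. *)
pose M x := (B x + data_size (e x) + 2) ^ c.
have eH : poly_bounded H (fun x => data_size (e x)).
  by apply: poly_bounded_le (poly_bounded_size H) _ => x; rewrite /H /=; lia.
have pBH := poly_bounded_ctx pB eH.
have pM : poly_bounded H M.
  apply: poly_bounded_exp; apply: poly_bounded_add; last exact: poly_bounded_const.
  exact: poly_bounded_add.
exists loop, [seq relocate 1 (size p).+1 i | i <- b :: p],
  (fun x => data_size (H x) * (M x + 30) + 30); split; last first.
- by apply: poly_bounded_le pBH _ => x; apply: SB.
- apply: poly_bounded_add; last exact: poly_bounded_const.
  apply: poly_bounded_mul; first exact: poly_bounded_size.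
  by apply: poly_bounded_add pM _; apply: poly_bounded_const.
move=> x; set prog := loop :: _.
have loopP k i s : size s = k -> i + k = size (l x) ->
  exists2 t, eval prog [:: DCons (enc_seq s) (DCons (S x i) (e x))] loop
               (S x (size (l x))) t & t <= k * (M x + 30) + 10.
  elim: k i s => [|k IHk] i [|a s] //= => [_|[sz_s]] ik.
    exists (2 + 3).+1 => //; rewrite -ik addn0.
    set env := [:: _].
    have v0 : eval prog env (EVar 0) (DCons DNil (DCons (S x i) (e x))) 1.
      exact: (EvVar _ env 0).
    by apply: EvIfNil; [exact: EvHd v0 | exact: EvHd (EvTl v0)].
  have lt_i : (x, i).2 < size (l (x, i).1) by rewrite /=; lia.
  have [t1 run1 le1] := run (exist _ (x, i) lt_i).
  have [|t2 run2 le2] := IHk i.+1 s sz_s; first by lia.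
  set env := [:: _].
  have v0 : eval prog env (EVar 0)
     (DCons (DCons a (enc_seq s)) (DCons (S x i) (e x))) 1.
    exact: (EvVar _ env 0).
  have := @eval_call_linked [:: loop] b p [::] env (ETl (EVar 0)) _ _ 2 t1 run1.
  rewrite cats0 [_ ++ _]/= -/prog => /(_ (EvTl v0)) /= evS.
  have evarg := EvCons (EvTl (EvHd v0)) (EvCons evS (EvTl (EvTl v0))).
  have := @EvCall prog env 0 _ _ _ _ _ evarg run2; set t3 := (_ + t2).+1 => evc.
  have [a' [b' evt]] : exists a' b', eval prog env (EHd (EVar 0)) (DCons a' b') 2.
    by exists a, (enc_seq s); apply: (EvHd v0).
  exists (2 + t3).+1; first exact: EvIfCons evt evc.
  have : t1 <= M x.
    apply: leq_trans le1 (leq_trans (Tc _) _) => /=.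
    by apply: leq_exp_base; have := @SB x i; lia.
  by rewrite /t3 mulSn; lia.
have [t evt let_] := loopP _ 0 (l x) erefl erefl.
exists t => //; apply: leq_trans let_ _.
have : size (l x) <= data_size (H x).
  rewrite /H /=; suff : size (l x) <= data_size (enc_seq (l x)) by lia.
  by elim: (l x) => //= d s; lia.
by move: (data_size (H x)) (M x) => h m; nia.
Qed.

End Iteration.

(** * Lists *)

Lemma size_enc_seq s :
  data_size (enc_seq s) = (\sum_(d <- s) (data_size d).+1).+1.
Proof. by elim: s => [|d s IHs] /=; rewrite ?big_nil // big_cons IHs; lia. Qed.

Lemma size_le_enc_seq s : size s <= data_size (enc_seq s).
Proof. by elim: s => //= d s; lia. Qed.

Lemma size_enc_seq_le (A : eqType) (F : A -> data) C s :
  (forall a, a \in s -> data_size (F a) <= C) ->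
  data_size (enc_seq [seq F a | a <- s]) <= 1 + size s * C.+1.
Proof.
elim: s => //= a s IHs le_C.
have := le_C a (mem_head _ _).
have := IHs (fun b bs => le_C b (mem_behead (s := a :: s) bs)).
by rewrite mulSn; lia.
Qed.

Lemma leq_sum_take (A : Type) (F : A -> nat) i (s : seq A) :
  \sum_(a <- take i s) F a <= \sum_(a <- s) F a.
Proof. by rewrite -{2}(cat_take_drop i s) big_cat leq_addr. Qed.

Lemma size_enc_seq_filter (A : Type) (F : A -> data) (p : pred A) (s : seq A) :
  data_size (enc_seq [seq F a | a <- s & p a]) <= data_size (enc_seq [seq F a | a <- s]).
Proof. by elim: s => //= a s IHs; case: (p a) => /=; lia. Qed.

Lemma measure_foldl (A B : Type) (f : B -> A -> B) (m : B -> nat) (h : A -> nat) b s :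
  (forall b a, m (f b a) <= m b + h a) -> m (foldl f b s) <= m b + \sum_(a <- s) h a.
Proof.
move=> mf; elim: s b => [|a s IHs] b /=; rewrite ?big_nil ?addn0 // big_cons.
by have := IHs (f b a); have := mf b a; lia.
Qed.

(** * Folding over encoded lists *)

Section Lists.
Variables (X : Type) (e : X -> data) (A : X -> Type) (encA : forall x, A x -> data).
Variable L : forall x, seq (A x).
Hypothesis ptL : polytime e (fun x => enc_seq [seq encA a | a <- L x]).

Let ctxA (u : {x : X & A x}) : data := DCons (encA (projT2 u)) (e (projT1 u)).

(** Each element of the list is no larger than the encoded list, so one bound [M] serves all terms,
    and there are at most as many terms as the size of that encoding. *)
Lemma sum_poly_bounded (h : forall x, A x -> nat) :
  poly_bounded ctxA (fun u => h (projT1 u) (projT2 u)) ->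
  poly_bounded e (fun x => \sum_(a <- L x) h x a).
Proof.
case=> c hc; have pL := polytime_bounded ptL; set SL := fun x => _ in pL.
have pb : poly_bounded e (fun x => SL x * (SL x + data_size (e x) + 2) ^ c).
  apply/poly_bounded_mul/poly_bounded_exp/poly_bounded_add => //.
    exact/poly_bounded_add/poly_bounded_size.
  exact: poly_bounded_const.
apply: poly_bounded_le pb _ => x.
set M := (_ + _ + _) ^ _.
have aux s : \sum_(a <- s) data_size (encA a) <= SL x ->
    \sum_(a <- s) h x a <= \sum_(a <- s) M.
  elim: s => [|a s IHs]; rewrite ?big_nil // !big_cons => le_s.
  apply: leq_add; last by apply: IHs; lia.
  apply: leq_trans (hc (existT _ x a)) _; apply: leq_exp_base => /=; lia.
have le1 : \sum_(a <- L x) data_size (encA a) <= SL x.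
  rewrite /SL size_enc_seq big_map; apply: leqW.
  by apply: leq_sum => a _.
apply: leq_trans (aux _ le1) _; rewrite big_const_seq count_predT iter_addn_0 mulnC.
apply: leq_mul => //; rewrite /SL size_enc_seq big_map.
by elim: (L x) => [|a s IHs] //=; rewrite big_cons; lia.
Qed.

Section Foldl.
Variables (B : X -> Type) (encB : forall x, B x -> data).
Variables (b0 : forall x, B x) (f : forall x, B x -> A x -> B x).
Variables (M : X -> nat) (m : forall x, B x -> nat) (h : forall x, A x -> nat).
Hypothesis pt0 : polytime e (fun x => encB (b0 x)).
Hypothesis pM : poly_bounded e M.
Hypothesis m0 : poly_bounded e (fun x => m (b0 x)).
Hypothesis encBm : forall x (b : B x), data_size (encB b) <= M x + 4 * m b.
Hypothesis fm : forall x (b : B x) (a : A x), m (f b a) <= m b + h a.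
Hypothesis ph : poly_bounded ctxA (fun u => h (projT2 u)).
Hypothesis ptf : polytime
  (fun u : {x : X & (B x * A x)%type} =>
     DCons (encB (projT2 u).1) (DCons (encA (projT2 u).2) (e (projT1 u))))
  (fun u => encB (f (projT2 u).1 (projT2 u).2)).

(** The accumulator is controlled by a measure [m] to which each element adds at most an amount [h]
    of its own, independent of the accumulator; the total growth is then a polynomially bounded sum.
    The factor 4 in [encBm] is the most that one bit contributes to [enc_nat], for folds whose
    measure is a number of bits. *)
Lemma polytime_foldl : polytime e (fun x => encB (foldl (@f x) (b0 x) (L x))).
Proof.
(* The list is used twice: as the clock, which is not inspected, and within the state, where it is
   consumed from the front. *)
pose S x i := DCons (encB (foldl (@f x) (b0 x) (take i (L x))))
                    (enc_seq [seq encA a | a <- drop i (L x)]).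
suff: polytime e (fun x => S x (size [seq encA a | a <- L x])).
  move/polytime_hd => pt; apply: polytime_ext pt _ _ => // x /=.
  by rewrite size_map take_size.
pose K x := M x + 4 * (m (b0 x) + \sum_(a <- L x) h a) +
            data_size (enc_seq [seq encA a | a <- L x]) + 1.
apply: (@polytime_iter _ e (fun x => [seq encA a | a <- L x]) S K) => //.
- rewrite /S; have := polytime_cons pt0 ptL.
  by move/polytime_ext; apply=> // x; rewrite take0 drop0.
- apply: poly_bounded_add; last exact: poly_bounded_const.
  apply: poly_bounded_add (polytime_bounded ptL).
  apply: poly_bounded_add => //; apply: poly_bounded_mul; first exact: poly_bounded_const.
  exact/poly_bounded_add/sum_poly_bounded.
- move=> x i _; rewrite /S /K /=.
  have := encBm (foldl (@f x) (b0 x) (take i (L x))).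
  have := measure_foldl (b0 x) (take i (L x)) (@fm x).
  have := leq_sum_take (@h x) i (L x).
  have : data_size (enc_seq [seq encA a | a <- drop i (L x)]) <=
         data_size (enc_seq [seq encA a | a <- L x]).
    rewrite !size_enc_seq !big_map -{2}(cat_take_drop i (L x)) big_cat /= ltnS.
    exact: leq_addl.
  lia.
pose U := {xi : X * nat | xi.2 < size [seq encA a | a <- L xi.1]}.
rewrite -/U.
have ltU (u : U) : (val u).2 < size (L (val u).1).
  by case: u => xi /=; rewrite size_map.
(* [A x] need not have a default element, so the current one is extracted by [tnth] from the proof
   that the round occurs. *)
pose el (u : U) : A (val u).1 := tnth (in_tuple (L (val u).1)) (Ordinal (ltU u)).
have elE (u : U) s0 : el u = nth s0 (L (val u).1) (val u).2.
  by rewrite /el (tnth_nth s0).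
pose pi (u : U) : {x : X & (B x * A x)%type} :=
  existT _ (val u).1 (foldl (@f _) (b0 _) (take (val u).2 (L (val u).1)), el u).
have dropE (u : U) :
    drop (val u).2 (L (val u).1) = el u :: drop (val u).2.+1 (L (val u).1).
  by rewrite (drop_nth (el u)) // -elE.
have takeE (u : U) :
    take (val u).2.+1 (L (val u).1) = rcons (take (val u).2 (L (val u).1)) (el u).
  by rewrite (take_nth (el u)) // -elE.
have id_ctx := polytime_id (fun u : U => DCons (S (val u).1 (val u).2) (e (val u).1)).
set ctx := fun u : U => _ in id_ctx *.
have pt_acc : polytime ctx (fun u => encB (projT2 (pi u)).1).
  exact: polytime_hd (polytime_hd id_ctx).
have pt_el : polytime ctx (fun u => encA (projT2 (pi u)).2).
  have := polytime_hd (polytime_tl (polytime_hd id_ctx)).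
  by move/polytime_ext; apply=> // u; rewrite /ctx /S /= dropE.
have pt_e : polytime ctx (fun u => e (val u).1) by exact: polytime_tl id_ctx.
have := polytime_comp (polytime_cons pt_acc (polytime_cons pt_el pt_e)) (polytime_pull pi ptf).
move/polytime_cons/(_ (polytime_tl (polytime_tl (polytime_hd id_ctx)))).
move/polytime_ext; apply=> // u; rewrite /S takeE -cats1 foldl_cat /=; congr DCons.
by rewrite dropE.
Qed.

End Foldl.

(** Consing onto the accumulator reverses the list. Reversal itself is the instance with the
    identity, and a second reversal later restores the order. *)
Lemma polytime_rev_map (g : forall x, A x -> data) :
  polytime ctxA (fun u => g (projT1 u) (projT2 u)) ->
  polytime e (fun x => enc_seq (rev [seq g x a | a <- L x])).
Proof.
move=> ptg.
have foldE x : foldl (fun acc a => g x a :: acc) [::] (L x) = rev [seq g x a | a <- L x].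
  have aux s acc : foldl (fun acc a => g x a :: acc) acc s = rev [seq g x a | a <- s] ++ acc.
    by elim: s acc => //= a s IHs acc; rewrite IHs rev_cons cat_rcons.
  by rewrite aux cats0.
apply: polytime_ext (_ : polytime e (fun x => enc_seq (foldl _ _ (L x)))) (frefl _) _;
  last by move=> x; rewrite -foldE.
apply: (@polytime_foldl (fun=> seq data) (fun _ => enc_seq) (fun=> [::])
  (fun x acc a => g x a :: acc) (fun=> 0) (fun _ s => data_size (enc_seq s))
  (fun x a => (data_size (g x a)).+1) (polytime_nil e) (poly_bounded_const e 0)
  (poly_bounded_const e 1)).
- by move=> x b; lia.
- by move=> x b a /=; lia.
- apply: poly_bounded_le (poly_bounded_add (polytime_bounded ptg) (poly_bounded_const _ 1)) _.
  by move=> u; rewrite addn1.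
- pose pi (u : {x : X & (seq data * A x)%type}) : {x : X & A x} :=
    existT _ (projT1 u) (projT2 u).2.
  apply: polytime_cons; last exact: polytime_here.
  exact/polytime_skip/(polytime_pull pi ptg).
Qed.

Lemma polytime_rev_filter (p : forall x, A x -> bool) :
  polytime ctxA (fun u => enc_bool (p (projT1 u) (projT2 u))) ->
  polytime e (fun x => enc_seq (rev [seq encA a | a <- L x & p x a])).
Proof.
move=> ptp.
have foldE x : [seq encA a | a <- foldl (fun acc a => if p x a then a :: acc else acc) [::] (L x)]
    = rev [seq encA a | a <- L x & p x a].
  have aux s acc : foldl (fun acc a => if p x a then a :: acc else acc) acc s =
      rev [seq a <- s | p x a] ++ acc.
    elim: s acc => //= a s IHs acc; rewrite IHs.
    by case: (p x a) => //; rewrite rev_cons cat_rcons.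
  by rewrite aux cats0 map_rev.
apply: polytime_ext (_ : polytime e (fun x => enc_seq [seq _ | a <- foldl _ _ (L x)]))
  (frefl _) _; last by move=> x; rewrite -foldE.
apply: (@polytime_foldl (fun x => seq (A x)) (fun x s => enc_seq [seq encA a | a <- s])
  (fun=> [::]) (fun x acc a => if p x a then a :: acc else acc) (fun=> 0)
  (fun x s => data_size (enc_seq [seq encA a | a <- s])) (fun x a => (data_size (encA a)).+1)
  (polytime_nil e) (poly_bounded_const e 0) (poly_bounded_const e 1)).
- by move=> x b; lia.
- by move=> x b a; case: (p x a) => /=; lia.
- apply: poly_bounded_le (poly_bounded_size _) _ => u.
  by rewrite /ctxA /=; have := data_size_gt0 (e (projT1 u)); lia.
- pose pi (u : {x : X & (seq (A x) * A x)%type}) : {x : X & A x} :=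
    existT _ (projT1 u) (projT2 u).2.
  have pt_s := polytime_here (fun u : {x : X & (seq (A x) * A x)%type} =>
     enc_seq [seq encA a | a <- (projT2 u).1])
     (fun u => DCons (encA (projT2 u).2) (e (projT1 u))).
  have := @polytime_if _ _ (fun u => p (projT1 u) (projT2 u).2) _ _
    (polytime_skip _ (polytime_pull pi ptp))
    (polytime_cons (polytime_skip _ (polytime_here _ _)) pt_s) pt_s.
  by move/polytime_ext; apply=> // u; case: (p _ _).
Qed.

Lemma polytime_has (p : forall x, A x -> bool) :
  polytime ctxA (fun u => enc_bool (p (projT1 u) (projT2 u))) ->
  polytime e (fun x => enc_bool (has (p x) (L x))).
Proof.
move=> ptp.
have foldE x : foldl (fun b a => b || p x a) false (L x) = has (p x) (L x).
  have aux s b : foldl (fun b a => b || p x a) b s = b || has (p x) s.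
    by elim: s b => [|a s IHs] b /=; rewrite ?orbF // IHs orbA.
  by rewrite aux.
apply: polytime_ext (_ : polytime e (fun x => enc_bool (foldl _ _ (L x)))) (frefl _) _;
  last by move=> x; rewrite -foldE.
apply: (@polytime_foldl (fun=> bool) (fun=> enc_bool)
  (fun=> false) (fun x b a => b || p x a) (fun=> 3) (fun _ _ => 0) (fun _ _ => 0)
  (polytime_nil e) (poly_bounded_const e 3) (poly_bounded_const e 0)).
- by move=> x [].
- by move=> x b a.
- exact: poly_bounded_const.
- pose pi (u : {x : X & (bool * A x)%type}) : {x : X & A x} :=
    existT _ (projT1 u) (projT2 u).2.
  exact: polytime_or (polytime_here _ _) (polytime_skip _ (polytime_pull pi ptp)).
Qed.

End Lists.

Lemma polytime_rev (X : Type) (e : X -> data) (l : X -> seq data) :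
  polytime e (fun x => enc_seq (l x)) -> polytime e (fun x => enc_seq (rev (l x))).
Proof.
move=> ptl.
have := @polytime_rev_map X e (fun=> data) (fun _ d => d) l _ (fun _ d => d).
move=> /(_ _ (polytime_here _ _)); move=> H.
have ptl' : polytime e (fun x => enc_seq [seq d | d <- l x]).
  by move/polytime_ext: ptl; apply=> // x; rewrite map_id.
by move/polytime_ext: (H ptl'); apply=> // x; rewrite map_id.
Qed.

Lemma polytime_map (X : Type) (e : X -> data) (A : X -> Type)
    (encA : forall x, A x -> data) (L : forall x, seq (A x)) (g : forall x, A x -> data) :
  polytime e (fun x => enc_seq [seq encA x a | a <- L x]) ->
  polytime (fun u : {x : X & A x} => DCons (encA _ (projT2 u)) (e (projT1 u)))
    (fun u => g (projT1 u) (projT2 u)) ->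
  polytime e (fun x => enc_seq [seq g x a | a <- L x]).
Proof.
move=> ptL ptg; have := polytime_rev (polytime_rev_map ptL ptg).
by move/polytime_ext; apply=> // x; rewrite revK.
Qed.

Lemma polytime_filter (X : Type) (e : X -> data) (A : X -> Type)
    (encA : forall x, A x -> data) (L : forall x, seq (A x)) (p : forall x, A x -> bool) :
  polytime e (fun x => enc_seq [seq encA x a | a <- L x]) ->
  polytime (fun u : {x : X & A x} => DCons (encA _ (projT2 u)) (e (projT1 u)))
    (fun u => enc_bool (p (projT1 u) (projT2 u))) ->
  polytime e (fun x => enc_seq [seq encA x a | a <- L x & p x a]).
Proof.
move=> ptL ptp; have := polytime_rev (polytime_rev_filter ptL ptp).
by move/polytime_ext; apply=> // x; rewrite revK.
Qed.

Lemma polytime_cat (X : Type) (e : X -> data) (l1 l2 : X -> seq data) :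
  polytime e (fun x => enc_seq (l1 x)) -> polytime e (fun x => enc_seq (l2 x)) ->
  polytime e (fun x => enc_seq (l1 x ++ l2 x)).
Proof.
move=> pt1 pt2; have ptL : polytime e (fun x => enc_seq [seq d | d <- rev (l1 x)]).
  by move/polytime_ext: (polytime_rev pt1); apply=> // x; rewrite map_id.
have foldE x : foldl (fun s d => d :: s) (l2 x) (rev (l1 x)) = l1 x ++ l2 x.
  have -> s t : foldl (fun (s : seq data) d => d :: s) t s = catrev s t.
    by elim: s t => //= a s IHs t; rewrite IHs.
  by rewrite catrevE revK.
apply: polytime_ext (_ : polytime e (fun x => enc_seq (foldl _ _ (rev (l1 x))))) (frefl _) _;
  last by move=> x; rewrite -foldE.
apply: (@polytime_foldl X e (fun=> data) (fun _ d => d) _ ptL (fun=> seq data)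
  (fun=> enc_seq) l2 (fun _ s d => d :: s) (fun=> 0) (fun _ s => data_size (enc_seq s))
  (fun _ d => (data_size d).+1) pt2 (poly_bounded_const e 0) (polytime_bounded pt2)).
- by move=> x s; lia.
- by move=> x s a /=; lia.
- apply: poly_bounded_le (poly_bounded_size _) _ => u.
  by rewrite /=; have := data_size_gt0 (e (projT1 u)); lia.
- apply: polytime_cons; last exact: polytime_here.
  exact/polytime_skip/polytime_here.
Qed.

Lemma polytime_flatten (X : Type) (e : X -> data) (L : X -> seq (seq data)) :
  polytime e (fun x => enc_seq [seq enc_seq s | s <- L x]) ->
  polytime e (fun x => enc_seq (flatten (L x))).
Proof.
move=> ptL.
have foldE x : foldl cat [::] (L x) = flatten (L x).
  have aux s acc : foldl cat acc s = acc ++ flatten s :> seq data.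
    by elim: s acc => [|a s IHs] acc /=; rewrite ?cats0 // IHs catA.
  by rewrite aux.
apply: polytime_ext (_ : polytime e (fun x => enc_seq (foldl _ _ (L x)))) (frefl _) _;
  last by move=> x; rewrite -foldE.
apply: (@polytime_foldl X e (fun=> seq data) (fun=> enc_seq) L ptL (fun=> seq data)
  (fun=> enc_seq) (fun=> [::]) (fun=> cat) (fun=> 0) (fun _ s => data_size (enc_seq s))
  (fun _ s => data_size (enc_seq s)) (polytime_nil e) (poly_bounded_const e 0)
  (poly_bounded_const e 1)).
- by move=> x s; lia.
- by move=> x b a; rewrite !size_enc_seq big_cat /=; lia.
- apply: poly_bounded_le (poly_bounded_size _) _ => u /=; lia.
- apply: polytime_cat; first exact: polytime_here.
  exact/polytime_skip/polytime_here.
Qed.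

(** * Unary numbers and indexing *)

(** Positions and vertices are kept in unary: such a number can act as the clock of a loop, and it
    stays polynomial because the vertices number as many as the rows of the input table. *)
Definition enc_unary (k : nat) : data := enc_seq (nseq k DNil).

Lemma size_enc_unary k : data_size (enc_unary k) = k.*2.+1.
Proof. by elim: k => //= k; rewrite /enc_unary /= => ->; lia. Qed.

Section Unary.
Variables (X : Type) (e : X -> data).

Lemma polytime_unaryS (k : X -> nat) :
  polytime e (fun x => enc_unary (k x)) -> polytime e (fun x => enc_unary (k x).+1).
Proof. exact/polytime_cons/polytime_nil. Qed.

Lemma polytime_drop (l : X -> seq data) (k : X -> nat) :
  polytime e (fun x => enc_seq (l x)) -> polytime e (fun x => enc_unary (k x)) ->
  polytime e (fun x => enc_seq (drop (k x) (l x))).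
Proof.
move=> ptl ptk; pose S x i := enc_seq (drop i (l x)).
suff: polytime e (fun x => S x (size (nseq (k x) DNil))).
  by move/polytime_ext; apply=> // x; rewrite /S size_nseq.
apply: (@polytime_iter _ e _ S (fun x => data_size (enc_seq (l x)))) => //.
- by move/polytime_ext: ptl; apply=> // x; rewrite /S drop0.
- exact: polytime_bounded.
- move=> x i _; rewrite /S !size_enc_seq ltnS -{2}(cat_take_drop i (l x)) big_cat /=.
  exact: leq_addl.
set ctx := (Z in polytime Z).
apply: polytime_ext (polytime_tl (polytime_hd (polytime_id ctx))) (frefl _) _.
move=> -[[x i] lt_i] /=.
rewrite /S; case: (ltnP i (size (l x))) => [lt|ge].
  by rewrite (drop_nth DNil lt).
by rewrite !drop_oversize // ltnW.
Qed.

Lemma polytime_nth (l : X -> seq data) (k : X -> nat) :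
  polytime e (fun x => enc_seq (l x)) -> polytime e (fun x => enc_unary (k x)) ->
  polytime e (fun x => nth DNil (l x) (k x)).
Proof.
move=> ptl ptk; have := polytime_hd (polytime_drop ptl ptk).
move/polytime_ext; apply=> // x; case: (ltnP (k x) (size (l x))) => [lt|ge].
  by rewrite (drop_nth DNil lt).
by rewrite drop_oversize // nth_default.
Qed.

Lemma polytime_unary_eq (k m : X -> nat) :
  polytime e (fun x => enc_unary (k x)) -> polytime e (fun x => enc_unary (m x)) ->
  polytime e (fun x => enc_bool (k x == m x)).
Proof.
move=> ptk ptm.
have aux (a b : X -> nat) : polytime e (fun x => enc_unary (a x)) ->
    polytime e (fun x => enc_unary (b x)) -> polytime e (fun x => enc_bool (a x <= b x)).
  move=> pta ptb; have ptT := polytime_const e (enc_bool true).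
  have := polytime_if_cons (polytime_drop pta ptb) (polytime_nil e) ptT.
  by move/polytime_ext; apply=> // x; rewrite drop_nseq leqNgt -subn_gt0; case: (_ - _).
have := polytime_and (aux _ _ ptk ptm) (aux _ _ ptm ptk).
by move/polytime_ext; apply=> // x; rewrite eqn_leq.
Qed.

End Unary.

(** * Binary arithmetic *)

Lemma bits_of_nat_pos p : bits_of_nat (nat_of_pos p) = bits_of_pos p.
Proof.
by rewrite /bits_of_nat -[nat_of_pos p]/(nat_of_bin (Npos p)) nat_of_binK.
Qed.

Lemma nat_pos_gt0 m : 0 < m -> exists p, m = nat_of_pos p.
Proof.
by move=> m_gt0; have := bin_of_natK m; case: bin_of_nat => [|p] /= mE; [lia | exists p].
Qed.

(** The exceptional case keeps expansions canonical: zero has no bits, so a zero bit put before it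
    must vanish. *)
Lemma bits_of_nat_double (b : bool) m :
  bits_of_nat (b + m.*2) =
    if (m == 0) && ~~ b then [::] else b :: bits_of_nat m.
Proof.
case: (posnP m) => [->|m_gt0]; first by case: b.
have [p ->] := nat_pos_gt0 m_gt0.
case: b; rewrite /= bits_of_nat_pos.
  by rewrite -[RHS]/(bits_of_pos (xI p)) -bits_of_nat_pos /=; congr bits_of_nat; lia.
by rewrite -[RHS]/(bits_of_pos (xO p)) -bits_of_nat_pos /=; congr bits_of_nat; lia.
Qed.

Lemma bits_of_natE m :
  bits_of_nat m = if m == 0 then [::] else odd m :: bits_of_nat m./2.
Proof.
rewrite -[in LHS](odd_double_half m) bits_of_nat_double.
have -> : (m./2 == 0) && ~~ odd m = (m == 0) by lia.
by [].
Qed.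

Lemma size_bits_half i m : size (bits_of_nat (iter i half m)) = size (bits_of_nat m) - i.
Proof.
elim: i => [|i IHi] /=; first by rewrite subn0.
rewrite subnS -IHi; move: (iter i half m) => k.
by rewrite [bits_of_nat k]bits_of_natE; case: eqP => [->|].
Qed.

Lemma iter_half_eq0 i m : size (bits_of_nat m) <= i -> iter i half m = 0.
Proof.
by rewrite -subn_eq0 -size_bits_half bits_of_natE; case: (iter i half m =P 0).
Qed.

Lemma enc_nat_hd m : dhd (enc_nat m) = enc_bool (odd m).
Proof. by rewrite /enc_nat bits_of_natE; case: eqP => [->|]. Qed.

Lemma enc_nat_tl m : dtl (enc_nat m) = enc_nat m./2.
Proof. by rewrite /enc_nat [in LHS]bits_of_natE; case: eqP => [->|]. Qed.

Lemma size_enc_nat m : data_size (enc_nat m) <= 1 + 4 * size (bits_of_nat m).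
Proof.
by rewrite /enc_nat; elim: (bits_of_nat m) => //= b s; case: b => /=; lia.
Qed.

Lemma size_bits_enc_nat m : size (bits_of_nat m) <= data_size (enc_nat m).
Proof. by have := size_le_enc_seq (map enc_bool (bits_of_nat m)); rewrite size_map. Qed.

Lemma size_enc_nat_half i m : data_size (enc_nat (iter i half m)) <= data_size (enc_nat m).
Proof.
elim: i => //= i; apply: leq_trans.
by rewrite -enc_nat_tl; case: (enc_nat _) => //= a b; lia.
Qed.

Section Arithmetic.
Variables (X : Type) (e : X -> data).

Lemma polytime_odd (a : X -> nat) :
  polytime e (fun x => enc_nat (a x)) -> polytime e (fun x => enc_bool (odd (a x))).
Proof. by move/polytime_hd/polytime_ext; apply=> // x; rewrite enc_nat_hd. Qed.

Lemma polytime_half (a : X -> nat) :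
  polytime e (fun x => enc_nat (a x)) -> polytime e (fun x => enc_nat (a x)./2).
Proof. by move/polytime_tl/polytime_ext; apply=> // x; rewrite enc_nat_tl. Qed.

Lemma polytime_double (b : X -> bool) (a : X -> nat) :
  polytime e (fun x => enc_bool (b x)) -> polytime e (fun x => enc_nat (a x)) ->
  polytime e (fun x => enc_nat (b x + (a x).*2)).
Proof.
move=> ptb pta; have ptc := polytime_cons ptb pta.
have := polytime_if_cons pta ptc (polytime_if ptb ptc (polytime_nil e)).
move/polytime_ext; apply=> // x; rewrite /enc_nat bits_of_nat_double.
by rewrite [bits_of_nat (a x)]bits_of_natE; case: eqP => _ //=; case: (b x).
Qed.

End Arithmetic.

(* Most significant bit first, unlike [bits_of_nat]. *)
Definition append_bits (c : nat) (s : seq bool) : nat :=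
  foldl (fun n (b : bool) => b + n.*2) c s.

Lemma size_append_bits c s :
  size (bits_of_nat (append_bits c s)) <= size (bits_of_nat c) + size s.
Proof.
elim: s c => [|b s IHs] c /=; first by rewrite addn0.
apply: leq_trans (IHs _) _; rewrite bits_of_nat_double.
by case: ifP => /= _; lia.
Qed.

(** One column of schoolbook addition. The new carry is the majority of the old carry and the two
    low bits. Result bits are pushed in front and thus end up most significant first, the order that
    [append_bits] reads. *)
Definition add_step (u : bool * nat * nat * seq bool) : bool * nat * nat * seq bool :=
  let: (c, a, b, s) := u in
  (odd a && odd b || c && (odd a || odd b), a./2, b./2, (c (+) odd a (+) odd b) :: s).

Definition enc_add (u : bool * nat * nat * seq bool) : data :=
  let: (c, a, b, s) := u in
  DCons (enc_bool c) (DCons (enc_nat a) (DCons (enc_nat b) (enc_seq (map enc_bool s)))).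

(** The invariant of the addition: the high part is what remains to be added, the low bits are those
    already produced. *)
Definition add_value (u : bool * nat * nat * seq bool) : nat :=
  let: (c, a, b, s) := u in append_bits (c + a + b) s.

Lemma add_step_value u : add_value (add_step u) = add_value u.
Proof.
case: u => [[[c a] b] s]; rewrite /= /append_bits /=; congr foldl.
have := odd_double_half a; have := odd_double_half b.
by case: (odd a); case: (odd b); case: c => /=; lia.
Qed.

Lemma add_stepE i a b : exists c s,
  iter i add_step (false, a, b, [::]) = (c, iter i half a, iter i half b, s) /\ size s = i.
Proof.
elim: i => [|i [c [s [E sz_s]]]]; first by exists false, [::].
by rewrite iterS E; do 2!eexists; split; [reflexivity | rewrite /= sz_s].
Qed.

Section AddStep.
Variables (X : Type) (e : X -> data).

Lemma polytime_add_step (u : X -> bool * nat * nat * seq bool) :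
  polytime e (fun x => enc_add (u x)) -> polytime e (fun x => enc_add (add_step (u x))).
Proof.
move=> ptu.
have ptc : polytime e (fun x => enc_bool (u x).1.1.1).
  by move/polytime_ext: (polytime_hd ptu); apply=> // x; case: (u x) => [[[]]].
have pta : polytime e (fun x => enc_nat (u x).1.1.2).
  by move/polytime_ext: (polytime_hd (polytime_tl ptu)); apply=> // x; case: (u x) => [[[]]].
have ptb : polytime e (fun x => enc_nat (u x).1.2).
  move/polytime_ext: (polytime_hd (polytime_tl (polytime_tl ptu))).
  by apply=> // x; case: (u x) => [[[]]].
have pts : polytime e (fun x => enc_seq (map enc_bool (u x).2)).
  move/polytime_ext: (polytime_tl (polytime_tl (polytime_tl ptu))).
  by apply=> // x; case: (u x) => [[[]]].
have pt_oa := polytime_odd pta; have pt_ob := polytime_odd ptb.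
have := polytime_cons (polytime_or (polytime_and pt_oa pt_ob)
    (polytime_and ptc (polytime_or pt_oa pt_ob)))
  (polytime_cons (polytime_half pta) (polytime_cons (polytime_half ptb)
    (polytime_cons (polytime_xor (polytime_xor ptc pt_oa) pt_ob) pts))).
by move/polytime_ext; apply=> // x; case: (u x) => [[[c a] b] s].
Qed.

End AddStep.

Section Addition.
Variables (X : Type) (e : X -> data).

Lemma polytime_append_bits (c : X -> bool) (s : X -> seq bool) :
  polytime e (fun x => enc_bool (c x)) ->
  polytime e (fun x => enc_seq (map enc_bool (s x))) ->
  polytime e (fun x => enc_nat (append_bits (c x) (s x))).
Proof.
move=> ptc pts.
apply: (@polytime_foldl X e (fun=> bool) (fun=> enc_bool) s pts (fun=> nat) (fun=> enc_nat)
  (fun x => c x) (fun _ n b => b + n.*2) (fun=> 1) (fun _ n => size (bits_of_nat n))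
  (fun _ _ => 1)) => //.
- have := polytime_double ptc (polytime_const e (enc_nat 0)).
  by move/polytime_ext; apply=> // x; rewrite addn0.
- exact: poly_bounded_const.
- by apply: poly_bounded_le (poly_bounded_const e 1) _ => x; case: (c x).
- by move=> x b; apply: size_enc_nat.
- by move=> x n b; rewrite bits_of_nat_double addn1; case: ifP.
- exact: poly_bounded_const.
- apply: polytime_double; last exact: polytime_here.
  exact/polytime_skip/polytime_here.
Qed.

Lemma polytime_add (a b : X -> nat) :
  polytime e (fun x => enc_nat (a x)) -> polytime e (fun x => enc_nat (b x)) ->
  polytime e (fun x => enc_nat (a x + b x)).
Proof.
move=> pta ptb.
(* The two lengths together are enough rounds to exhaust both operands; a final carry survives as
   the top bit handed to [append_bits]. *)
pose l x := map enc_bool (bits_of_nat (a x)) ++ map enc_bool (bits_of_nat (b x)).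
have ptl : polytime e (fun x => enc_seq (l x)) by apply: polytime_cat.
pose w x i := iter i add_step (false, a x, b x, [::]).
have pts : polytime e (fun x => enc_add (w x (size (l x)))).
  apply: (@polytime_iter _ e l (fun x i => enc_add (w x i))
    (fun x => data_size (enc_nat (a x)) + data_size (enc_nat (b x)) +
              4 * data_size (enc_seq (l x)) + 10)) => //.
  - exact: polytime_cons (polytime_nil e) (polytime_cons pta (polytime_cons ptb (polytime_nil e))).
  - apply: poly_bounded_add; last exact: poly_bounded_const.
    apply: poly_bounded_add; first by apply: poly_bounded_add; apply: polytime_bounded.
    by apply: poly_bounded_mul; [apply: poly_bounded_const | apply: polytime_bounded].
  - move=> x i le_i; have [c [s [wE sz_s]]] := add_stepE i (a x) (b x).
    rewrite /w wE /=.
    have := size_enc_nat_half i (a x); have := size_enc_nat_half i (b x).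
    have : data_size (enc_seq (map enc_bool s)) <= 1 + 4 * i.
      by rewrite -sz_s; elim: (s) => //= d t; case: d => /=; lia.
    have := size_le_enc_seq (l x).
    by case: (c) => /=; lia.
  exact: (@polytime_add_step _ _ (fun u => w (val u).1 (val u).2) (polytime_here _ _)).
have sz_l x : size (l x) = size (bits_of_nat (a x)) + size (bits_of_nat (b x)).
  by rewrite size_cat !size_map.
have wE x : exists c s, w x (size (l x)) = (c, 0, 0, s).
  have [c [s [E _]]] := add_stepE (size (l x)) (a x) (b x).
  by exists c, s; rewrite /w E !iter_half_eq0 // sz_l ?leq_addl ?leq_addr.
have ptc : polytime e (fun x => enc_bool (w x (size (l x))).1.1.1).
  by move/polytime_ext: (polytime_hd pts); apply=> // x; have [c [s ->]] := wE x.
have ptd : polytime e (fun x => enc_seq (map enc_bool (w x (size (l x))).2)).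
  move/polytime_ext: (polytime_tl (polytime_tl (polytime_tl pts))).
  by apply=> // x; have [c [s ->]] := wE x.
have := polytime_append_bits ptc ptd; move/polytime_ext; apply=> // x.
have vE : add_value (w x (size (l x))) = a x + b x.
  rewrite /w; elim: (size (l x)) => [|i IHi] /=; first by rewrite /append_bits.
  by rewrite add_step_value.
by rewrite -vE; have [c [s ->]] := wE x; rewrite /= !addn0.
Qed.

End Addition.

Lemma size_bits_add a b :
  size (bits_of_nat (a + b)) <= size (bits_of_nat a) + size (bits_of_nat b) + 1.
Proof.
pose i := size (bits_of_nat a) + size (bits_of_nat b).
have vE : add_value (iter i add_step (false, a, b, [::])) = a + b.
  by elim: i => [|i IHi] //=; rewrite add_step_value.
have [c [s [E sz_s]]] := add_stepE i a b.
rewrite -vE E /= !iter_half_eq0 ?leq_addl ?leq_addr // !addn0.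
apply: leq_trans (size_append_bits _ _) _.
by rewrite sz_s -/i; case: (c) => /=; lia.
Qed.

(** Bits are read from the least significant end, so a later difference overrides the verdict
    reached so far. Accordingly, the invariant lets the verdict count only if the remaining high
    parts agree. *)
Definition lt_step (u : bool * nat * nat) : bool * nat * nat :=
  let: (c, a, b) := u in (if odd a (+) odd b then odd b else c, a./2, b./2).

Lemma lt_step_value u (v := fun u : bool * nat * nat =>
    if u.1.2 == u.2 then u.1.1 else u.1.2 < u.2) : v (lt_step u) = v u.
Proof.
case: u => [[c a] b]; rewrite /v /=.
have := odd_double_half a; have := odd_double_half b.
move: a./2 b./2 => a' b' <- <-; rewrite !oddD !odd_double !oddb !addbF.
by case: (odd a); case: (odd b) => /=; case: eqP => ?; case: eqP => ? //; lia.
Qed.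

Lemma lt_stepE i a b : exists c,
  iter i lt_step (false, a, b) = (c, iter i half a, iter i half b).
Proof. by elim: i => [|i [c E]]; [exists false | rewrite iterS E; eexists]. Qed.

Section Comparison.
Variables (X : Type) (e : X -> data).

Lemma polytime_lt (a b : X -> nat) :
  polytime e (fun x => enc_nat (a x)) -> polytime e (fun x => enc_nat (b x)) ->
  polytime e (fun x => enc_bool (a x < b x)).
Proof.
move=> pta ptb.
pose l x := map enc_bool (bits_of_nat (a x)) ++ map enc_bool (bits_of_nat (b x)).
have ptl : polytime e (fun x => enc_seq (l x)) by apply: polytime_cat.
pose w x i := iter i lt_step (false, a x, b x).
pose enc (u : bool * nat * nat) :=
  DCons (enc_bool u.1.1) (DCons (enc_nat u.1.2) (enc_nat u.2)).
have pts : polytime e (fun x => enc (w x (size (l x)))).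
  apply: (@polytime_iter _ e l (fun x i => enc (w x i))
    (fun x => data_size (enc_nat (a x)) + data_size (enc_nat (b x)) + 10)) => //.
  - exact: polytime_cons (polytime_nil e) (polytime_cons pta ptb).
  - apply: poly_bounded_add; last exact: poly_bounded_const.
    by apply: poly_bounded_add; apply: polytime_bounded.
  - move=> x i le_i; have [c wE] := lt_stepE i (a x) (b x).
    rewrite /w wE /=.
    have := size_enc_nat_half i (a x); have := size_enc_nat_half i (b x).
    by case: (c) => /=; lia.
  set U := (X in @polytime X); set ctx := (X in polytime X).
  have pu : polytime ctx (fun u : U => enc (w (val u).1 (val u).2)) by apply: polytime_here.
  have ptc : polytime ctx (fun u : U => enc_bool (w (val u).1 (val u).2).1.1).
    exact: polytime_hd pu.
  have pt1 : polytime ctx (fun u : U => enc_nat (w (val u).1 (val u).2).1.2).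
    exact: polytime_hd (polytime_tl pu).
  have pt2 : polytime ctx (fun u : U => enc_nat (w (val u).1 (val u).2).2).
    exact: polytime_tl (polytime_tl pu).
  have := polytime_cons (polytime_bool_if (polytime_xor (polytime_odd pt1) (polytime_odd pt2))
     (polytime_odd pt2) ptc) (polytime_cons (polytime_half pt1) (polytime_half pt2)).
  by move/polytime_ext; apply=> // -[[x i] ?] /=; case: (w x i) => [[c a'] b'].
have := polytime_hd pts; move/polytime_ext; apply=> // x /=.
have : (if (w x (size (l x))).1.2 == (w x (size (l x))).2 then (w x (size (l x))).1.1
     else (w x (size (l x))).1.2 < (w x (size (l x))).2) = (a x < b x).
  rewrite /w; elim: (size (l x)) => [|i IHi]; first by rewrite /=; case: eqP => // ->; rewrite ltnn.
  by rewrite iterS lt_step_value.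
have [c E] := lt_stepE (size (l x)) (a x) (b x).
by rewrite /w E /= !iter_half_eq0 ?eqxx /=; [move=> -> | rewrite size_cat !size_map leq_addl
  | rewrite size_cat !size_map leq_addr].
Qed.

Lemma polytime_le (a b : X -> nat) :
  polytime e (fun x => enc_nat (a x)) -> polytime e (fun x => enc_nat (b x)) ->
  polytime e (fun x => enc_bool (a x <= b x)).
Proof.
move=> pta ptb; have := polytime_neg (polytime_lt ptb pta).
by move/polytime_ext; apply=> // x; rewrite -leqNgt.
Qed.

Lemma polytime_sum (A : X -> Type) (encA : forall x, A x -> data)
    (L : forall x, seq (A x)) (g : forall x, A x -> nat) :
  polytime e (fun x => enc_seq [seq encA x a | a <- L x]) ->
  polytime (fun u : {x : X & A x} => DCons (encA _ (projT2 u)) (e (projT1 u)))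
    (fun u => enc_nat (g (projT1 u) (projT2 u))) ->
  polytime e (fun x => enc_nat (\sum_(a <- L x) g x a)).
Proof.
move=> ptL ptg.
have foldE x : foldl (fun n a => n + g x a) 0 (L x) = \sum_(a <- L x) g x a.
  have aux s n : foldl (fun n a => n + g x a) n s = n + \sum_(a <- s) g x a.
    by elim: s n => [|a s IHs] n /=; rewrite ?big_nil ?addn0 // IHs big_cons addnA.
  by rewrite aux.
apply: polytime_ext (_ : polytime e (fun x => enc_nat (foldl _ _ (L x)))) (frefl _) _;
  last by move=> x; rewrite -foldE.
apply: (@polytime_foldl X e A encA L ptL (fun=> nat) (fun=> enc_nat) (fun=> 0)
  (fun x n a => n + g x a) (fun=> 1) (fun _ n => size (bits_of_nat n))
  (fun x a => (size (bits_of_nat (g x a))).+1) (polytime_nil e)).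
- exact: poly_bounded_const.
- exact: poly_bounded_const.
- by move=> x n; apply: size_enc_nat.
- by move=> x n a; have := size_bits_add n (g x a); lia.
- apply: poly_bounded_le (poly_bounded_add (polytime_bounded ptg) (poly_bounded_const _ 1)) _.
  by move=> u; have := size_bits_enc_nat (g (projT1 u) (projT2 u)); lia.
- apply: polytime_add; first exact: polytime_here.
  pose pi (u : {x : X & (nat * A x)%type}) : {x : X & A x} :=
    existT _ (projT1 u) (projT2 u).2.
  exact/polytime_skip/(polytime_pull pi ptg).
Qed.

End Comparison.

Import Order.TTheory GRing.Theory Num.Theory.

(** * Matroids given by closure operators *)

(** Closure is the convenient presentation here: in both matroids it has a direct description, by
    connectivity and by saturated heads, and the arcs of the exchange graph are statements about
    closures. *)
Record matroid (T : finType) : Type := Matroid {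
  span :> {set T} -> {set T};
  span_ext : forall A : {set T}, A \subset span A;
  span_mono : forall A B : {set T}, A \subset B -> span A \subset span B;
  span_idem : forall A : {set T}, span (span A) \subset span A;
  span_exchange : forall (A : {set T}) (x y : T),
    y \notin span A -> y \in span (x |: A) -> x \in span (y |: A)
}.

Section Matroid.
Variables (T : finType) (M : matroid T).
Implicit Types (A B C I J : {set T}) (x y z : T).

Definition indep A : bool := [forall a in A, a \notin M (A :\ a)].

Lemma indepP A : reflect (forall a, a \in A -> a \notin M (A :\ a)) (indep A).
Proof. exact: forall_inP. Qed.

Lemma span_le A B x : A \subset M B -> x \in M A -> x \in M B.
Proof.
by move=> sAB xA; apply/(subsetP (span_idem M B))/(subsetP (span_mono M sAB)).
Qed.

Lemma span_sub A B x : A \subset B -> x \in M A -> x \in M B.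
Proof. by move=> sAB; apply/subsetP/span_mono. Qed.

Lemma span_mem A x : x \in A -> x \in M A.
Proof. exact/subsetP/span_ext. Qed.

Lemma indep_sub A B : A \subset B -> indep B -> indep A.
Proof.
move=> sAB /indepP iB; apply/indepP => a aA.
apply: contra (iB a (subsetP sAB _ aA)); apply: span_sub.
exact: setSD.
Qed.

Lemma indep_add I x : indep I -> x \notin M I -> indep (x |: I).
Proof.
move=> iI xI; apply/indepP => a; rewrite in_setU1 => /predU1P[->|aI].
  apply: contra xI; apply: span_sub; apply/subsetP => z.
  by rewrite !inE => /andP[/negPf->].
have [<-|neq] := eqVneq a x.
  apply: contra (indepP _ iI a aI); apply: span_sub; apply/subsetP => z.
  by rewrite !inE; case: eqP.
apply: contra xI => ax.
have {}ax : a \in M (x |: (I :\ a)).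
  by apply: span_sub ax; apply/subsetP => z; rewrite !inE; case: eqP.
by rewrite -(setD1K aI); apply: span_exchange ax; apply: (indepP _ iI).
Qed.

(** Steinitz exchange: an element [y] of [I] outside [J] is replaced by an element of [J] not
    spanned by the rest of [I], which keeps the size and brings [I] closer to [J]. If there were
    none, [y] would be spanned by the rest of [I] through [J]. *)
Lemma indep_card I J : indep I -> I \subset M J -> #|I| <= #|J|.
Proof.
have [k] := ubnP #|I :\: J|; elim: k I => // k IHk I lt_k iI sIJ.
have [sub|/subsetPn[y yI yJ]] := boolP (I \subset J); first exact: subset_leq_card.
have y_out := indepP _ iI y yI.
have /subsetPn[x xJ x_out] : ~~ (J \subset M (I :\ y)).
  by apply: contra y_out => /span_le; apply; apply: (subsetP sIJ).
have iIx := indep_add (indep_sub (subsetDl I [set y]) iI) x_out.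
have xI : x \notin I :\ y by apply: contra x_out; apply: span_mem.
have cardE : #|x |: (I :\ y)| = #|I| by rewrite cardsU1 xI (cardsD1 y I) yI.
rewrite -cardE; apply: IHk => //.
  rewrite ltnS in lt_k; apply: leq_trans lt_k.
  apply: proper_card; apply/properP; split.
    apply/subsetP => z; rewrite !inE => /andP[zJ /predU1P[zx|/andP[_ ->]]]; last by rewrite zJ.
    by rewrite zx xJ in zJ.
  by exists y; rewrite !inE ?yJ ?yI // eqxx orbF; apply: contraNneq yJ => ->.
apply/subsetP => z; rewrite in_setU1 => /predU1P[->|]; first exact: span_mem.
by rewrite in_setD1 => /andP[_]; apply: (subsetP sIJ).
Qed.

(** A dependent element of [J] could be dropped without losing the span, leaving too few elements to
    span [I]. *)
Lemma indep_span_card I J : indep I -> I \subset M J -> #|J| <= #|I| -> indep J.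
Proof.
move=> iI sIJ leJI; apply/indepP => a aJ; apply/negP => aout.
have: #|I| <= #|J :\ a|.
  apply: indep_card => //; apply/subsetP => z /(subsetP sIJ); apply: span_le.
  apply/subsetP => b bJ; have [->//|neq] := eqVneq b a.
  by apply: span_mem; rewrite !inE neq.
by move: leJI; rewrite (cardsD1 a J) aJ; lia.
Qed.

(** [x |: C] is the fundamental circuit of [x], with [C] a minimal subset of [I] spanning [x]. The
    last conjunct gives its two uses: [x] may replace [y] in [I], and [y] is recovered from [x] and
    the rest of [C]. *)
Lemma fundamental_circuit I x : indep I -> x \in M I ->
  exists C, [/\ C \subset I, x \in M C &
    forall y, y \in C -> x \notin M (I :\ y) /\ y \in M (x |: (C :\ y))].
Proof.
move=> iI xI; have [C minC _] : {C | minset (fun C => (x \in M C) && (C \subset I)) C & C \subset I}.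
  by apply: minset_exists; rewrite xI subxx.
have /minsetP[/andP[xC sCI] Cmin] := minC.
exists C; split=> // y yC.
have x_out : x \notin M (C :\ y).
  apply/negP => xCy; have := Cmin (C :\ y).
  rewrite xCy (subset_trans (subsetDl _ _) sCI) subsetDl => /(_ isT isT) E.
  by have := yC; rewrite -E !inE eqxx.
have yx : y \in M (x |: (C :\ y)) by apply: span_exchange x_out _; rewrite setD1K.
split=> //; apply/negP => xIy.
have := indepP _ iI y (subsetP sCI _ yC); rewrite (span_le _ yx) //.
apply/subsetP => z; rewrite in_setU1 => /predU1P[->//|zC].
by apply/span_mem/(subsetP (setSD _ sCI)).
Qed.

Lemma indep_swap I x y : y \in I -> x \notin I -> indep I ->
  indep (x |: (I :\ y)) = (x \notin M (I :\ y)).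
Proof.
move=> yI xI iI; apply/idP/idP => [/indepP/(_ x (setU11 _ _))|]; last first.
  exact/indep_add/(indep_sub (subsetDl _ _) iI).
by rewrite setU1K // !inE negb_and xI orbT.
Qed.

Definition weight (u : T -> int) A : int := (\sum_(z in A) u z)%R.

Lemma weight_swap u A x y : y \in A -> x \notin A ->
  weight u (x |: (A :\ y)) = (weight u A + u x - u y)%R.
Proof.
move=> yA xA; rewrite /weight big_setU1 ?inE ?negb_and ?xA ?orbT //=.
by rewrite [in RHS](big_setD1 y yA) /=; lia.
Qed.

Definition locally_optimal (u : T -> int) I : Prop :=
  forall x y, y \in I -> x \notin I -> x \notin M (I :\ y) -> (u x <= u y)%R.

Definition globally_optimal (u : T -> int) I : Prop :=
  forall J, indep J -> #|J| = #|I| -> (weight u J <= weight u I)%R.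

Lemma globally_locally_optimal u I :
  indep I -> globally_optimal u I -> locally_optimal u I.
Proof.
move=> iI opt x y yI xI; rewrite -(indep_swap yI xI iI) => /opt.
have -> : #|x |: (I :\ y)| = #|I|.
  by rewrite cardsU1 !inE negb_and xI orbT (cardsD1 y I) yI.
by move=> /(_ erefl); rewrite weight_swap //; lia.
Qed.

(** For [x] in [J] outside [I] there is a [y] in [I] outside [J] such that [x] may replace [y] in
    [I] and [y] may replace [x] in [J]. By local optimality the second exchange does not decrease
    the weight of [J], and it brings [J] closer to [I]. *)
Lemma locally_globally_optimal u I :
  indep I -> locally_optimal u I -> globally_optimal u I.
Proof.
move=> iI opt J; have [k] := ubnP #|J :\: I|; elim: k J => // k IHk J lt_k iJ cardJ.
have [sub|/subsetPn[x xJ xI]] := boolP (J \subset I).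
  by have /eqP -> : J == I by rewrite eqEcard sub cardJ leqnn.
have x_out := indepP _ iJ x xJ.
have [y [yI x_swap y_out]] : exists y, [/\ y \in I, x \notin M (I :\ y) & y \notin M (J :\ x)].
  have [xMI|xMI] := boolP (x \in M I).
    have [C [sCI xC Cswap]] := fundamental_circuit iI xMI.
    have /subsetPn[y yC y_out] : ~~ (C \subset M (J :\ x)).
      by apply: contra x_out => /span_le; apply.
    by exists y; split=> //; [apply: (subsetP sCI) | have [] := Cswap y yC].
  (* Here [x] may replace any element of [I], and [J :\ x], having fewer elements than [I], cannot
     span it. *)
  have /subsetPn[y yI y_out] : ~~ (I \subset M (J :\ x)).
    apply/negP => /(indep_card iI); rewrite -cardJ (cardsD1 x J) xJ; lia.
  exists y; split=> //; apply: contra xMI; apply: span_sub; exact: subsetDl.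
have yJ : y \notin J.
  have := y_out; apply: contra => yJ; apply: span_mem; rewrite !inE yJ andbT.
  by apply: contraNneq xI => <-.
have iJ' : indep (y |: (J :\ x)) by rewrite indep_swap.
have := opt x y yI xI x_swap.
have := IHk (y |: (J :\ x)); rewrite weight_swap //.
have -> : #|y |: (J :\ x)| = #|I|.
  by rewrite cardsU1 !inE negb_and yJ orbT -cardJ (cardsD1 x J) xJ.
move=> /(_ _ iJ' erefl) le1 le2.
suff: (weight u J + u y - u x <= weight u I)%R by lia.
apply: le1; rewrite ltnS in lt_k; apply: leq_trans lt_k.
apply: proper_card; apply/properP; split.
  by apply/subsetP => z; rewrite !inE => /andP[zI /predU1P[zy|/andP[_ ->]]];
     rewrite ?zI //; rewrite zy yI in zI.
by exists x; rewrite !inE ?xJ ?xI ?eqxx //= orbF; apply: contraNneq xI => ->.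
Qed.

(** * Simultaneous exchanges between elements of equal weight *)

Section Swap.
Variables (I : {set T}) (u : T -> int) (m : nat) (y x : nat -> T).
Let Y : {set T} := [set y (i : 'I_m) | i : 'I_m].
Let Z : {set T} := [set x (i : 'I_m) | i : 'I_m].
Hypothesis iI : indep I.
Hypothesis optI : locally_optimal u I.
Hypothesis yI : forall i, i < m -> y i \in I.
Hypothesis xI : forall i, i < m -> x i \notin I.
Hypothesis y_inj : forall i j, i < m -> j < m -> y i = y j -> i = j.
Hypothesis x_inj : forall i j, i < m -> j < m -> x i = x j -> i = j.
Hypothesis u_tight : forall i, i < m -> u (y i) = u (x i).
Hypothesis swap : forall i, i < m -> x i \notin M (I :\ y i).
(** The triangularity condition within a weight class: [x j] cannot replace an earlier [y i].
    Between different classes local optimality plays the corresponding part. *)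
Hypothesis no_shortcut : forall i j, i < j -> j < m -> u (y i) = u (x j) ->
  x j \in M (I :\ y i).

Let J := (I :\: Y) :|: Z.

Let cardY : #|Y| = m.
Proof.
by rewrite card_imset ?card_ord // => i j /y_inj E; apply/val_inj/E.
Qed.

Let sYI : Y \subset I.
Proof. by apply/subsetP => _ /imsetP[i _ ->]; apply: yI. Qed.

Let cardJ : #|J| <= #|I|.
Proof.
apply: leq_trans (leq_card_setU _ _) _; rewrite cardsD (setIidPr sYI) cardY.
have : #|Z| <= m by apply: leq_trans (leq_imset_card _ _) _; rewrite card_ord.
by have := subset_leq_card sYI; rewrite cardY; lia.
Qed.

(* Process the pairs by decreasing weight, and pairs of equal weight from the
   last one to the first: the fundamental circuit of [x j] then meets [Y] only
   in [y j] and in elements already known to be spanned by [J]. *)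
Lemma swap_span : (forall i, i < m -> x i \in M I) -> I \subset M J.
Proof.
move=> xMI.
suff sYJ : Y \subset M J.
  apply/subsetP => z zI; have [/(subsetP sYJ)//|zY] := boolP (z \in Y).
  by apply: span_mem; rewrite !inE zY zI.
apply/subsetP => _ /imsetP[i0 _ ->]; apply/negPn/negP => bad0.
(* Since indices are below [m.+1], [F] orders pairs lexicographically by weight and index; its
   maximum over the unspanned [y i] is the first failure in the order of processing. *)
pose F (i : 'I_m) : int := (u (y i) * m.+1%:Z + i%:Z)%R.
case: (@Order.TotalTheory.arg_maxP _ int 'I_m i0
  (fun i => y i \notin M J) F bad0) => j badj jmax.
case/negP: badj.
have [C [sCI xC Cswap]] := fundamental_circuit iI (xMI j (ltn_ord j)).
have yC : y j \in C.
  apply: contraT => yC; have := swap (ltn_ord j); rewrite (span_sub _ xC) //.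
  by apply/subsetP => z zC; rewrite !inE (subsetP sCI _ zC) andbT; apply: contraNneq yC => <-.
have [_] := Cswap _ yC; apply: span_le; apply/subsetP => z.
rewrite in_setU1 => /predU1P[->|]; first by apply: span_mem; rewrite in_setU imset_f ?orbT.
rewrite in_setD1 => /andP[z_neq zC].
have [/imsetP[i _ zE]|zY] := boolP (z \in Y); last first.
  by apply: span_mem; rewrite !inE zY (subsetP sCI _ zC).
apply: contraT; rewrite zE => bad.
have [arc _] := Cswap z zC; rewrite zE in arc.
(* As [x j] can replace [y i], the latter weighs at least as much as [y j]. Maximality of [F j]
   leaves only equal weights with [i < j], which [no_shortcut] excludes. *)
have le_u := optI (yI (ltn_ord i)) (xI (ltn_ord j)) arc.
have := jmax i bad; rewrite /F.
have := u_tight (ltn_ord j); have := ltn_ord i; have := ltn_ord j.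
have ij : i <> j :> nat by move=> ij; rewrite zE ij eqxx in z_neq.
have [lt_ij|ge_ij] := ltnP i j.
  have := no_shortcut lt_ij (ltn_ord j); rewrite (negPf arc).
  move: (u (y i)) (u (y j)) (u (x j)) le_u => a b c; nia.
by move: (u (y i)) (u (y j)) (u (x j)) le_u => a b c; nia.
Qed.

Lemma swap_indep : (forall i, i < m -> x i \in M I) -> indep J.
Proof. by move=> xMI; apply: indep_span_card iI (swap_span xMI) cardJ. Qed.

Let weightJ : weight u J = weight u I.
Proof.
have JZ : J :&: Z = Z by apply/setIidPr/subsetUr.
have JDZ : J :\: Z = I :\: Y.
  apply/setP => z; rewrite in_setD in_setU in_setD; have [/imsetP[i _ ->]|] := boolP (z \in Z).
    by rewrite (negPf (xI (ltn_ord i))) andbF.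
  by rewrite orbF.
rewrite /weight (big_setID Z) /= JZ JDZ (big_setID Y (A := I)) /= (setIidPr sYI).
congr (_ + _)%R; rewrite !big_imset /=; first 1 last.
- by move=> i j _ _ /y_inj E; apply/val_inj/E.
- by move=> i j _ _ /x_inj E; apply/val_inj/E.
by apply: eq_bigr => i _; rewrite u_tight.
Qed.

Variable x0 : T.
Hypothesis x0_new : x0 \notin M I.
Hypothesis x0_max : forall z, z \notin M I -> (u z <= u x0)%R.
Hypothesis x0_first : forall i, i < m -> x i \notin M I -> u (x i) <> u x0.

(** An element [x0] outside the span may replace any element of [I], so none of these is lighter
    than [x0], while nothing outside the span is heavier. An [x i] outside the span would thus have
    exactly the weight of [x0], against [x0_first]. Hence the exchanged set spans [I], and [x0] can
    be added. The result weighs as much as [x0 |: I], which is locally optimal. *)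
Lemma augment_side :
  [/\ indep (x0 |: J), #|x0 |: J| = #|I|.+1 & globally_optimal u (x0 |: J)].
Proof.
have x0_le z : z \in I -> (u x0 <= u z)%R.
  move=> zI; apply: optI => //; first by apply: contra x0_new; apply: span_mem.
  by apply: contra x0_new; apply/span_sub/subsetDl.
have xMI i : i < m -> x i \in M I.
  move=> lt_i; apply: contraT => out; have /(_ lt_i out) := @x0_first i.
  by have := x0_max out; have := x0_le _ (yI lt_i); rewrite u_tight //; lia.
have iJ := swap_indep xMI; have sIJ := swap_span xMI.
have x0J : x0 \notin M J.
  apply: contra x0_new; apply: span_le; apply/subsetP => z; rewrite in_setU in_setD.
  by case/orP=> [/andP[_]|/imsetP[i _ ->]]; [apply: span_mem | apply: xMI].
have x0nJ : x0 \notin J by apply: contra x0J; apply: span_mem.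
have x0nI : x0 \notin I by apply: contra x0_new; apply: span_mem.
have eqJ : #|J| = #|I| by apply/eqP; rewrite eqn_leq cardJ indep_card.
split; [exact: indep_add | by rewrite cardsU1 x0nJ eqJ |].
move=> K iK; rewrite cardsU1 x0nJ eqJ => cardK.
have -> : weight u (x0 |: J) = weight u (x0 |: I).
  by rewrite /weight !big_setU1 //= -/(weight u J) weightJ.
have iI0 := indep_add iI x0_new.
apply: locally_globally_optimal => //; last by rewrite cardsU1 x0nI.
move=> z v; rewrite in_setU1 => /predU1P[->|vI]; rewrite in_setU1 negb_or => /andP[zx0 zI].
  rewrite setU1K //; exact: x0_max.
move=> out; apply: optI => //; apply: contra out; apply: span_sub.
by apply/setSD/subsetUr.
Qed.

End Swap.

End Matroid.

(** * Weighted matroid intersection *)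

Section Intersection.
Variables (T : finType) (M1 M2 : matroid T) (w : T -> nat).
Implicit Types (A I J : {set T}) (x y z : T).

Definition common A : bool := indep M1 A && indep M2 A.

Definition split_optimal I : Prop :=
  exists w1 w2 : T -> int,
    [/\ forall z, (w z)%:Z%R = (w1 z + w2 z)%R,
        globally_optimal M1 w1 I & globally_optimal M2 w2 I].

Lemma split_optimal_max I J :
  split_optimal I -> common J -> #|J| = #|I| -> \sum_(z in J) w z <= \sum_(z in I) w z.
Proof.
move=> [w1 [w2 [wE opt1 opt2]]] /andP[iJ1 iJ2] cardJ.
have sumE A : (\sum_(z in A) w z)%:Z%R = (weight w1 A + weight w2 A)%R.
  rewrite /weight -big_split /= -[LHS]natz natr_sum; apply: eq_bigr => z _.
  by rewrite natz wE.
have := opt1 J iJ1 cardJ; have := opt2 J iJ2 cardJ.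
by have := sumE I; have := sumE J; lia.
Qed.

Lemma common0 : common set0.
Proof. by apply/andP; split; apply/indepP => a; rewrite inE. Qed.

Lemma split_optimal0 : split_optimal set0.
Proof.
exists (fun z => (w z)%:Z%R), (fun=> 0%R); split=> [z|J _|J _]; first by rewrite addr0.
  by rewrite cards0 => /eqP; rewrite cards_eq0 => /eqP->.
by rewrite cards0 => /eqP; rewrite cards_eq0 => /eqP->.
Qed.

(** * The exchange graph *)

Section Exchange.
Variable I : {set T}.

(** Steps out of [I] are exchanges in [M1], steps into [I] exchanges in [M2]. A walk from an element
    free in [M1] to one free in [M2] therefore alternates, beginning and ending outside [I]. *)
Definition arc : rel T := [rel z z' |
  if z \in I then (z' \notin I) && (z' \notin M1 (I :\ z))
  else (z' \in I) && (z \notin M2 (I :\ z'))].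

Definition source x : bool := x \notin M1 I.
Definition sink x : bool := x \notin M2 I.
Definition cost z : int := if z \in I then (w z)%:Z%R else (- (w z)%:Z)%R.

Lemma source_notin x : source x -> x \notin I.
Proof. by apply: contra; apply: span_mem. Qed.

Lemma sink_notin x : sink x -> x \notin I.
Proof. by apply: contra; apply: span_mem. Qed.

Lemma arc_parity z z' : arc z z' -> (z' \in I) = (z \notin I).
Proof. by rewrite /arc /=; case: (z \in I) => /andP[] // /negPf. Qed.

(** The min-max argument with [R] as certificate: the part of [J] in [R] is spanned in [M2] by the
    part of [I] in [R], the rest of [J] is spanned in [M1] by the rest of [I]. A fundamental circuit
    crossing the boundary would give an arc leaving [R]. *)
Lemma no_augmentation_max (R : pred T) J :
  common I -> (forall x, source x -> R x) -> (forall z z', R z -> arc z z' -> R z') ->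
  (forall x, sink x -> ~~ R x) -> common J -> #|J| <= #|I|.
Proof.
move=> /andP[iI1 iI2] srcR closedR sinkR /andP[iJ1 iJ2].
pose RS : {set T} := [set z | R z].
rewrite -(cardsID RS J) -(cardsID RS I); apply: leq_add.
  apply: (indep_card (indep_sub (subsetIl _ _) iJ2)).
  apply/subsetP => x; rewrite !inE => /andP[_ Rx].
  have [xI|xI] := boolP (x \in I); first by apply: span_mem; rewrite !inE xI.
  have xM : x \in M2 I by apply: contraLR Rx; apply: sinkR.
  have [C [sCI xC Cswap]] := fundamental_circuit iI2 xM.
  apply: span_sub xC; apply/subsetP => y yC; rewrite !inE (subsetP sCI) //=.
  have [out _] := Cswap y yC; apply: (closedR x) => //.
  by rewrite /arc /= (negPf xI) out (subsetP sCI).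
apply: (indep_card (indep_sub (subsetDl _ _) iJ1)).
apply/subsetP => x; rewrite !inE => /andP[Rx _].
have [xI|xI] := boolP (x \in I); first by apply: span_mem; rewrite !inE xI Rx.
have xM : x \in M1 I by apply: contraNT Rx; apply: srcR.
have [C [sCI xC Cswap]] := fundamental_circuit iI1 xM.
apply: span_sub xC; apply/subsetP => y yC; rewrite !inE (subsetP sCI) // andbT.
have [out _] := Cswap y yC; apply: contra Rx => Ry; apply: (closedR y) => //.
by rewrite /arc /= (subsetP sCI) // xI out.
Qed.

(** * Augmentation along a shortest walk *)

Section Augment.
(** [d z] and [l z] stand for the cost and the number of vertices of an optimal walk to [z], cost
    being compared first; [q] is an optimal walk to a sink. The hypotheses are the triangle
    inequalities, each with its refinement to lengths in the case of equality. *)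
Variables (d : T -> int) (l : T -> nat) (reach : pred T) (m : nat) (q : nat -> T).
Hypothesis comI : common I.
Hypothesis optI : split_optimal I.
Hypothesis d_source : forall x, source x ->
  [/\ reach x, (d x <= cost x)%R & d x = cost x -> l x <= 1].
Hypothesis d_arc : forall z z', reach z -> arc z z' ->
  [/\ reach z', (d z' <= d z + cost z')%R & d z' = (d z + cost z')%R -> l z' <= (l z).+1].
Hypothesis q_source : source (q 0).
Hypothesis q_sink : sink (q m.*2).
Hypothesis q_arc : forall i, i < m.*2 -> arc (q i) (q i.+1).
Hypothesis q_reach : forall i, i <= m.*2 -> reach (q i).
Hypothesis q_len : forall i, i <= m.*2 -> l (q i) = i.+1.
Hypothesis d_q0 : d (q 0) = cost (q 0).
Hypothesis d_q : forall i, i < m.*2 -> d (q i.+1) = (d (q i) + cost (q i.+1))%R.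
Hypothesis d_sink : forall x, sink x -> reach x ->
  (d (q m.*2) <= d x)%R /\ (d x = d (q m.*2) -> m.*2 < l x).

Let q_parity i : i <= m.*2 -> (q i \in I) = odd i.
Proof.
elim: i => [_|i IHi lt_i]; first exact/negbTE/source_notin.
by rewrite (arc_parity (q_arc lt_i)) IHi // ltnW.
Qed.

Let q_inj i j : i <= m.*2 -> j <= m.*2 -> q i = q j -> i = j.
Proof. by move=> li lj E; have := q_len li; rewrite E (q_len lj) => -[]. Qed.

Definition augmented : {set T} :=
  [set z | (z \in I) (+) [exists i : 'I_(m.*2.+1), z == q i]].

Let augmentedE x0 (Y Z : {set T}) :
  (forall z, z \in Y <-> exists i, [/\ i <= m.*2, odd i & z = q i]) ->
  (forall z, z \in x0 |: Z <-> exists i, [/\ i <= m.*2, ~~ odd i & z = q i]) ->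
  x0 |: ((I :\: Y) :|: Z) = augmented.
Proof.
move=> YP ZP; apply/setP => z; rewrite setUCA in_setU in_setD [in RHS]inE.
have -> : [exists i : 'I_(m.*2.+1), z == q i] = (z \in Y) || (z \in x0 |: Z).
  apply/existsP/orP => [[i /eqP zE]|[/YP|/ZP] [i [le_i _ zE]]].
  - have le_i : i <= m.*2 by rewrite -ltnS.
    by case: (boolP (odd i)) => par; [left; apply/YP | right; apply/ZP]; exists i.
  - by exists (Ordinal (le_i : i < m.*2.+1)); rewrite zE.
  - by exists (Ordinal (le_i : i < m.*2.+1)); rewrite zE.
case: (boolP (z \in Y)) => [/YP[i [le_i par zE]]|_].
  rewrite zE q_parity // par /=; apply/negP => /ZP[j [le_j parj /q_inj E]].
  by rewrite -(E le_i le_j) par in parj.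
case: (boolP (z \in x0 |: Z)) => [/ZP[i [le_i par zE]]|_]; last by rewrite orbF addbF.
by rewrite zE q_parity // (negPf par) orbT.
Qed.

(** The symmetric difference with the walk is read in two ways. For [M1] the source [q 0] is added
    and each odd vertex is exchanged for its successor; for [M2] the sink is added and each odd
    vertex is exchanged for its predecessor. *)
Lemma augment_correct :
  [/\ common augmented, #|augmented| = #|I|.+1 & split_optimal augmented].
Proof.
have [/andP[iI1 iI2] [w1 [w2 [wE opt1 opt2]]]] := (comI, optI).
have lo1 := globally_locally_optimal iI1 opt1.
have lo2 := globally_locally_optimal iI2 opt2.
(* Distances from the sources determine the new splitting [u1 + u2]; where they
   are infinite, the old splitting shifted by a large [N] serves. *)
pose F z := `|w1 z|%N + `|w2 z|%N + `|d z|%N + w z.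
pose B := \max_z F z.
have FB z : F z <= B by apply: leq_bigmax.
(* All values compared are at most [B] in absolute value, so the shift decides every comparison
   between a reachable and an unreachable element. *)
pose N : int := (4 * B)%N%:Z%R.
pose u1 z : int :=
  if reach z then if z \in I then d z else (d z + (w z)%:Z)%R else (w1 z + N)%R.
pose u2 z : int := ((w z)%:Z - u1 z)%R.
have lu1 : locally_optimal M1 u1 I.
  move=> x y yI xI out; have a_yx : arc y x by rewrite /arc /= yI xI out.
  have := FB x; have := FB y; have := lo1 x y yI xI out; have := d_arc _ a_yx.
  rewrite /u1 /F /N yI (negPf xI) /cost (negPf xI).
  case: (reach y) => [/(_ isT)[-> le_d _]|_]; first by lia.
  by case: (reach x); lia.
have lu2 : locally_optimal M2 u2 I.
  move=> x y yI xI out; have a_xy : arc x y by rewrite /arc /= yI (negPf xI) out.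
  have := FB x; have := FB y; have := lo2 x y yI xI out; have := d_arc _ a_xy.
  have := wE x; have := wE y.
  rewrite /u2 /u1 /F /N yI (negPf xI) /cost yI.
  case: (reach x) => [wx wy /(_ isT)[-> le_d _]|wx wy _]; first by lia.
  by case: (reach y); lia.
have par1 i : i < m -> (q i.*2.+1 \in I) = true by move=> lt; rewrite q_parity /=; lia.
have par0 i : i <= m -> (q i.*2 \in I) = false by move=> lt; rewrite q_parity; lia.
have u1_even i : i <= m -> u1 (q i.*2) = (d (q i.*2) + (w (q i.*2))%:Z)%R.
  by move=> le_i; rewrite /u1 q_reach ?par0 //; lia.
have u1_odd i : i < m -> u1 (q i.*2.+1) = d (q i.*2.+1).
  by move=> le_i; rewrite /u1 q_reach ?par1 //; lia.
have c_even i : i <= m -> cost (q i.*2) = (- (w (q i.*2))%:Z)%R.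
  by move=> le_i; rewrite /cost par0.
have u1_0 : u1 (q 0) = 0%R by rewrite (u1_even 0) // d_q0 (c_even 0) //; lia.
have dq1 i : i < m -> d (q i.*2.+1) = (d (q i.*2) + (w (q i.*2.+1))%:Z)%R.
  by move=> lt; rewrite d_q ?/cost ?par1 //; lia.
have dq2 i : i < m -> d (q i.*2.+2) = (d (q i.*2.+1) - (w (q i.*2.+2))%:Z)%R.
  move=> lt; rewrite d_q ?/cost; last by lia.
  by rewrite -[i.*2.+2]/(i.+1.*2) par0.
have a1 i : i < m -> q i.*2.+2 \notin M1 (I :\ q i.*2.+1).
  move=> lt; have : i.*2.+1 < m.*2 by lia.
  by move/q_arc; rewrite /arc /= par1 // => /andP[].
have a2 i : i < m -> q i.*2 \notin M2 (I :\ q i.*2.+1).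
  move=> lt; have : i.*2 < m.*2 by lia.
  by move/q_arc; rewrite /arc /= par0 ?par1 //= ltnW.
pose Y1 : {set T} := [set q (i : 'I_m).*2.+1 | i : 'I_m].
pose Z1 : {set T} := [set q (i : 'I_m).*2.+2 | i : 'I_m].
have E1 : q 0 |: ((I :\: Y1) :|: Z1) = augmented.
  apply: augmentedE => z; split.
  - by case/imsetP=> i _ ->; exists i.*2.+1; rewrite /= odd_double; have := ltn_ord i; split=> //; lia.
  - case=> i [le_i par ->]; have lt_i : i./2 < m by lia.
    apply/imsetP; exists (Ordinal lt_i) => //=; congr q; lia.
  - rewrite in_setU1 => /predU1P[->|/imsetP[i _ ->]]; first by exists 0.
    by exists i.*2.+2; rewrite /= odd_double; have := ltn_ord i; split=> //; lia.
  - case=> -[|i] [le_i par ->]; first by rewrite setU11.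
    have lt_i : i./2 < m by lia.
    rewrite in_setU1; apply/orP; right; apply/imsetP; exists (Ordinal lt_i) => //=; congr q; lia.
(* For [M2] the pairs are numbered from the end of the walk, so that a forbidden exchange is again a
   forward jump. *)
pose r i := (m.-1 - i).*2.
pose Y2 : {set T} := [set q (r (i : 'I_m)).+1 | i : 'I_m].
pose Z2 : {set T} := [set q (r (i : 'I_m)) | i : 'I_m].
have E2 : q m.*2 |: ((I :\: Y2) :|: Z2) = augmented.
  apply: augmentedE => z; split.
  - case/imsetP=> i _ ->; exists (r i).+1; rewrite /= /r odd_double.
    by have := ltn_ord i; split=> //; lia.
  - case=> i [le_i par ->]; have lt_i : m.-1 - i./2 < m by lia.
    apply/imsetP; exists (Ordinal lt_i) => //=; rewrite /r; congr q; lia.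
  - rewrite in_setU1 => /predU1P[->|/imsetP[i _ ->]]; first by exists m.*2; rewrite odd_double.
    by exists (r i); rewrite /r odd_double; have := ltn_ord i; split=> //; lia.
  - case=> i [le_i par ->]; rewrite in_setU1; have [->|neq] := eqVneq i m.*2; first by rewrite eqxx.
    have lt_i : m.-1 - i./2 < m by lia.
    by apply/orP; right; apply/imsetP; exists (Ordinal lt_i) => //=; rewrite /r; congr q; lia.
have side1 : [/\ indep M1 augmented, #|augmented| = #|I|.+1 & globally_optimal M1 u1 augmented].
  rewrite -E1.
  apply: (@augment_side T M1 I u1 m (fun i => q i.*2.+1) (fun i => q i.*2.+2)) => //.
  - by move=> i lt; exact: negbT (par0 i.+1 lt).
  - by move=> i j li lj /q_inj; lia.
  - by move=> i j li lj /q_inj; lia.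
  - move=> i lt; have := dq2 i lt; rewrite -[i.*2.+2]/(i.+1.*2) u1_odd // u1_even //; lia.
  - move=> i j lt_ij lt_j; rewrite -[j.*2.+2]/(j.+1.*2) u1_odd ?u1_even //; last by lia.
    move=> tight; apply: contraT => out.
    (* A tight arc jumping forward would reach its head at the same cost with fewer vertices. *)
    have a_ij : arc (q i.*2.+1) (q j.+1.*2).
      by rewrite /arc /= par1 ?out ?andbT ?par0 //; lia.
    have [|_ _] := d_arc _ a_ij; first by apply: q_reach; lia.
    rewrite /cost par0 // !q_len; try lia.
  - move=> z out; have [rz le_z _] := d_source out.
    have zI := source_notin out; move: le_z.
    by rewrite u1_0 /u1 rz (negPf zI) /cost (negPf zI); lia.
  - move=> i lt out; rewrite -[i.*2.+2]/(i.+1.*2) u1_even // u1_0 => tight.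
    have [_ _] := d_source out; rewrite -[i.*2.+2]/(i.+1.*2) c_even // q_len; lia.
have u2_even i : i <= m -> u2 (q i.*2) = (- d (q i.*2))%R.
  by move=> le_i; rewrite /u2 u1_even //; lia.
have u2_odd i : i < m -> u2 (q i.*2.+1) = ((w (q i.*2.+1))%:Z - d (q i.*2.+1))%R.
  by move=> le_i; rewrite /u2 u1_odd.
have side2 : [/\ indep M2 augmented, #|augmented| = #|I|.+1 & globally_optimal M2 u2 augmented].
  rewrite -E2.
  apply: (@augment_side T M2 I u2 m (fun i => q (r i).+1) (fun i => q (r i))) => //.
  - by move=> i lt; apply: par1; lia.
  - by move=> i lt; apply/negbT/par0; lia.
  - by move=> i j li lj /q_inj; rewrite /r; lia.
  - by move=> i j li lj /q_inj; rewrite /r; lia.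
  - move=> i lt; rewrite u2_odd ?u2_even ?dq1; lia.
  - by move=> i lt; apply: a2; lia.
  - move=> i j lt_ij lt_j; rewrite u2_odd ?u2_even; try lia.
    move=> tight; apply: contraT => out.
    have a_ij : arc (q (r j)) (q (r i).+1).
      by rewrite /arc /= par0 ?out ?andbT ?par1 //; lia.
    have [|_ _] := d_arc _ a_ij; first by apply: q_reach; rewrite /r; lia.
    by rewrite /cost par1 ?q_len /r; lia.
  - move=> z out; have zI := sink_notin out; have := d_sink out.
    rewrite u2_even // /u2 /u1 (negPf zI).
    case: (reach z) => [/(_ isT)[le_z _]|_]; first by lia.
    by have := FB z; have := FB (q m.*2); have := wE z; rewrite /F /N; lia.
  - move=> i lt out; rewrite !u2_even //; last by lia.
    move=> tight; have [|_] := d_sink out; first by apply: q_reach; rewrite /r; lia.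
    by rewrite q_len /r; lia.
have [ind1 card1 go1] := side1; have [ind2 _ go2] := side2.
split=> //; first by rewrite /common ind1.
by exists u1, u2; split=> // z; rewrite /u2; lia.
Qed.

End Augment.

End Exchange.

End Intersection.

(** * Shortest augmenting walks *)

Section Walks.
Variables (T : finType) (w : T -> nat) (inI : pred T) (ar : rel T) (src snk : pred T).
Implicit Types (z : T) (p : seq T) (D : seq (seq T)).

(* Walks are stored backwards, the empty list standing for "no walk".  They are
   compared by [key], whose scaling factor makes the length of a walk break ties
   between walks of equal cost. *)

Definition gain p : nat := \sum_(z <- p) if inI z then w z else 0.
Definition loss p : nat := \sum_(z <- p) if inI z then 0 else w z.
(** A stored walk has at most [#|T|.+1] vertices and an extension of it one more, so a difference in
    length never outweighs a difference in cost. *)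
Definition scale : nat := #|T|.+3.

(** The comparison of keys with the negative terms moved to the other side, so that only natural
    numbers are computed. *)
Definition shorter p p' : bool :=
  size p + scale * (gain p + loss p') < size p' + scale * (gain p' + loss p).

Definition key_cost z : int :=
  (1 + scale%:Z * (if inI z then (w z)%:Z else - (w z)%:Z))%R.

Definition key p : int := (\sum_(z <- p) key_cost z)%R.

Lemma key_cons z p : key (z :: p) = (key_cost z + key p)%R.
Proof. by rewrite /key big_cons. Qed.

Lemma keyE p : key p = ((size p)%:Z + scale%:Z * ((gain p)%:Z - (loss p)%:Z))%R.
Proof.
rewrite /key /gain /loss /key_cost; elim: p => [|z p IHp]; first by rewrite !big_nil subrr mulr0 addr0.
by rewrite !big_cons IHp /= intS !PoszD; case: (inI z); ring.
Qed.

Lemma shorterE p p' : shorter p p' = (key p < key p')%R.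
Proof.
rewrite /shorter !keyE; move: scale => k.
rewrite !mulnDr -ltz_nat !PoszD !PoszM !mulrBr.
move: (k%:Z * (gain p)%:Z)%R (k%:Z * (gain p')%:Z)%R (k%:Z * (loss p)%:Z)%R.
by move: (k%:Z * (loss p')%:Z)%R => a b c d; apply/idP/idP; lia.
Qed.

Definition better p acc : seq T :=
  if p is [::] then acc else if acc is [::] then p else
  if shorter p acc then p else acc.

Definition best (f : seq T -> seq T) D : seq T :=
  foldl (fun acc p => better (f p) acc) [::] D.

(** A walk already ending at [z'] is kept, so that one selection over all stored walks both
    preserves and improves the one for [z']. *)
Definition extend z' p : seq T :=
  if p is z :: _ then
    if z == z' then p else if ar z z' then z' :: p else [::]
  else [::].

Definition at_sink p : seq T :=
  if p is z :: _ then if snk z then p else [::] else [::].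

Definition init_walks : seq (seq T) := [seq if src z then [:: z] else [::] | z <- enum T].
Definition round D : seq (seq T) := [seq best (extend z) D | z <- enum T].
Definition walks : seq (seq T) := iter #|T| round init_walks.
Definition best_walk : seq T := best at_sink walks.

Lemma bestP f D :
  (best f D = [::] /\ forall p, p \in D -> f p = [::]) \/
  (exists p, [/\ p \in D, best f D = f p, f p != [::] &
     forall p', p' \in D -> f p' != [::] -> (key (f p) <= key (f p'))%R]).
Proof.
rewrite /best; elim/last_ind: D => [|D p IHD]; first by left.
rewrite -cats1 foldl_cat /=; case: IHD => [[-> none]|[p0 [p0D -> p0n0 p0min]]].
  have [fp|fp] := eqVneq (f p) [::].
    left; rewrite /= fp; split=> // p'; rewrite mem_cat inE => /orP[/none //|/eqP->] //.
  right; exists p; split=> //; first by rewrite mem_cat inE eqxx orbT.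
    by case: (f p) fp.
  by move=> p'; rewrite mem_cat inE => /orP[/none ->|/eqP->].
right; have [fp|fp] := eqVneq (f p) [::].
  exists p0; rewrite fp mem_cat p0D; split=> // p'; rewrite mem_cat inE.
  by move=> /orP[/p0min|/eqP->] //; rewrite fp.
have -> : better (f p) (f p0) = if shorter (f p) (f p0) then f p else f p0.
  by case: (f p) (f p0) fp p0n0 => [|? ?] [|? ?].
case: ifP; rewrite shorterE => cmp.
  exists p; rewrite mem_cat inE eqxx orbT; split=> // p'; rewrite mem_cat inE.
  by move=> /orP[p'D /(p0min _ p'D)|/eqP->] //; lia.
exists p0; rewrite mem_cat p0D; split=> // p'; rewrite mem_cat inE.
by move=> /orP[p'D /(p0min _ p'D)|/eqP->] //; lia.
Qed.

Lemma size_walks i (D := iter i round init_walks) :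
  size D = #|T| /\ forall p, p \in D -> size p <= i.+1.
Proof.
rewrite {}/D; split; first by case: i => [|i]; rewrite ?iterS size_map -cardE.
elim: i => [|i IHi] p.
  by case/mapP=> z _ ->; case: ifP.
rewrite iterS => /mapP[z _ ->].
case: (bestP (extend z) (iter i round init_walks)) => [[-> _]//|[p' [/IHi le_p -> _ _]]].
rewrite /extend; case: p' le_p => // v s le_p.
by case: ifP => _; [apply: leqW | case: ifP].
Qed.

Definition walk p : bool :=
  if p is z :: s then path (fun a b => ar b a) z s && src (last z s) else false.

Hypothesis ar_irr : irreflexive ar.

(** The Bellman-Ford invariant: a walk is dominated through its tail, for which an earlier round has
    stored a walk that the current round extends. *)
Lemma walksP i (D := iter i round init_walks) :
  (forall p, p \in D -> p != [::] -> walk p /\ size p <= i.+1) /\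
  (forall z s, walk (z :: s) -> size s <= i ->
     exists t, z :: t \in D /\ (key (z :: t) <= key (z :: s))%R).
Proof.
rewrite {}/D; elim: i => [|i [IH1 IH2]]; rewrite ?iterS /=.
  split=> [p /mapP[z _ ->]|z [|v s] //= src_z _].
    by case: ifP => //= ->.
  by exists [::]; split=> //; apply/mapP; exists z; rewrite ?mem_enum // src_z.
set D := iter i round init_walks in IH1 IH2 *.
split=> [_ /mapP[z' _ ->]|z s wzs sz_s].
  case: (bestP (extend z') D) => [[-> //]|[p [pD -> + _ _]]].
  case: p pD => [|z s] //= pD; have [//|wp sz_p] := IH1 _ pD.
  case: (z =P z') => [_ _|_]; first by split; [exact: wp | exact: leqW sz_p].
  by case: (boolP (ar z z')) => // az _; move: wp; rewrite /walk /= az.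
have [t [tD le_t]] : exists t, t \in D /\ exists t', [/\ extend z t = z :: t' &
    (key (z :: t') <= key (z :: s))%R].
  case: (ltnP i (size s)) => [lt_i|le_i]; last first.
    have [t [tD le_t]] := IH2 _ _ wzs le_i; exists (z :: t); split=> //.
    by exists t; rewrite /extend eqxx.
  case: s sz_s wzs lt_i => // v s sz_s /andP[/= /andP[avz pvs] src_s] lt_i.
  have [||t [tD le_t]] := IH2 v s; rewrite /walk ?pvs //.
  exists (v :: t); split=> //; exists (v :: t); rewrite /extend avz.
  case: eqP => [E|_]; first by rewrite E ar_irr in avz.
  by split=> //; move: le_t; rewrite !key_cons; lia.
case: le_t => t' [ext le_t'].
case: (bestP (extend z) D) => [[_ /(_ _ tD)]|[p [pD bestE n0 pmin]]]; first by rewrite ext.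
have := pmin _ tD; rewrite ext => /(_ isT) le_p.
have : best (extend z) D \in [seq best (extend z) D | z <- enum T].
  by apply: map_f; rewrite mem_enum.
rewrite bestE; move: n0 le_p; rewrite /extend; case: p pD {bestE pmin} => // v p pD.
case: (v =P z) => [->|_]; first by move=> _ le_p mem; exists p; split=> //; apply: le_trans le_t'.
case: (boolP (ar v z)) => // _ _ le_p mem.
by exists (v :: p); split=> //; apply: le_trans le_t'.
Qed.

Variable phi : T -> int.
Hypothesis ar_phi : forall z z', ar z z' ->
  (phi z' - phi z + 1 <= key_cost z')%R.

Lemma key_path z s : path (fun a b => ar b a) z s ->
  (phi z - phi (last z s) + (size s)%:Z <= key (belast z s))%R.
Proof.
elim: s z => [|v s IHs] z /=; first by rewrite /key big_nil; lia.
by case/andP=> /ar_phi le_z /IHs; rewrite key_cons; lia.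
Qed.

Lemma key_cat p p' : key (p ++ p') = (key p + key p')%R.
Proof. by rewrite /key big_cat. Qed.

(** Cutting out a closed part does not increase the key: by telescoping the potential [phi], the key
    of a cycle is at least its length. *)
Lemma walk_uniq z s : walk (z :: s) ->
  exists t, [/\ walk (z :: t), uniq (z :: t) & (key (z :: t) <= key (z :: s))%R].
Proof.
elim: s z => [|v s IHs] z wzs; first by exists [::].
have /andP[/= /andP[avz pvs] src_s] := wzs.
have [|t [/andP[pvt src_t] uvt le_t]] := IHs v; first by rewrite /walk pvs.
have le_t' : (key (z :: v :: t) <= key (z :: v :: s))%R.
  by move: le_t; rewrite !key_cons; lia.
have wzt : walk (z :: v :: t) by rewrite /walk /= avz pvt.
have [zt|zt] := boolP (z \in v :: t); last by exists (v :: t); split=> //=; rewrite zt.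
case/splitPr: zt le_t' uvt wzt => a b le_t' uvt /andP[+ src_b].
rewrite cat_path /= => /and3P[pza az pzb].
exists b; split.
- by move: src_b; rewrite /walk pzb last_cat.
- by move: uvt; rewrite cat_uniq => /and3P[].
apply: le_trans le_t'; rewrite -cat_cons key_cat -[leLHS]add0r lerD2r.
have := @key_path z (rcons a z); rewrite rcons_path pza last_rcons size_rcons.
by move=> /(_ az); rewrite belast_rcons; lia.
Qed.

Lemma walk_dominated z s : walk (z :: s) ->
  exists t, z :: t \in walks /\ (key (z :: t) <= key (z :: s))%R.
Proof.
move=> /walk_uniq[t [wt ut le_t]].
have [_ /(_ z t wt)] := walksP #|T|.
have := card_uniqP ut => /= ct; have := max_card (mem (z :: t)).
rewrite ct => /ltnW sz /(_ sz) [t' [mem le_t']].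
by exists t'; split=> //; exact: le_trans le_t' le_t.
Qed.

End Walks.

(** Turns a comparison of keys back into the lexicographic comparison of cost and length. *)
Lemma scaled_le (k r s : nat) (a b : int) : s < k + r ->
  (r%:Z + k%:Z * a <= s%:Z + k%:Z * b)%R -> (a <= b)%R /\ (a = b -> r <= s).
Proof.
move=> lt_s le_ab; split=> [|eq_ab]; last by move: le_ab; rewrite eq_ab; lia.
rewrite leNgt; apply/negP => lt_ba.
have : (k%:Z * (b + 1) <= k%:Z * a)%R by rewrite ler_wpM2l //; lia.
by rewrite mulrDr mulr1; lia.
Qed.

(** * From the computed walk to an augmentation *)

Section Step.
Variables (T : finType) (M1 M2 : matroid T) (w : T -> nat) (I : {set T}).
Hypotheses (comI : common M1 M2 I) (optI : split_optimal M1 M2 w I).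

Let inI z := z \in I.
Let ar := arc M1 M2 I.
Let src := source M1 I.
Let snk := sink M2 I.
Let keyI := key w inI.
Let K := scale T.
Let D := walks w inI ar src.
Let P := best_walk w inI ar src snk.

Let ar_irr : irreflexive ar.
Proof. by move=> z; apply/negP => /arc_parity; case: (z \in I). Qed.

Let walkI := walk ar src.

Let walkP : (forall p, p \in D -> p != [::] -> walkI p /\ size p <= #|T|.+1) /\
  (forall z s, walkI (z :: s) ->
    exists t, z :: t \in D /\ (keyI (z :: t) <= keyI (z :: s))%R).
Proof.
split; first by have [H _] := walksP w inI src ar_irr #|T|; apply: H.
have [/andP[iI1 iI2] [w1 [w2 [wE opt1 opt2]]]] := (comI, optI).
have lo1 := globally_locally_optimal iI1 opt1.
have lo2 := globally_locally_optimal iI2 opt2.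
(* The potential comes from the splitting. On arcs out of [I] the required inequality is local
   optimality for [w1], on arcs into [I] that for [w2]; the 1 is the share of the new vertex in the
   length. *)
pose phi z : int := if z \in I then (w1 z * K%:Z)%R else (- (w2 z * K%:Z))%R.
move=> z s; apply: (@walk_dominated T w inI ar src ar_irr phi) => {}z z'.
rewrite /key_cost /ar /arc /= /phi /inI; have := wE z; have := wE z'.
case: (boolP (z \in I)) => zI wz' wz /andP[z'I out].
  have := lo1 _ _ zI z'I out; rewrite (negPf z'I) wz' -/K.
  by move: (w1 z) (w1 z') (w2 z') => a b c; nia.
have := lo2 _ _ z'I zI out; rewrite z'I wz' -/K.
by move: (w2 z) (w1 z') (w2 z') => a b c; nia.
Qed.

Let sel z p : seq T := if p is v :: _ then if v == z then p else [::] else [::].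
(** The cheapest stored walk ending at [z], empty if [z] cannot be reached. *)
Let W z := best w inI (sel z) D.
Let reach z := W z != [::].

Let W_spec z : reach z ->
  [/\ exists s, W z = z :: s, walkI (W z), size (W z) <= #|T|.+1 & W z \in D].
Proof.
rewrite /reach /W; case: (bestP w inI (sel z) D) => [[-> //]|[p [pD -> + _]]].
case: p pD => [|v p] //= pD; case: (v =P z) => // vz _.
have [W1 _] := walkP; have [//|wp sz] := W1 _ pD.
by split=> //; exists p; rewrite vz.
Qed.

Let W_min z s : walkI (z :: s) -> reach z /\ (keyI (W z) <= keyI (z :: s))%R.
Proof.
have [_ W2] := walkP; move=> /W2[t [tD le_t]].
rewrite /reach /W; case: (bestP w inI (sel z) D) => [[_ /(_ _ tD)]|[p [pD -> n0 pmin]]].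
  by rewrite /= eqxx.
have := pmin _ tD; rewrite /= eqxx => /(_ isT) le_p; split=> //.
exact: le_trans le_p le_t.
Qed.

Let W_source x : src x -> reach x /\ (keyI (W x) <= keyI [:: x])%R.
Proof. by move=> sx; apply: W_min; rewrite /walkI /= sx. Qed.

Let W_arc z z' : reach z -> ar z z' -> reach z' /\ (keyI (W z') <= keyI (z' :: W z))%R.
Proof.
move=> /W_spec[[s ->] wz _ _] azz'; apply: W_min.
by move: wz; rewrite /walkI /= azz'.
Qed.

Let P_nil : P = [::] -> forall J, common M1 M2 J -> #|J| <= #|I|.
Proof.
move=> P0 J; apply: (@no_augmentation_max _ _ _ _ reach) => //.
- by move=> x /W_source[].
- by move=> z z' rz /(W_arc rz)[].
move=> x sx; apply/negP => /W_spec[[s Ws] _ _ WD].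
move: P0; rewrite /P /best_walk -/D.
case: (bestP w inI (at_sink snk) D) => [[_ /(_ _ WD)]|[p [_ -> /negPf n0 _]]].
  by rewrite Ws /= [snk x]sx.
by move/eqP; rewrite n0.
Qed.

Let csum p : int := (\sum_(z <- p) cost w I z)%R.

Let keyIE p : keyI p = ((size p)%:Z + K%:Z * csum p)%R.
Proof.
rewrite /keyI /key /csum /key_cost; elim: p => [|z p IHp]; first by rewrite !big_nil mulr0 addr0.
by rewrite !big_cons IHp /cost /inI -/K /= intS; ring.
Qed.

Lemma augmenting_step (I' := [set z | (z \in I) (+) (z \in P)]) :
  (I' = I /\ forall J, common M1 M2 J -> #|J| <= #|I|) \/
  [/\ common M1 M2 I', #|I'| = #|I|.+1 & split_optimal M1 M2 w I'].
Proof.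
have [P0|Pn0] := eqVneq P [::].
  left; split; last exact: P_nil.
  by apply/setP => z; rewrite inE P0 in_nil addbF.
right; move: Pn0; rewrite {}/I' /P /best_walk -/D.
case: (bestP w inI (at_sink snk) D) => [[-> //]|[p [pD PE n0 pmin]]] _.
rewrite PE; case: p pD PE n0 pmin => // zl s pD PE.
rewrite [at_sink _ _]/=; case: ifP => // sink_zl _ pmin.
have [W1 _] := walkP; have [//|/andP[pz src0] szp] := W1 _ pD.
(* Walks are stored with the last vertex first; [q] numbers the vertices from the source, and
   [pre i] below is the part up to [q i]. *)
pose p := zl :: s; pose n := size s; pose q i := nth zl p (n - i).
have sz_le i : i <= n -> n - i < size p by rewrite /p /= -/n; lia.
have q0E : q 0 = last zl s by rewrite /q subn0 (last_nth zl).
have qnE : q n = zl by rewrite /q subnn.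
have q_arc i : i < n -> ar (q i) (q i.+1).
  move=> lt_i; have := pathP zl pz (n - i.+1).
  have -> : (n - i.+1 < size s) by rewrite /n in lt_i *; lia.
  move=> /(_ isT); rewrite /q /p /=.
  by have -> : n - i = (n - i.+1).+1 by lia.
pose pre i := drop (n - i) p.
have preE i : i <= n -> pre i = q i :: (if i is j.+1 then pre j else [::]).
  move=> le_i; rewrite /pre (drop_nth zl) ?sz_le //; congr cons.
  case: i le_i => [|i] le_i; first by rewrite subn0 drop_oversize.
  by congr drop; lia.
have sz_pre i : i <= n -> size (pre i) = i.+1.
  by move=> le_i; rewrite /pre size_drop /p /= -/n; lia.
have pre_walk i : i <= n -> walkI (pre i).
  elim: i => [|i IHi] le_i; rewrite preE //; first by rewrite /walkI /= q0E.
  have := IHi (ltnW le_i); rewrite (preE i) ?(ltnW le_i) // /walkI /=.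
  by rewrite q_arc.
have W_pre i : i <= n -> reach (q i) /\ (keyI (W (q i)) <= keyI (pre i))%R.
  by move=> le_i; have := pre_walk i le_i; rewrite preE //; apply: W_min.
(* Initial parts of an optimal walk are optimal: a saving at [q i] would be carried along the
   remaining arcs to a saving at the sink, where the walk was chosen minimal. *)
have W_eq i : i <= n -> keyI (W (q i)) = keyI (pre i).
  move=> le_i; apply/eqP; rewrite eq_le (proj2 (W_pre i le_i)) /=.
  have chain j : i + j <= n -> (keyI (W (q (i + j)%N)) - keyI (pre (i + j)%N)
      <= keyI (W (q i)) - keyI (pre i))%R.
    elim: j => [|j IHj] le_j; first by rewrite addn0.
    rewrite addnS in le_j *; have [rj _] := W_pre (i + j) (ltnW le_j).
    have [_] := W_arc rj (q_arc _ le_j); have := IHj (ltnW le_j).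
    by rewrite (preE (i + j).+1) // /keyI !key_cons; lia.
  have := chain (n - i); rewrite subnKC // => /(_ (leqnn _)).
  suff : (keyI (pre n) <= keyI (W (q n)))%R by lia.
  have [rn _] := W_pre n (leqnn n); have [[t Wt] _ _ WD] := W_spec rn.
  have := pmin _ WD; rewrite Wt qnE /= sink_zl => /(_ isT).
  by rewrite /pre subnn drop0.
pose d z := csum (W z); pose l z := size (W z).
have l_bnd z : reach z -> 0 < l z < K.-1.
  by move=> /W_spec[[t Wt] _ + _]; rewrite /l Wt /K /scale /=; lia.
have d_l z (a : int) (b : nat) : reach z -> b <= K.-1 ->
    (keyI (W z) <= b%:Z + K%:Z * a)%R -> (d z <= a)%R /\ (d z = a -> l z <= b).
  move=> rz b_le; rewrite keyIE -/(d z) -/(l z).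
  by apply: scaled_le; have := l_bnd z rz; lia.
have csum_cons z t : csum (z :: t) = (cost w I z + csum t)%R by rewrite /csum big_cons.
have n_bnd : n.+1 <= K.-2 by move: szp; rewrite /= -/n /K /scale; lia.
have d_pre i : i <= n -> d (q i) = csum (pre i) /\ l (q i) = i.+1.
  move=> le_i; have [ri _] := W_pre i le_i.
  have := W_eq i le_i; rewrite !keyIE sz_pre // -/(d _) -/(l _) => E.
  have := l_bnd _ ri => lb.
  have [||le1 le1'] := @scaled_le K (l (q i)) i.+1 (d (q i)) (csum (pre i)).
  - by lia.
  - by rewrite E.
  have [||le2 le2'] := @scaled_le K i.+1 (l (q i)) (csum (pre i)) (d (q i)).
  - by lia.
  - by rewrite E.
  by split; lia.
(* Source and sink both lie outside [I], and membership alternates along arcs. *)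
have n_even : n = n./2.*2.
  suff : odd n = false by lia.
  have par i : i <= n -> (q i \in I) = odd i.
    elim: i => [_|i IHi lt_i]; first by apply/negbTE/(@source_notin _ M1); rewrite q0E.
    by rewrite (arc_parity (q_arc i lt_i)) IHi // ltnW.
  by rewrite -par // qnE; apply/negbTE/(sink_notin sink_zl).
have augE : [set z | (z \in I) (+) (z \in zl :: s)] = augmented I n./2 q.
  apply/setP => z; rewrite !inE; congr (_ (+) _); rewrite -in_cons -/p.
  apply/idP/existsP => [zp|[i /eqP->]].
    have lt_i : n - index z p < (n./2.*2).+1 by rewrite -n_even; lia.
    have le_n : index z p <= n by have : index z p < size p by rewrite index_mem.
    by exists (Ordinal lt_i); rewrite /= /q subKn ?nth_index.
  by rewrite /q mem_nth // sz_le // -ltnS {2}n_even.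
rewrite augE; apply: (@augment_correct T M1 M2 w I d l reach) => //; rewrite -?n_even.
- move=> x sx; have [rx] := W_source sx; rewrite [keyI [:: x]]keyIE csum_cons => le_x.
  have [||le1 le2] := @d_l x (cost w I x) 1 rx => //.
    by move: le_x; rewrite /csum big_nil addr0.
- move=> z z' rz azz'; have [rz'] := W_arc rz azz'; rewrite [keyI (_ :: _)]keyIE csum_cons => le_z.
  have [||le1 le2] := @d_l z' (d z + cost w I z')%R (l z).+1 rz'.
  + by have := l_bnd z rz; lia.
  + by move: le_z; rewrite [(cost _ _ _ + _)%R]addrC.
  by split.
- by rewrite q0E.
- by rewrite qnE.
- exact: q_arc.
- by move=> i le_i; have [] := W_pre i le_i.
- by move=> i le_i; have [] := d_pre i le_i.
- by have [-> _] := d_pre 0 (leq0n n); rewrite preE // csum_cons /csum big_nil addr0.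
- move=> i lt_i; have [-> _] := d_pre i.+1 lt_i; have [-> _] := d_pre i (ltnW lt_i).
  by rewrite preE // csum_cons addrC.
- move=> x sx rx; have [[t Wt] _ _ WD] := W_spec rx.
  have := pmin _ WD; rewrite Wt /= [snk x]sx -Wt => /(_ rx).
  have -> : zl :: s = pre n by rewrite /pre subnn drop0.
  have [dn ln] := d_pre n (leqnn n); have := l_bnd x rx.
  rewrite -/keyI !keyIE sz_pre // -dn -/(d x) -/(l x) => lb.
  case/scaled_le; first by lia.
  by move=> le1 le2; split=> // E; apply: le2.
Qed.

End Step.

(** * The graphic matroid and the in-degree matroid *)

Section Graphic.
Variable V : finType.
Implicit Types (A B : {set V * V}) (x y : V * V) (u v : V).

Definition edge A : rel V := [rel u v | ((u, v) \in A) || ((v, u) \in A)].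

Lemma edge_sym A : symmetric (edge A).
Proof. by move=> u v; rewrite /edge /= orbC. Qed.

Lemma linked_sym A u v : connect (edge A) u v = connect (edge A) v u.
Proof. exact/sym_connect_sym/edge_sym. Qed.

Lemma linked_sub A B u v : A \subset B -> connect (edge A) u v -> connect (edge B) u v.
Proof.
move=> /subsetP sAB; apply: connect_sub => {}u {}v /= /orP[] /sAB uv.
  by apply: connect1; rewrite /edge /= uv.
by apply: connect1; rewrite /edge /= uv orbT.
Qed.

Lemma linked_add A x u v (c := connect (edge A)) :
  connect (edge (x |: A)) u v =
  [|| c u v, c u x.1 && c x.2 v | c u x.2 && c x.1 v].
Proof.
rewrite {}/c; apply/idP/idP => [/connectP[p]|].
  elim: p u => [|u1 p IHp] u /= => [_ ->|/andP[uu1 /IHp IH] /IH {IH}]; first by rewrite connect0.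
  case/orP: uu1; rewrite in_setU1 => /predU1P[<-|uu1] /=.
  - by case/or3P=> [->|/andP[_ ->]|/andP[_ ->]]; rewrite ?connect0 ?orbT.
  - have cu : connect (edge A) u u1 by apply: connect1; rewrite /edge /= uu1.
    by case/or3P=> [|/andP[]|/andP[]] /(connect_trans cu) -> // ->; rewrite ?orbT.
  - by case/or3P=> [->|/andP[_ ->]|/andP[_ ->]]; rewrite ?connect0 ?orbT.
  - have cu : connect (edge A) u u1 by apply: connect1; rewrite /edge /= uu1 orbT.
    by case/or3P=> [|/andP[]|/andP[]] /(connect_trans cu) -> // ->; rewrite ?orbT.
have sA : A \subset x |: A by apply: subsetUr.
have cx : connect (edge (x |: A)) x.1 x.2.
  by apply: connect1; rewrite /edge /= -surjective_pairing setU11.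
case/or3P=> [|/andP[u1 v1]|/andP[u1 v1]]; first exact: linked_sub.
  exact: connect_trans (linked_sub sA u1) (connect_trans cx (linked_sub sA v1)).
rewrite linked_sym in cx.
exact: connect_trans (linked_sub sA u1) (connect_trans cx (linked_sub sA v1)).
Qed.

Definition graphic_span A : {set V * V} := [set x | connect (edge A) x.1 x.2].

Lemma graphic_ext A : A \subset graphic_span A.
Proof.
apply/subsetP => x xA; rewrite inE; apply: connect1.
by rewrite /edge /= -surjective_pairing xA.
Qed.

Lemma graphic_mono A B : A \subset B -> graphic_span A \subset graphic_span B.
Proof. by move=> sAB; apply/subsetP => x; rewrite !inE; apply: linked_sub. Qed.

Lemma graphic_idem A : graphic_span (graphic_span A) \subset graphic_span A.
Proof.
apply/subsetP => x; rewrite !inE; apply: connect_sub => u v.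
by rewrite /edge /= !inE /= => /orP[|] //; rewrite linked_sym.
Qed.

Lemma graphic_exchange A x y : y \notin graphic_span A ->
  y \in graphic_span (x |: A) -> x \in graphic_span (y |: A).
Proof.
rewrite !inE => /negPf yA; rewrite !linked_add yA /=.
case/orP=> /andP[a b]; last by rewrite a b !orbT.
by rewrite (linked_sym A x.1 y.1) a (linked_sym A y.2) b orbT.
Qed.

Definition graphic : matroid (V * V)%type :=
  Matroid graphic_ext graphic_mono graphic_idem graphic_exchange.

Definition indegree A v : nat := #|[set x in A | x.2 == v]|.

Variable q : nat.

(** Closure in the partition matroid: once [q] arcs of [A] enter a vertex, every pair with that head
    is spanned. *)
Definition indegree_span A : {set V * V} := [set x | (x \in A) || (q <= indegree A x.2)].

Lemma indegree_sub A B v : A \subset B -> indegree A v <= indegree B v.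
Proof.
move=> /subsetP sAB; apply/subset_leq_card/subsetP => x; rewrite !inE => /andP[/sAB ->].
by [].
Qed.

Lemma indegree_add A x v : indegree (x |: A) v = ((x \notin A) && (x.2 == v)) + indegree A v.
Proof.
have [xA|xA] := boolP (x \in A); first by rewrite (setUidPr _) // sub1set.
have [xv|xv] /= := boolP (x.2 == v); rewrite /indegree; last first.
  rewrite add0n; apply: eq_card => z; rewrite !inE.
  by case: (z =P x) => //= ->; rewrite (negPf xv) andbF.
rewrite [RHS](_ : _ = #|x |: [set z in A | z.2 == v]|); last by rewrite cardsU1 !inE (negPf xA).
apply: eq_card => z; rewrite !inE.
by case: (z =P x) => // ->; rewrite xv.
Qed.

Lemma indegree_ext A : A \subset indegree_span A.
Proof. by apply/subsetP => x xA; rewrite inE xA. Qed.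

Lemma indegree_mono A B : A \subset B -> indegree_span A \subset indegree_span B.
Proof.
move=> sAB; apply/subsetP => x; rewrite !inE => /orP[/(subsetP sAB) ->//|].
by move=> /leq_trans/(_ (indegree_sub x.2 sAB)) ->; rewrite orbT.
Qed.

Lemma indegree_idem A : indegree_span (indegree_span A) \subset indegree_span A.
Proof.
apply/subsetP => x; rewrite !inE; case: (leqP q (indegree A x.2)); first by rewrite orbT.
rewrite !orbF => lt_q /orP[//|]; rewrite leqNgt (leq_ltn_trans _ lt_q) //.
apply/subset_leq_card/subsetP => y; rewrite !inE => /andP[/orP[->//|+] /eqP yx].
by rewrite yx leqNgt lt_q.
Qed.

Lemma indegree_exchange A x y : y \notin indegree_span A ->
  y \in indegree_span (x |: A) -> x \in indegree_span (y |: A).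
Proof.
rewrite !inE negb_or => /andP[/negPf yA]; rewrite yA orbF -ltnNge => lt_q.
have [->//|neq /=] := eqVneq y x.
rewrite !indegree_add yA /=; have [->|neq2] := eqVneq x.2 y.2.
  by case: (x \in A) => /=; rewrite ?eqxx ?orbT // => ->; rewrite orbT.
by rewrite andbF leqNgt lt_q.
Qed.

Definition indegree_matroid : matroid (V * V)%type :=
  Matroid indegree_ext indegree_mono indegree_idem indegree_exchange.

Lemma indep_indegree A :
  indep indegree_matroid A = [forall v, indegree A v <= q].
Proof.
have addE x : x \in A -> indegree A x.2 = (indegree (A :\ x) x.2).+1.
  by move=> xA; rewrite -{1}(setD1K xA) indegree_add !inE !eqxx.
apply/indepP/forallP => [ind v|deg x xA].
  have [E|[x]] := set_0Vmem [set x in A | x.2 == v]; first by rewrite /indegree E cards0.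
  rewrite inE => /andP[xA /eqP <-]; rewrite addE //.
  by have := ind x xA; rewrite inE negb_or -ltnNge => /andP[].
by rewrite inE !inE eqxx /= -ltnNge -addE.
Qed.

End Graphic.

(** * Polytrees are the common independent sets *)

Section Polytrees.
Variable V : finType.
Implicit Types (A : {set V * V}) (D : rel V).

Definition arc_set D : {set V * V} := [set x | D x.1 x.2].

(** An arc spanned by the others closes a simple path into a cycle of the underlying graph. If that
    path is a single edge, it must come from the opposite arc, which the first part of [polytree]
    excludes. *)
Lemma polytree_indep D : polytree D -> indep (graphic V) (arc_set D).
Proof.
case=> antisym [_ irr acyc]; apply/indepP => -[u v]; rewrite inE /= => uv.
rewrite inE /=; apply/negP => /connectP[p0 path0 last0].
case/shortenP: path0 last0 => p path_p uniq_p _ last_p.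
have neq : u != v.
  by apply: contraTneq uv => ->; have := irr v; rewrite /underlying /= orbb => ->.
have sub : subrel (edge (arc_set D :\ (u, v))) (underlying D).
  by move=> a b; rewrite /edge /underlying /= !inE /= => /orP[] /andP[_ ->]; rewrite ?orbT.
have := acyc (u :: p); rewrite /ucycle uniq_p andbT /= rcons_path (sub_path sub) // -last_p.
rewrite /underlying /= uv orbT => /(_ isT).
case: p path_p last_p {uniq_p} => [_ /= E|w [|//]]; first by rewrite E eqxx in neq.
move=> /= + E; rewrite /edge /= -E andbT !inE eqxx /= => /andP[_ vu].
by have := antisym u v uv; rewrite vu.
Qed.

Lemma indep_polytree A :
  indep (graphic V) A -> polytree [rel u v | (u, v) \in A].
Proof.
move=> /indepP ind.
have noloop u : (u, u) \notin A.
  by apply/negP => uu; have := ind _ uu; rewrite inE /= connect0.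
split=> [u v /= uv|].
  apply/negP => vu; have := ind _ uv; rewrite inE /= => /negP[].
  have neq : u != v by apply: contraTneq uv => ->.
  have neq2 : (v, u) != (u, v) by rewrite xpair_eqE negb_and neq orbT.
  by apply: connect1; rewrite /edge /= !inE vu neq2 orbT.
split=> [u v|u|]; first by rewrite /underlying /= orbC.
  by rewrite /underlying /= orbb; apply/negbTE.
move=> [|x [|y [|z s]]] // /andP[cyc uni]; exfalso.
(* The arc behind the first edge of the cycle is spanned by the arcs behind the others, because the
   rest of the cycle joins its ends. *)
have [a [aA aE]] : exists a, a \in A /\ (a = (x, y) \/ a = (y, x)).
  by move: cyc => /= /andP[/orP[] xy _]; [exists (x, y) | exists (y, x)]; split; auto.
have toA u v : underlying [rel u v | (u, v) \in A] u v -> (u, v) != a -> (v, u) != a ->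
    edge (A :\ a) u v.
  by rewrite /edge /= !inE => uv -> ->.
suff yx : connect (edge (A :\ a)) y x.
  have := ind a aA; rewrite inE => /negP[].
  by case: aE yx => -> yx //=; rewrite linked_sym.
move: uni => /= /and4P[x_out y_out _ _].
move: cyc => /= /and3P[_ yz pz].
apply/connectP; exists (z :: rcons s x); last by rewrite /= last_rcons.
rewrite /=; apply/andP; split.
  apply: toA => //; case: aE => ->; rewrite xpair_eqE negb_and.
  - by move: x_out; rewrite !inE !negb_or => /and3P[xy _ _]; rewrite eq_sym xy.
  - by move: x_out; rewrite !inE !negb_or => /and3P[_ xz _]; rewrite eq_sym xz orbT.
  - by move: x_out; rewrite !inE !negb_or => /and3P[_ xz _]; rewrite eq_sym xz.
  - by move: x_out; rewrite !inE !negb_or => /and3P[xy _ _]; rewrite [y == x]eq_sym xy orbT.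
(* After [z] the cycle does not return to [y], so none of its further edges can come from [a]. *)
pose P := [pred t | t != y].
have all_P : all P (z :: rcons s x).
  rewrite /= all_rcons /=; move: x_out y_out; rewrite !inE !negb_or.
  move=> /and3P[xy _ _] /andP[yz' ys]; rewrite eq_sym yz' xy /=.
  by apply/allP => t ts /=; apply: contraNneq ys => <-.
apply: (sub_in_path (P := P) (e := underlying [rel u v | (u, v) \in A])) all_P pz => u v Pu Pv uv.
rewrite !inE in Pu Pv.
by apply: toA => //; case: aE => ->; rewrite xpair_eqE negb_and ?Pu ?Pv ?orbT.
Qed.

End Polytrees.

(** * The algorithm *)

Section Algorithm.
Variables (V : finType) (q : nat) (w : V * V -> nat).
Implicit Types (A : seq (V * V)) (x z : V * V).

(** Union of components by renaming: the class of the tail takes over the label of the head. *)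
Definition relabel (f : V -> V) x : V -> V :=
  fun v => if f v == f x.1 then f x.2 else f v.
Definition labels A : V -> V := foldl relabel id A.
Definition linked A x : bool := labels A x.1 == labels A x.2.
Definition full A v : bool := q <= \sum_(b <- A) (b.2 == v).

Definition seq_source A x : bool := ~~ linked A x.
Definition seq_sink A x : bool := (x \notin A) && ~~ full A x.2.
Definition seq_arc A z z' : bool :=
  if z \in A then (z' \notin A) && ~~ linked [seq b <- A | b != z] z'
  else (z' \in A) && ~~ full [seq b <- A | b != z'] z.2.

Definition seq_walk A : seq (V * V) :=
  best_walk w (fun z => z \in A) (seq_arc A) (seq_source A) (seq_sink A).

(** Filtering the list of all pairs makes every iterate a duplicate-free sublist of it, which bounds
    its size for the time analysis. With an empty walk the set is unchanged. *)
Definition seq_step A : seq (V * V) :=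
  [seq z <- enum {: V * V} | (z \in A) (+) (z \in seq_walk A)].

Definition seq_weight A : nat := \sum_(z <- A) w z.

Lemma linkedE A u v :
  (labels A u == labels A v) = connect (edge [set z in A]) u v.
Proof.
elim/last_ind: A u v => [|A x IHA] u v.
  have -> : [set z in [::]] = set0 :> {set V * V} by apply/setP => z; rewrite !inE.
  apply/eqP/connectP => [/esym E|[[|y p] /=]]; first by exists [::].
    by move=> _ ->.
  by rewrite /edge /= !inE.
have -> : [set z in rcons A x] = x |: [set z in A].
  by apply/setP => z; rewrite !inE mem_rcons inE.
rewrite linked_add -!IHA /labels -cats1 foldl_cat /= -/(labels A) /relabel.
move: (labels A u) (labels A v) (labels A x.1) (labels A x.2) => a b c d.
rewrite [c == b]eq_sym [d == b]eq_sym.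
case: (a =P c) => [->|ac]; case: (b =P c) => [->|bc].
- by rewrite !eqxx.
- rewrite [c == b]eq_sym; case: (b =P c) => // _; rewrite [d == b]eq_sym.
  by case: (b == d); rewrite ?andbF ?orbF.
- by rewrite andbT; case: (a =P c) => // _ /=.
- by case: (a =P c) => // _ /=; case: (b =P c) => // _; rewrite !andbF !orbF.
Qed.

Lemma fullE A v : uniq A -> full A v = (q <= indegree [set z in A] v).
Proof.
move=> uA; rewrite /full /indegree; congr (_ <= _).
have -> : \sum_(b <- A) (b.2 == v) = size [seq b <- A | b.2 == v].
  rewrite size_filter -sum1_count [RHS]big_mkcond; apply: eq_bigr => b _.
  by case: (b.2 == v).
rewrite -(card_uniqP (filter_uniq _ uA)); apply: eq_card => z.
by rewrite mem_filter !inE andbC.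
Qed.

Let M1 := graphic V.
Let M2 := indegree_matroid V q.

Lemma set_rem A z : [set b in [seq b <- A | b != z]] = [set b in A] :\ z.
Proof. by apply/setP => b; rewrite !inE mem_filter. Qed.

Lemma seq_sourceE A x : seq_source A x = source M1 [set z in A] x.
Proof. by rewrite /seq_source /source inE -linkedE. Qed.

Lemma seq_sinkE A x : uniq A -> seq_sink A x = sink M2 [set z in A] x.
Proof. by move=> uA; rewrite /seq_sink /sink !inE negb_or fullE. Qed.

Lemma seq_arcE A z z' : uniq A -> seq_arc A z z' = arc M1 M2 [set b in A] z z'.
Proof.
move=> uA; rewrite /seq_arc /arc /= !inE; case: (boolP (z \in A)) => zA.
  by rewrite -set_rem /linked linkedE.
by rewrite andbF fullE ?filter_uniq // set_rem.
Qed.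

Definition seq_iter j : seq (V * V) := iter j seq_step [::].

Lemma seq_iter_uniq j : uniq (seq_iter j).
Proof. by case: j => //= j; apply/filter_uniq/enum_uniq. Qed.

Lemma seq_walkE A : uniq A ->
  seq_walk A = best_walk w (fun z => z \in [set b in A]) (arc M1 M2 [set b in A])
    (source M1 [set b in A]) (sink M2 [set b in A]).
Proof.
move=> uA; rewrite /seq_walk.
have -> : seq_source A = source M1 [set b in A] by apply/funext => x; apply: seq_sourceE.
have -> : seq_sink A = sink M2 [set b in A] by apply/funext => x; apply: seq_sinkE.
have -> : seq_arc A = arc M1 M2 [set b in A].
  by apply/funext => x; apply/funext => y; apply: seq_arcE.
apply: (congr1 (fun f => best_walk w f _ _ _)).
by apply/funext => x; rewrite inE.
Qed.

Lemma seq_weightE A : uniq A -> seq_weight A = \sum_(z in [set b in A]) w z.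
Proof.
move=> uA; rewrite /seq_weight big_uniq //=; apply: eq_bigl => z; by rewrite inE.
Qed.

Lemma seq_iter_step j (I := [set b in seq_iter j]) (I' := [set b in seq_iter j.+1]) :
  common M1 M2 I -> split_optimal M1 M2 w I ->
  (I' = I /\ forall J, common M1 M2 J -> #|J| <= #|I|) \/
  [/\ common M1 M2 I', #|I'| = #|I|.+1 & split_optimal M1 M2 w I'].
Proof.
move=> comI optI; have := augmenting_step comI optI.
rewrite -seq_walkE ?seq_iter_uniq //.
have -> : [set z | (z \in I) (+) (z \in seq_walk (seq_iter j))] = I'.
  by apply/setP => z; rewrite /I' /I /= !inE mem_filter mem_enum andbT.
by [].
Qed.

Lemma seq_iter_optimal j (I := [set b in seq_iter j]) :
  common M1 M2 I /\ split_optimal M1 M2 w I.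
Proof.
rewrite {}/I; elim: j => [|j [comI optI]].
  have -> : [set b in seq_iter 0] = set0 by apply/setP => z; rewrite !inE.
  by split; [apply: common0 | apply: split_optimal0].
by case: (seq_iter_step comI optI) => [[-> _]|[]].
Qed.

(** Removing an element from [J] shows that the preceding iterate has one element fewer than [J];
    then [J] witnesses that it is not of maximal size, so the next step must augment. *)
Lemma seq_iter_card J : common M1 M2 J -> #|[set b in seq_iter #|J|]| = #|J|.
Proof.
move: {2}#|J| (erefl #|J|) => k; elim: k J => [|k IHk] J cardJ comJ.
  by rewrite cardJ; have -> : [set b in seq_iter 0] = set0; rewrite ?cards0 //; apply/setP => z; rewrite !inE.
have [x xJ] : exists x, x \in J by apply/card_gt0P; rewrite cardJ.
have cardJx : #|J :\ x| = k by move: cardJ; rewrite (cardsD1 x J) xJ => -[].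
have comJx : common M1 M2 (J :\ x).
  by have /andP[i1 i2] := comJ; apply/andP; split; [apply: indep_sub i1 | apply: indep_sub i2];
     apply: subsetDl.
have := IHk _ cardJx comJx; rewrite cardJx cardJ => cardk.
have [comI optI] := seq_iter_optimal k.
case: (seq_iter_step comI optI) => [[_ /(_ J comJ)]|[_ ->]]; last by rewrite cardk.
by rewrite cardk cardJ ltnn.
Qed.

(** A witness [A] is compared with the iterate of index [#|A|], which has the same size and is
    heaviest for it; hence all cardinalities are tried. *)
Lemma seq_iter_correct t :
  (exists2 A : {set V * V}, common M1 M2 A & t <= \sum_(z in A) w z) <->
  has (fun j => t <= seq_weight (seq_iter j)) (iota 0 #|{: V * V}|.+1).
Proof.
split=> [[A comA le_t]|/hasP[j _ le_t]].
  apply/hasP; exists #|A|; first by rewrite mem_iota /= add0n ltnS max_card.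
  rewrite seq_weightE ?seq_iter_uniq //; apply: leq_trans le_t _.
  have [_ optI] := seq_iter_optimal #|A|.
  by apply: (split_optimal_max optI comA); rewrite seq_iter_card.
exists [set b in seq_iter j]; first by have [] := seq_iter_optimal j.
by rewrite -seq_weightE ?seq_iter_uniq.
Qed.

End Algorithm.

(** * Correctness *)

Section Instance.
Variable I : PL_instance.
Let V := 'I_(num_vertices I).

(** Zero on loops, as on the diagonal of the input table; loops are dependent in the graphic matroid
    and never chosen. *)
Definition arc_weight (x : V * V) : nat :=
  if x.1 == x.2 then 0 else score_fun x.2 [set x.1].

Lemma score_arc_set (D : rel V) : polytree D ->
  score D = \sum_(x in arc_set D) arc_weight x.
Proof.
move=> [_ [_ irr _]].
rewrite /score (eq_bigr (fun v => \sum_(u | D u v) arc_weight (u, v))).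
  rewrite (exchange_big_dep predT) //= pair_big_dep /=; apply: eq_big => [[u v]|[u v] _] //.
  by rewrite inE.
move=> v _; have loop : ~~ D v v.
  by have /negbT := irr v; rewrite /underlying /= orbb.
rewrite score_additive; last by rewrite inE.
apply: eq_big => u; rewrite inE // => uv; rewrite /arc_weight /=.
by case: eqP uv loop => // -> ->.
Qed.

Lemma indegree_arc_set (D : rel V) v : indegree (arc_set D) v = #|parents D v|.
Proof.
have inj : injective (fun u : V => (u, v)) by move=> u u' [].
rewrite -[RHS](card_imset _ inj); apply: eq_card => -[u v']; rewrite !inE /=.
apply/andP/imsetP => [[uv /eqP E]|[u' + [-> ->]]]; last by rewrite inE eqxx.
by rewrite E in uv *; exists u; rewrite ?inE.
Qed.

Definition cap : nat := `|max_indegree I|%N.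
(** Scores are natural numbers, so a negative target amounts to 0. *)
Definition goal : nat := if (target I < 0)%R then 0 else `|target I|%N.

(** A negative bound on in-degrees excludes every digraph with a vertex but holds vacuously without
    vertices. Past this test, [cap] either is the bound or bounds nothing, there being no vertex. *)
Definition decide : bool :=
  ~~ ((max_indegree I < 0)%R && (0 < num_vertices I)) &&
  has (fun j => goal <= seq_weight arc_weight (seq_iter cap arc_weight j))
    (iota 0 #|{: V * V}|.+1).

Lemma decideP : decide <-> PL_yes I.
Proof.
rewrite /decide; split=> [/andP[q_ok /seq_iter_correct[A /andP[i1 i2] le_t]]|].
  have pA := indep_polytree i1.
  have AE : arc_set [rel u v | (u, v) \in A] = A.
    by apply/setP => -[u v]; rewrite inE.
  exists [rel u v | (u, v) \in A]; split=> //.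
    move=> v; rewrite -indegree_arc_set AE.
    move: i2; rewrite indep_indegree => /forallP/(_ v); rewrite /cap.
    have : 0 < num_vertices I by apply: leq_ltn_trans (ltn_ord v).
    by move: q_ok; lia.
  rewrite score_arc_set // AE; move: le_t; rewrite /goal -/V.
  by move: (\sum_(z in A) _) => S; case: ltP => cmp; lia.
case=> D [pD deg le_t]; apply/andP; split.
  apply/negP => /andP[q_neg]; case: (num_vertices I) (D) deg => // n D' deg _.
  by have := deg ord0; lia.
apply/seq_iter_correct; exists (arc_set D).
  apply/andP; split; first exact: polytree_indep.
  rewrite indep_indegree; apply/forallP => v; rewrite indegree_arc_set.
  by have := deg v; rewrite /cap; lia.
by move: le_t; rewrite -score_arc_set // /goal; case: ltP => cmp; lia.
Qed.

End Instance.

(** * Running time of the algorithm *)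

Local Notation vertex I := 'I_(num_vertices I).
Local Notation arcs I := (vertex I * vertex I)%type.

(** Each arc carries its weight, so lists of arcs are evaluated without consulting the input
    table. *)
Definition enc_arc (I : PL_instance) (x : arcs I) : data :=
  DCons (enc_unary x.1) (DCons (enc_unary x.2) (enc_nat (arc_weight x))).

Definition enc_arcs (I : PL_instance) (s : seq (arcs I)) : data :=
  enc_seq [seq enc_arc x | x <- s].

Definition enc_map (I : PL_instance) (f : vertex I -> vertex I) : data :=
  enc_seq [seq enc_unary (f v) | v <- enum (vertex I)].

Definition enc_instance (I : PL_instance) : data :=
  DCons (enc_arcs (enum {: arcs I})) (DCons (enc_map (@id (vertex I)))
    (DCons (enc_nat (cap I)) (enc_nat (goal I)))).

Section ArcOperations.
Variables (X : Type) (e : X -> data) (I : X -> PL_instance).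
Hypothesis ptI : polytime e (fun x => enc_instance (I x)).
Implicit Types (a b : forall x, arcs (I x)) (A : forall x, seq (arcs (I x))).

Lemma polytime_all_arcs : polytime e (fun x => enc_arcs (enum {: arcs (I x)})).
Proof. exact: polytime_hd ptI. Qed.

Lemma polytime_id_map : polytime e (fun x => enc_map (@id (vertex (I x)))).
Proof. exact: polytime_hd (polytime_tl ptI). Qed.

Lemma polytime_cap : polytime e (fun x => enc_nat (cap (I x))).
Proof. exact: polytime_hd (polytime_tl (polytime_tl ptI)). Qed.

Lemma polytime_goal : polytime e (fun x => enc_nat (goal (I x))).
Proof. exact: polytime_tl (polytime_tl (polytime_tl ptI)). Qed.

Lemma polytime_source_vertex a :
  polytime e (fun x => enc_arc (a x)) -> polytime e (fun x => enc_unary (a x).1).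
Proof. by move=> pta; exact: polytime_hd pta. Qed.

Lemma polytime_head_vertex a :
  polytime e (fun x => enc_arc (a x)) -> polytime e (fun x => enc_unary (a x).2).
Proof. by move=> pta; exact: polytime_hd (polytime_tl pta). Qed.

Lemma polytime_arc_weight a :
  polytime e (fun x => enc_arc (a x)) -> polytime e (fun x => enc_nat (arc_weight (a x))).
Proof. by move=> pta; exact: polytime_tl (polytime_tl pta). Qed.

Lemma polytime_arc_eq a b :
  polytime e (fun x => enc_arc (a x)) -> polytime e (fun x => enc_arc (b x)) ->
  polytime e (fun x => enc_bool (a x == b x)).
Proof.
move=> pta ptb.
exact: (polytime_and
  (polytime_unary_eq (polytime_source_vertex pta) (polytime_source_vertex ptb))
  (polytime_unary_eq (polytime_head_vertex pta) (polytime_head_vertex ptb))).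
Qed.

Lemma polytime_nat_of_bool (c : X -> bool) :
  polytime e (fun x => enc_bool (c x)) -> polytime e (fun x => enc_nat (c x)).
Proof.
move=> ptc; have := polytime_if ptc (polytime_const e (enc_nat 1)) (polytime_const e (enc_nat 0)).
by move/polytime_ext; apply=> // x; case: (c x).
Qed.

(** A property of the head of a possibly empty walk becomes [has] on a list of at most one
    element. *)
Lemma polytime_take1 A :
  polytime e (fun x => enc_arcs (A x)) -> polytime e (fun x => enc_arcs (take 1 (A x))).
Proof.
move=> ptA.
have := polytime_if_cons ptA (polytime_cons (polytime_hd ptA) (polytime_nil e)) (polytime_nil e).
by move/polytime_ext; apply=> // x; case: (A x) => [|? ?] //=; rewrite take0.
Qed.

(** Labels are vertex numbers, so one bound covers all labellings; the fold computing [labels] can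
    use a constant measure. *)
Lemma map_bounded : exists M : X -> nat, poly_bounded e M /\
  forall x (f : vertex (I x) -> vertex (I x)), data_size (enc_map f) <= M x.
Proof.
exists (fun x => (data_size (enc_map (@id (vertex (I x))))) *
   (2 * data_size (enc_map (@id (vertex (I x)))) + 4) + 1); split.
  have pb := polytime_bounded polytime_id_map.
  apply: poly_bounded_add; last exact: poly_bounded_const.
  apply: poly_bounded_mul => //; apply: poly_bounded_add; last exact: poly_bounded_const.
  by apply: poly_bounded_mul => //; apply: poly_bounded_const.
move=> x f; have len (g : vertex (I x) -> vertex (I x)) : num_vertices (I x) <= data_size (enc_map g).
  by have := size_le_enc_seq [seq enc_unary (g v) | v <- enum (vertex (I x))];
     rewrite size_map size_enum_ord.
rewrite {1}/enc_map size_enc_seq big_map addn1 ltnS.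
apply: (@leq_trans (\sum_(v <- enum (vertex (I x))) (2 * num_vertices (I x) + 2))).
  by apply: leq_sum => v _; rewrite size_enc_unary; have := ltn_ord (f v); lia.
rewrite big_const_seq count_predT iter_addn_0 size_enum_ord mulnC.
by apply: leq_mul; [exact: len | have := len id; lia].
Qed.

End ArcOperations.

Section Lookup.
Variables (X : Type) (e : X -> data) (I : X -> PL_instance).

Lemma polytime_lookup (f : forall x, vertex (I x) -> vertex (I x)) (v : forall x, vertex (I x)) :
  polytime e (fun x => enc_map (@f x)) -> polytime e (fun x => enc_unary (v x)) ->
  polytime e (fun x => enc_unary (f x (v x))).
Proof.
move=> ptf ptv; have := polytime_nth ptf ptv; move/polytime_ext; apply=> // x.
by rewrite (nth_map (v x)) ?size_enum_ord // nth_ord_enum.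
Qed.

Lemma polytime_mem (a : forall x, arcs (I x)) (A : forall x, seq (arcs (I x))) :
  polytime e (fun x => enc_arc (a x)) -> polytime e (fun x => enc_arcs (A x)) ->
  polytime e (fun x => enc_bool (a x \in A x)).
Proof.
move=> pta ptA.
have := @polytime_has X e (fun x => arcs (I x)) (fun x => @enc_arc (I x)) A ptA
  (fun x b => b == a x).
move=> H; have {}H : polytime e (fun x => enc_bool (has (fun b => b == a x) (A x))).
  apply: H; apply: (@polytime_arc_eq _ _ (fun u => I (projT1 u))); first exact: polytime_here.
  exact: (polytime_weaken _ pta).
by move/polytime_ext: H; apply=> // x; rewrite -has_pred1; apply/f_equal/eq_has.
Qed.

Lemma polytime_remove (a : forall x, arcs (I x)) (A : forall x, seq (arcs (I x))) :
  polytime e (fun x => enc_arc (a x)) -> polytime e (fun x => enc_arcs (A x)) ->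
  polytime e (fun x => enc_arcs [seq b <- A x | b != a x]).
Proof.
move=> pta ptA.
apply: (@polytime_filter X e (fun x => arcs (I x)) (fun x => @enc_arc (I x)) A
  (fun x b => b != a x) ptA).
apply: polytime_neg; apply: (@polytime_arc_eq _ _ (fun u => I (projT1 u))).
  exact: polytime_here.
exact: (polytime_weaken _ pta).
Qed.

End Lookup.

Section Relabel.
Variables (X : Type) (e : X -> data) (I : X -> PL_instance).

Lemma polytime_relabel (f : forall x, vertex (I x) -> vertex (I x)) (a : forall x, arcs (I x)) :
  polytime e (fun x => enc_map (@f x)) -> polytime e (fun x => enc_arc (a x)) ->
  polytime e (fun x => enc_map (relabel (@f x) (a x))).
Proof.
move=> ptf pta.
have pt1 := polytime_lookup ptf (polytime_source_vertex pta).
have pt2 := polytime_lookup ptf (polytime_head_vertex pta).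
apply: (@polytime_map X e (fun x => vertex (I x)) (fun x v => enc_unary (f x v))
  (fun x => enum (vertex (I x))) (fun x v => enc_unary (relabel (@f x) (a x) v)) ptf).
have ptv := polytime_here (fun u : {x : X & vertex (I x)} => enc_unary (f _ (projT2 u)))
  (fun u => e (projT1 u)).
have := polytime_if (polytime_unary_eq ptv (polytime_weaken _ pt1))
  (polytime_weaken _ pt2) ptv.
by move/polytime_ext; apply=> // -[x v] /=; rewrite /relabel -val_eqE /=; case: ifP.
Qed.

End Relabel.

Section ArcTests.
Variables (X : Type) (e : X -> data) (I : X -> PL_instance).
Hypothesis ptI : polytime e (fun x => enc_instance (I x)).

Lemma polytime_labels (A : forall x, seq (arcs (I x))) :
  polytime e (fun x => enc_arcs (A x)) -> polytime e (fun x => enc_map (labels (A x))).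
Proof.
move=> ptA; have [M [pM encM]] := map_bounded ptI.
apply: (@polytime_foldl X e (fun x => arcs (I x)) (fun x => @enc_arc (I x)) A ptA
  (fun x => vertex (I x) -> vertex (I x)) (fun x => @enc_map (I x)) (fun x => id)
  (fun x => @relabel (vertex (I x))) M (fun _ _ => 0) (fun _ _ => 0)) => //.
- exact: polytime_id_map.
- exact: poly_bounded_const.
- by move=> x f; rewrite muln0 addn0.
- exact: poly_bounded_const.
apply: (@polytime_relabel _ _ (fun u => I (projT1 u))); first exact: polytime_here.
exact/polytime_skip/polytime_here.
Qed.

Lemma polytime_linked (A : forall x, seq (arcs (I x))) (a : forall x, arcs (I x)) :
  polytime e (fun x => enc_arcs (A x)) -> polytime e (fun x => enc_arc (a x)) ->
  polytime e (fun x => enc_bool (linked (A x) (a x))).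
Proof.
move=> ptA pta; have ptf := polytime_labels ptA.
exact: (polytime_unary_eq (polytime_lookup ptf (polytime_source_vertex pta))
  (polytime_lookup ptf (polytime_head_vertex pta))).
Qed.

Lemma polytime_full (A : forall x, seq (arcs (I x))) (v : forall x, vertex (I x)) :
  polytime e (fun x => enc_arcs (A x)) -> polytime e (fun x => enc_unary (v x)) ->
  polytime e (fun x => enc_bool (full (cap (I x)) (A x) (v x))).
Proof.
move=> ptA ptv; apply: polytime_le; first exact: polytime_cap.
apply: (@polytime_sum X e (fun x => arcs (I x)) (fun x => @enc_arc (I x)) A
  (fun x b => b.2 == v x) ptA).
apply: polytime_nat_of_bool; apply: polytime_unary_eq.
  exact: (@polytime_head_vertex _ _ (fun u => I (projT1 u)) _ (polytime_here _ _)).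
exact: (polytime_weaken _ ptv).
Qed.

Lemma polytime_seq_source (A : forall x, seq (arcs (I x))) (a : forall x, arcs (I x)) :
  polytime e (fun x => enc_arcs (A x)) -> polytime e (fun x => enc_arc (a x)) ->
  polytime e (fun x => enc_bool (seq_source (A x) (a x))).
Proof. by move=> ptA pta; apply/polytime_neg/polytime_linked. Qed.

Lemma polytime_seq_sink (A : forall x, seq (arcs (I x))) (a : forall x, arcs (I x)) :
  polytime e (fun x => enc_arcs (A x)) -> polytime e (fun x => enc_arc (a x)) ->
  polytime e (fun x => enc_bool (seq_sink (cap (I x)) (A x) (a x))).
Proof.
move=> ptA pta; apply: polytime_and; first exact/polytime_neg/polytime_mem.
by apply/polytime_neg/polytime_full => //; apply: polytime_head_vertex.
Qed.

Lemma polytime_seq_arc (A : forall x, seq (arcs (I x))) (a b : forall x, arcs (I x)) :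
  polytime e (fun x => enc_arcs (A x)) -> polytime e (fun x => enc_arc (a x)) ->
  polytime e (fun x => enc_arc (b x)) ->
  polytime e (fun x => enc_bool (seq_arc (cap (I x)) (A x) (a x) (b x))).
Proof.
move=> ptA pta ptb; apply: polytime_bool_if; first exact: polytime_mem.
  apply: polytime_and; first exact/polytime_neg/polytime_mem.
  by apply/polytime_neg/polytime_linked => //; apply: polytime_remove.
apply: polytime_and; first exact: polytime_mem.
by apply/polytime_neg/polytime_full; [apply: polytime_remove | apply: polytime_head_vertex].
Qed.

(** The product is a repeated sum: one copy of [k x] for each arc in the list of all arcs, and three
    more. *)
Lemma polytime_scale (k : X -> nat) :
  polytime e (fun x => enc_nat (k x)) ->
  polytime e (fun x => enc_nat (scale {: arcs (I x)} * k x)).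
Proof.
move=> ptk; have := polytime_all_arcs ptI.
move/(@polytime_sum X e (fun x => arcs (I x)) (fun x => @enc_arc (I x)) _ (fun x _ => k x)).
move=> /(_ (polytime_weaken _ ptk)) pts.
have := polytime_add pts (polytime_add ptk (polytime_add ptk ptk)).
move/polytime_ext; apply=> // x.
rewrite big_const_seq count_predT iter_addn_0 -cardE /scale; congr enc_nat.
by rewrite !mulSn addnC -!addnA [X in _ + (_ + (_ + X))]mulnC.
Qed.

Lemma polytime_gain (A p : forall x, seq (arcs (I x))) :
  polytime e (fun x => enc_arcs (A x)) -> polytime e (fun x => enc_arcs (p x)) ->
  polytime e (fun x => enc_nat (gain (@arc_weight (I x)) (fun z => z \in A x) (p x))).
Proof.
move=> ptA ptp.
apply: (@polytime_sum X e (fun x => arcs (I x)) (fun x => @enc_arc (I x)) p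
  (fun x z => if z \in A x then arc_weight z else 0) ptp).
set ctx := (Z in polytime Z).
have ptz : polytime ctx (fun u => enc_arc (projT2 u)) by apply: polytime_here.
have ptm : polytime ctx (fun u => enc_bool (projT2 u \in A (projT1 u))).
  apply: (@polytime_mem _ _ (fun u => I (projT1 u))) => //; exact: (polytime_weaken _ ptA).
have := polytime_if ptm (@polytime_arc_weight _ _ (fun u => I (projT1 u)) _ ptz)
  (polytime_const ctx (enc_nat 0)).
by move/polytime_ext; apply=> // -[x z] /=; case: ifP.
Qed.

Lemma polytime_loss (A p : forall x, seq (arcs (I x))) :
  polytime e (fun x => enc_arcs (A x)) -> polytime e (fun x => enc_arcs (p x)) ->
  polytime e (fun x => enc_nat (loss (@arc_weight (I x)) (fun z => z \in A x) (p x))).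
Proof.
move=> ptA ptp.
apply: (@polytime_sum X e (fun x => arcs (I x)) (fun x => @enc_arc (I x)) p
  (fun x z => if z \in A x then 0 else arc_weight z) ptp).
set ctx := (Z in polytime Z).
have ptz : polytime ctx (fun u => enc_arc (projT2 u)) by apply: polytime_here.
have ptm : polytime ctx (fun u => enc_bool (projT2 u \in A (projT1 u))).
  apply: (@polytime_mem _ _ (fun u => I (projT1 u))) => //; exact: (polytime_weaken _ ptA).
have := polytime_if ptm (polytime_const ctx (enc_nat 0))
  (@polytime_arc_weight _ _ (fun u => I (projT1 u)) _ ptz).
by move/polytime_ext; apply=> // -[x z] /=; case: ifP.
Qed.

Lemma polytime_size (p : forall x, seq (arcs (I x))) :
  polytime e (fun x => enc_arcs (p x)) -> polytime e (fun x => enc_nat (size (p x))).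
Proof.
move=> ptp; apply: polytime_ext (_ : polytime e (fun x => enc_nat (\sum_(z <- p x) 1)))
  (frefl _) _; last by move=> x; rewrite sum1_size.
apply: (@polytime_sum X e (fun x => arcs (I x)) (fun x => @enc_arc (I x)) p (fun=> fun=> 1) ptp).
exact: (polytime_const _ (enc_nat 1)).
Qed.

Lemma polytime_shorter (A p p' : forall x, seq (arcs (I x))) :
  polytime e (fun x => enc_arcs (A x)) -> polytime e (fun x => enc_arcs (p x)) ->
  polytime e (fun x => enc_arcs (p' x)) ->
  polytime e (fun x => enc_bool
    (shorter (@arc_weight (I x)) (fun z => z \in A x) (p x) (p' x))).
Proof.
move=> ptA ptp ptp'.
apply: polytime_lt; apply: polytime_add; try exact: polytime_size.
  by apply/polytime_scale/polytime_add; [apply: polytime_gain | apply: polytime_loss].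
by apply/polytime_scale/polytime_add; [apply: polytime_gain | apply: polytime_loss].
Qed.

Lemma polytime_better (A p p' : forall x, seq (arcs (I x))) :
  polytime e (fun x => enc_arcs (A x)) -> polytime e (fun x => enc_arcs (p x)) ->
  polytime e (fun x => enc_arcs (p' x)) ->
  polytime e (fun x => enc_arcs
    (better (@arc_weight (I x)) (fun z => z \in A x) (p x) (p' x))).
Proof.
move=> ptA ptp ptp'.
have := polytime_if_cons ptp (polytime_if_cons ptp'
  (polytime_if (polytime_shorter ptA ptp ptp') ptp ptp') ptp) ptp'.
move/polytime_ext; apply=> // x; rewrite /better.
by case: (p x) => [|? ?] //; case: (p' x) => [|? ?] //=; case: ifP.
Qed.

End ArcTests.

Section WalkOperations.
Variables (X : Type) (e : X -> data) (I : X -> PL_instance).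
Hypothesis ptI : polytime e (fun x => enc_instance (I x)).

Lemma polytime_extend (A p : forall x, seq (arcs (I x))) (a : forall x, arcs (I x)) :
  polytime e (fun x => enc_arcs (A x)) -> polytime e (fun x => enc_arcs (p x)) ->
  polytime e (fun x => enc_arc (a x)) ->
  polytime e (fun x => enc_arcs (extend (seq_arc (cap (I x)) (A x)) (a x) (p x))).
Proof.
move=> ptA ptp pta; have pt1 := polytime_take1 ptp.
have pt_eq : polytime e (fun x => enc_bool (has (fun z => z == a x) (take 1 (p x)))).
  apply: (@polytime_has X e (fun x => arcs (I x)) (fun x => @enc_arc (I x)) _ pt1
    (fun x z => z == a x)).
  apply: (@polytime_arc_eq _ _ (fun u => I (projT1 u))); first exact: polytime_here.
  exact: (polytime_weaken _ pta).
have pt_arc : polytime e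
    (fun x => enc_bool (has (fun z => seq_arc (cap (I x)) (A x) z (a x)) (take 1 (p x)))).
  apply: (@polytime_has X e (fun x => arcs (I x)) (fun x => @enc_arc (I x)) _ pt1
    (fun x z => seq_arc (cap (I x)) (A x) z (a x))).
  apply: (@polytime_seq_arc _ _ (fun u => I (projT1 u))).
  - exact: (polytime_weaken _ ptI).
  - exact: (polytime_weaken _ ptA).
  - exact: polytime_here.
  - exact: (polytime_weaken _ pta).
have := polytime_if pt_eq ptp (polytime_if pt_arc (polytime_cons pta ptp) (polytime_nil e)).
move/polytime_ext; apply=> // x; case: (p x) => [|z s] //=.
by rewrite take0 /= !orbF; case: ifP => // _; case: ifP.
Qed.

Lemma polytime_at_sink (A p : forall x, seq (arcs (I x))) :
  polytime e (fun x => enc_arcs (A x)) -> polytime e (fun x => enc_arcs (p x)) ->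
  polytime e (fun x => enc_arcs (at_sink (seq_sink (cap (I x)) (A x)) (p x))).
Proof.
move=> ptA ptp; have pt1 := polytime_take1 ptp.
have pt_sink : polytime e
    (fun x => enc_bool (has (seq_sink (cap (I x)) (A x)) (take 1 (p x)))).
  apply: (@polytime_has X e (fun x => arcs (I x)) (fun x => @enc_arc (I x)) _ pt1
    (fun x => seq_sink (cap (I x)) (A x))).
  apply: (@polytime_seq_sink _ _ (fun u => I (projT1 u))).
  - exact: (polytime_weaken _ ptI).
  - exact: (polytime_weaken _ ptA).
  - exact: polytime_here.
have := polytime_if pt_sink ptp (polytime_nil e).
move/polytime_ext; apply=> // x; case: (p x) => [|z s] //=.
by rewrite take0 /= !orbF; case: ifP.
Qed.

Lemma polytime_best (A : forall x, seq (arcs (I x))) (D : forall x, seq (seq (arcs (I x))))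
    (f : forall x, seq (arcs (I x)) -> seq (arcs (I x))) :
  polytime e (fun x => enc_arcs (A x)) ->
  polytime e (fun x => enc_seq [seq enc_arcs p | p <- D x]) ->
  polytime (fun u : {x : X & seq (arcs (I x))} => DCons (enc_arcs (projT2 u)) (e (projT1 u)))
    (fun u => enc_arcs (f (projT1 u) (projT2 u))) ->
  polytime e (fun x => enc_arcs
    (best (@arc_weight (I x)) (fun z => z \in A x) (f x) (D x))).
Proof.
move=> ptA ptD ptf.
apply: (@polytime_foldl X e (fun x => seq (arcs (I x))) (fun x => @enc_arcs (I x)) D ptD
  (fun x => seq (arcs (I x))) (fun x => @enc_arcs (I x)) (fun=> [::])
  (fun x acc p => better (@arc_weight (I x)) (fun z => z \in A x) (f x p) acc)
  (fun=> 0) (fun x b => data_size (enc_arcs b)) (fun x p => data_size (enc_arcs (f x p)))).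
- exact: polytime_nil.
- exact: poly_bounded_const.
- exact: (poly_bounded_const e 1).
- by move=> x b; lia.
- move=> x b p; rewrite /better; case: (f x p) => [|y s]; first exact: leq_addr.
  by case: b => [|z t]; [exact: leq_addl | case: ifP => _; [exact: leq_addl | exact: leq_addr]].
- exact: polytime_bounded ptf.
pose pi (u : {x : X & (seq (arcs (I x)) * seq (arcs (I x)))%type}) :
  {x : X & seq (arcs (I x))} := existT _ (projT1 u) (projT2 u).2.
apply: (@polytime_better _ _ (fun u => I (projT1 u))).
- exact/polytime_skip/polytime_skip/(polytime_pull (fun u => projT1 u) ptI).
- exact/polytime_skip/polytime_skip/(polytime_pull (fun u => projT1 u) ptA).
- exact/polytime_skip/(polytime_pull pi ptf).
- exact: polytime_here.
Qed.

Lemma polytime_init_walks (A : forall x, seq (arcs (I x))) :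
  polytime e (fun x => enc_arcs (A x)) ->
  polytime e (fun x => enc_seq [seq enc_arcs p | p <- init_walks (seq_source (A x))]).
Proof.
move=> ptA.
apply: polytime_ext (_ : polytime e (fun x => enc_seq [seq
  enc_arcs (if seq_source (A x) z then [:: z] else [::]) | z <- enum {: arcs (I x)}]))
  (frefl _) _; last by move=> x; congr enc_seq; rewrite /init_walks -[RHS]map_comp; apply: eq_map.
apply: (@polytime_map X e (fun x => arcs (I x)) (fun x => @enc_arc (I x)) _
  (fun x z => enc_arcs (if seq_source (A x) z then [:: z] else [::])) (polytime_all_arcs ptI)).
set ctx := (Z in polytime Z).
have ptz : polytime ctx (fun u => enc_arc (projT2 u)) by apply: polytime_here.
have pts : polytime ctx (fun u => enc_bool (seq_source (A (projT1 u)) (projT2 u))).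
  apply: (@polytime_seq_source _ _ (fun u => I (projT1 u))) => //.
    exact: (polytime_weaken _ ptI).
  exact: (polytime_weaken _ ptA).
have := polytime_if pts (polytime_cons ptz (polytime_nil _)) (polytime_nil _).
by move/polytime_ext; apply=> // u; case: ifP.
Qed.

End WalkOperations.

Section Rounds.
Variables (X : Type) (e : X -> data) (I : X -> PL_instance).
Hypothesis ptI : polytime e (fun x => enc_instance (I x)).

Lemma polytime_round (A : forall x, seq (arcs (I x))) (D : forall x, seq (seq (arcs (I x)))) :
  polytime e (fun x => enc_arcs (A x)) ->
  polytime e (fun x => enc_seq [seq enc_arcs p | p <- D x]) ->
  polytime e (fun x => enc_seq [seq enc_arcs p | p <-
    round (@arc_weight (I x)) (fun z => z \in A x) (seq_arc (cap (I x)) (A x)) (D x)]).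
Proof.
move=> ptA ptD.
apply: polytime_ext (_ : polytime e (fun x => enc_seq [seq
  enc_arcs (best (@arc_weight (I x)) (fun z => z \in A x)
    (extend (seq_arc (cap (I x)) (A x)) z) (D x)) | z <- enum {: arcs (I x)}]))
  (frefl _) _; last by move=> x; congr enc_seq; rewrite /round -[RHS]map_comp; apply: eq_map.
apply: (@polytime_map X e (fun x => arcs (I x)) (fun x => @enc_arc (I x)) _
  (fun x z => enc_arcs (best (@arc_weight (I x)) (fun z => z \in A x)
    (extend (seq_arc (cap (I x)) (A x)) z) (D x))) (polytime_all_arcs ptI)).
set ctx := (Z in polytime Z).
have ptI' : polytime ctx (fun u => enc_instance (I (projT1 u))) by exact: (polytime_weaken _ ptI).
have ptA' : polytime ctx (fun u => enc_arcs (A (projT1 u))) by exact: (polytime_weaken _ ptA).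
have ptz : polytime ctx (fun u => enc_arc (projT2 u)) by apply: polytime_here.
apply: (@polytime_best _ _ (fun u => I (projT1 u)) ptI' (fun u => A (projT1 u))
  (fun u => D (projT1 u)) (fun u => extend (seq_arc (cap (I (projT1 u))) (A (projT1 u))) (projT2 u))) => //.
  exact: (polytime_weaken _ ptD).
apply: (@polytime_extend _ _ (fun v => I (projT1 (projT1 v)))).
- exact: (polytime_weaken _ ptI').
- exact: (polytime_weaken _ ptA').
- exact: polytime_here.
- exact: (polytime_weaken _ ptz).
Qed.

End Rounds.

Section Iterations.
Variables (X : Type) (e : X -> data) (I : X -> PL_instance).
Hypothesis ptI : polytime e (fun x => enc_instance (I x)).

Lemma size_enc_arc_le x (z : arcs (I x)) :
  data_size (enc_arc z) <= data_size (enc_arcs (enum {: arcs (I x)})).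
Proof.
rewrite /enc_arcs size_enc_seq big_map; apply: leqW.
by rewrite (bigD1_seq z) ?mem_enum ?enum_uniq //=; lia.
Qed.

Lemma card_arcs_le x : #|{: arcs (I x)}| <= data_size (enc_arcs (enum {: arcs (I x)})).
Proof.
by rewrite cardE -(size_map (@enc_arc (I x))); apply: size_le_enc_seq.
Qed.

Lemma polytime_walks (A : forall x, seq (arcs (I x))) :
  polytime e (fun x => enc_arcs (A x)) ->
  polytime e (fun x => enc_seq [seq enc_arcs p | p <-
    walks (@arc_weight (I x)) (fun z => z \in A x) (seq_arc (cap (I x)) (A x))
      (seq_source (A x))]).
Proof.
move=> ptA; have ptE := polytime_all_arcs ptI.
pose E x := data_size (enc_arcs (enum {: arcs (I x)})).
pose D x i := iter i (round (@arc_weight (I x)) (fun z => z \in A x)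
  (seq_arc (cap (I x)) (A x))) (init_walks (seq_source (A x))).
pose S x i := enc_seq [seq enc_arcs p | p <- D x i].
suff: polytime e (fun x => S x (size [seq enc_arc z | z <- enum {: arcs (I x)}])).
  by move/polytime_ext; apply=> // x; rewrite size_map -cardE.
(* At most [E x] walks are stored, each with at most [E x + 1] arcs, each of size at most [E x]. *)
pose B x := 1 + E x * (2 + (E x + 1) * (E x + 1)).
apply: (@polytime_iter _ e _ S B) => //.
- exact: polytime_init_walks.
- have pE : poly_bounded e E := polytime_bounded ptE.
  have p1 := poly_bounded_const e 1.
  apply: poly_bounded_add => //; apply: poly_bounded_mul => //.
  apply: poly_bounded_add; first exact: poly_bounded_const.
  by apply: poly_bounded_mul; apply: poly_bounded_add.
- move=> x i; rewrite size_map -cardE => le_i.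
  have [szD szp] := size_walks (@arc_weight (I x)) (fun z => z \in A x)
    (seq_arc (cap (I x)) (A x)) (seq_source (A x)) i.
  have le_E := card_arcs_le x.
  apply: leq_trans (size_enc_seq_le (C := 1 + (E x + 1) * (E x + 1)) _) _; last first.
    by rewrite /B leq_add2l szD; apply: leq_mul.
  move=> p /szp sz_p; apply: leq_trans (size_enc_seq_le (C := E x) _) _.
    by move=> z _; apply: size_enc_arc_le.
  by rewrite leq_add2l; apply: leq_mul; rewrite ?addn1 //; apply: leq_trans sz_p _; rewrite ltnS;
     apply: leq_trans le_i _.
set U := (Z in @polytime Z); set ctx := (Z in polytime Z).
apply: (@polytime_round U ctx (fun u => I (val u).1) _ (fun u => A (val u).1)
  (fun u => D (val u).1 (val u).2)).
- exact/polytime_skip/(polytime_pull (fun u : U => (val u).1) ptI).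
- exact/polytime_skip/(polytime_pull (fun u : U => (val u).1) ptA).
- exact: polytime_here.
Qed.

Lemma polytime_seq_walk (A : forall x, seq (arcs (I x))) :
  polytime e (fun x => enc_arcs (A x)) ->
  polytime e (fun x => enc_arcs (seq_walk (cap (I x)) (@arc_weight (I x)) (A x))).
Proof.
move=> ptA; apply: (polytime_best ptI ptA (polytime_walks ptA)).
apply: (@polytime_at_sink _ _ (fun u => I (projT1 u))).
- exact: (polytime_weaken _ ptI).
- exact: (polytime_weaken _ ptA).
- exact: polytime_here.
Qed.

Lemma polytime_seq_step (A : forall x, seq (arcs (I x))) :
  polytime e (fun x => enc_arcs (A x)) ->
  polytime e (fun x => enc_arcs (seq_step (cap (I x)) (@arc_weight (I x)) (A x))).
Proof.
move=> ptA; have ptw := polytime_seq_walk ptA.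
apply: (@polytime_filter X e (fun x => arcs (I x)) (fun x => @enc_arc (I x))
  (fun x => enum {: arcs (I x)})
  (fun x z => (z \in A x) (+) (z \in seq_walk (cap (I x)) (@arc_weight (I x)) (A x)))
  (polytime_all_arcs ptI)).
by apply: polytime_xor; apply: (@polytime_mem _ _ (fun u => I (projT1 u)));
   [exact: polytime_here | exact: (polytime_weaken _ ptA)
   | exact: polytime_here | exact: (polytime_weaken _ ptw)].
Qed.

Lemma polytime_seq_weight (A : forall x, seq (arcs (I x))) :
  polytime e (fun x => enc_arcs (A x)) ->
  polytime e (fun x => enc_nat (seq_weight (@arc_weight (I x)) (A x))).
Proof.
move=> ptA.
apply: (@polytime_sum X e (fun x => arcs (I x)) (fun x => @enc_arc (I x)) A
  (fun x => @arc_weight (I x)) ptA).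
exact: (@polytime_arc_weight _ _ (fun u => I (projT1 u)) _ (polytime_here _ _)).
Qed.

End Iterations.

Section Decide.
Variables (X : Type) (e : X -> data) (I : X -> PL_instance).
Hypothesis ptI : polytime e (fun x => enc_instance (I x)).

Lemma polytime_reachable_goal :
  polytime e (fun x => enc_bool (has (fun j => goal (I x) <=
    seq_weight (@arc_weight (I x)) (seq_iter (cap (I x)) (@arc_weight (I x)) j))
    (iota 0 #|{: arcs (I x)}|.+1))).
Proof.
pose A x j := seq_iter (cap (I x)) (@arc_weight (I x)) j.
pose ok x j := goal (I x) <= seq_weight (@arc_weight (I x)) (A x j).
(* The state holds the verdict on the first [j.+1] iterates together with the current one, so no
   iterate is computed twice. *)
pose S x j := DCons (enc_bool (has (ok x) (iota 0 j.+1))) (enc_arcs (A x j)).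
have ptE := polytime_all_arcs ptI.
suff: polytime e (fun x => S x (size [seq enc_arc z | z <- enum {: arcs (I x)}])).
  by move/polytime_hd/polytime_ext; apply=> // x; rewrite size_map -cardE.
apply: (@polytime_iter _ e _ S (fun x => 4 + data_size (enc_arcs (enum {: arcs (I x)})))) => //.
- apply: polytime_cons; last exact: polytime_nil.
  have := polytime_le (polytime_goal ptI) (polytime_const e (enc_nat 0)).
  move/polytime_ext; apply=> // x.
  by rewrite /= orbF /ok /seq_weight big_nil.
- by apply: poly_bounded_add (poly_bounded_const _ _) (polytime_bounded ptE).
- move=> x j _; rewrite /S /=.
  have : data_size (enc_bool (has (ok x) (iota 0 j.+1))) <= 3 by case: has.
  suff : data_size (enc_arcs (A x j)) <= data_size (enc_arcs (enum {: arcs (I x)})).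
    by rewrite /=; lia.
  by case: j => [|j]; [exact: data_size_gt0 | exact: size_enc_seq_filter].
set U := (Z in @polytime Z); set ctx := (Z in polytime Z).
have ptI' : polytime ctx (fun u : U => enc_instance (I (val u).1)).
  exact/polytime_skip/(polytime_pull (fun u : U => (val u).1) ptI).
have ptS : polytime ctx (fun u : U => S (val u).1 (val u).2) by apply: polytime_here.
have ptA : polytime ctx (fun u : U => enc_arcs (A (val u).1 (val u).2.+1)).
  apply: (@polytime_seq_step _ _ (fun u : U => I (val u).1) ptI'
    (fun u : U => A (val u).1 (val u).2)); exact: polytime_tl ptS.
have pt_ok : polytime ctx (fun u : U => enc_bool (ok (val u).1 (val u).2.+1)).
  apply: polytime_le; first exact: polytime_goal ptI'.
  exact: (@polytime_seq_weight _ _ (fun u : U => I (val u).1)).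
have pt_has : polytime ctx (fun u : U => enc_bool (has (ok (val u).1) (iota 0 (val u).2.+1))).
  exact: polytime_hd ptS.
have := polytime_cons (polytime_or pt_has pt_ok) ptA.
move/polytime_ext; apply=> // u; rewrite /S -[in RHS](addn1 (val u).2.+1) iotaD has_cat.
by rewrite [has _ (iota _ 1)]orbF.
Qed.

End Decide.

(** * Reading the input *)

Lemma enum_pair (A B : finType) :
  enum {: A * B} = [seq (a, b) | a <- enum A, b <- enum B].
Proof. by rewrite [LHS]enumT unlock. Qed.

Definition score_rows (I : PL_instance) : seq data :=
  [seq enc_seq [seq enc_nat (arc_weight (x, v)) | x <- enum (vertex I)] | v <- enum (vertex I)].

Lemma polytime_score_rows : polytime PL_encode (fun I => enc_seq (score_rows I)).
Proof. exact: polytime_hd (polytime_id PL_encode). Qed.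

(** The number of vertices is read off as the number of rows of the table: starting from the empty
    list, each row increases all entries by one and puts a 0 in front. *)
Lemma polytime_vertices : polytime PL_encode (fun I => enc_map (@id (vertex I))).
Proof.
pose S (I : PL_instance) i := enc_seq [seq enc_unary j | j <- iota 0 i].
have ptR := polytime_score_rows.
have szR I : size (score_rows I) = num_vertices I by rewrite size_map size_enum_ord.
suff: polytime PL_encode (fun I => S I (size (score_rows I))).
  move/polytime_ext; apply=> // I; rewrite szR /S /enc_map; congr enc_seq.
  by rewrite -val_enum_ord -map_comp.
pose R I := data_size (enc_seq (score_rows I)).
apply: (@polytime_iter _ PL_encode _ S (fun I => 1 + R I * (2 * R I + 2))) => //.
- exact: polytime_nil.
- have pR : poly_bounded PL_encode R := polytime_bounded ptR.
  apply: poly_bounded_add; first exact: poly_bounded_const.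
  apply: poly_bounded_mul => //; apply: poly_bounded_add; last exact: poly_bounded_const.
  by apply: poly_bounded_mul => //; apply: poly_bounded_const.
- move=> I i le_i; have le_R := size_le_enc_seq (score_rows I).
  apply: leq_trans (size_enc_seq_le (C := 2 * R I + 1) _) _.
    by move=> j; rewrite mem_iota size_enc_unary /R; lia.
  by rewrite size_iota leq_add2l; apply: leq_mul; rewrite ?/R; lia.
set U := (Z in @polytime Z); set ctx := (Z in polytime Z).
have pts : polytime ctx (fun u : U => enc_seq [seq enc_unary j.+1 | j <- iota 0 (val u).2]).
  apply: (@polytime_map _ ctx (fun=> nat) (fun=> enc_unary) (fun u => iota 0 (val u).2)
    (fun _ j => enc_unary j.+1)); first exact: polytime_here.
  exact/polytime_unaryS/polytime_here.
have := polytime_cons (polytime_nil ctx) pts; move/polytime_ext; apply=> // -[[I i] ?] /=.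
by rewrite /S /= -[1]/(1 + 0) iotaDl -map_comp.
Qed.

Lemma polytime_arcs : polytime PL_encode (fun I => enc_arcs (enum {: arcs I})).
Proof.
have ptR := polytime_score_rows; have ptV := polytime_vertices.
apply: polytime_ext (_ : polytime PL_encode (fun I => enc_seq (flatten
  [seq [seq enc_arc (a, b) | b <- enum (vertex I)] | a <- enum (vertex I)]))) (frefl _) _;
  last by move=> I; rewrite /enc_arcs enum_pair map_allpairs.
apply: polytime_flatten.
apply: polytime_ext (_ : polytime PL_encode (fun I => enc_seq
  [seq enc_seq [seq enc_arc (a, b) | b <- enum (vertex I)] | a <- enum (vertex I)])) (frefl _) _;
  last by move=> I; congr enc_seq; rewrite -[RHS]map_comp; apply: eq_map.
apply: (@polytime_map _ PL_encode (fun I => vertex I) (fun I => @enc_unary \o val)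
  (fun I => enum (vertex I))
  (fun I a => enc_seq [seq enc_arc (a, b) | b <- enum (vertex I)]) ptV).
set U := (Z in @polytime Z); set ctx := (Z in polytime Z).
have pta : polytime ctx (fun u : U => enc_unary (projT2 u)) by apply: polytime_here.
have ptR1 : polytime ctx (fun u : U => enc_seq (score_rows (projT1 u))).
  exact: (polytime_weaken _ ptR).
apply: (@polytime_map _ ctx (fun u => vertex (projT1 u)) (fun u => @enc_unary \o val)
  (fun u => enum (vertex (projT1 u))) (fun u b => enc_arc (projT2 u, b))
  (polytime_weaken _ ptV)).
set U' := (Z in @polytime Z); set ctx' := (Z in polytime Z).
have ptb : polytime ctx' (fun u : U' => enc_unary (projT2 u)) by apply: polytime_here.
have pta' : polytime ctx' (fun u : U' => enc_unary (projT2 (projT1 u))).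
  exact: (polytime_weaken _ pta).
have ptR' : polytime ctx' (fun u : U' => enc_seq (score_rows (projT1 (projT1 u)))).
  exact: (polytime_weaken _ ptR1).
(* Rows belong to heads, so the weight of the arc from [a] to [b] is entry [a] of row [b]. *)
have pt_row : polytime ctx' (fun u : U' => enc_seq
    [seq enc_nat (arc_weight (x, projT2 u)) | x <- enum (vertex (projT1 (projT1 u)))]).
  have := polytime_nth ptR' ptb; move/polytime_ext; apply=> // -[[I a] b] /=.
  by rewrite (nth_map b) ?size_enum_ord // nth_ord_enum.
have pt_w : polytime ctx' (fun u : U' => enc_nat (arc_weight (projT2 (projT1 u), projT2 u))).
  have := polytime_nth pt_row pta'; move/polytime_ext; apply=> // -[[I a] b] /=.
  by rewrite (nth_map b) ?size_enum_ord // nth_ord_enum.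
exact: polytime_cons pta' (polytime_cons ptb pt_w).
Qed.

Lemma polytime_instance : polytime PL_encode enc_instance.
Proof.
have ptin := polytime_tl (polytime_id PL_encode).
apply: polytime_cons; first exact: polytime_arcs.
apply: polytime_cons; first exact: polytime_vertices.
apply: polytime_cons; first exact: polytime_tl (polytime_hd (polytime_tl ptin)).
have pts : polytime PL_encode (fun I => enc_bool (target I < 0)%R).
  exact: polytime_hd (polytime_hd ptin).
have ptt : polytime PL_encode (fun I => enc_nat `|target I|%N).
  exact: polytime_tl (polytime_hd ptin).
have := polytime_if pts (polytime_const _ (enc_nat 0)) ptt.
by move/polytime_ext; apply=> // I; rewrite /goal; case: ifP.
Qed.

Lemma polytime_decide : polytime PL_encode (fun I => enc_bool (decide I)).
Proof.
have ptin := polytime_tl (polytime_id PL_encode).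
apply: polytime_and; last exact: (polytime_reachable_goal polytime_instance).
apply/polytime_neg/polytime_and.
  exact: polytime_hd (polytime_hd (polytime_tl ptin)).
(* There is a vertex exactly when the table has a row. *)
have := polytime_if_cons polytime_score_rows (polytime_const _ (enc_bool true)) (polytime_nil _).
move/polytime_ext; apply=> // I; have : size (score_rows I) = num_vertices I.
  by rewrite size_map size_enum_ord.
by case: (score_rows I) => [|d s] <-.
Qed.

Fixpoint quote (d : data) : expr :=
  if d is DCons a b then ECons (quote a) (quote b) else ENil.

Lemma eval_quote p env d : exists t, eval p env (quote d) d t.
Proof.
elim: d => [|a [t1 ev1] b [t2 ev2]] /=; first by exists 1; constructor.
by exists (t1 + t2).+1; constructor.
Qed.

Lemma computable_const k : computable (fun=> k).
Proof. by exists [:: quote (enc_nat k)] => m; apply: eval_quote. Qed.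

Theorem theorem12 : fixed_parameter_tractable PL_additive_bounded.
Proof.
have [b [p [T [run [c Tc] _]]]] := polytime_decide.
(* The time bound has base [(data_size _).+1], at most twice the size of the input; the constant
   [2 ^ c] pays for this factor. *)
exists (b :: p), (fun=> 2 ^ c), c; split; first exact: computable_const.
move=> I; have [t run_t le_t] := run I; exists (decide I), t; split=> //.
  exact: decideP.
apply: leq_trans le_t (leq_trans (Tc I) _) => /=; rewrite -expnMn; apply: leq_exp_base.
by have := data_size_gt0 (PL_encode I); lia.
Qed.
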